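(* Let $\sigma>0$ and $\tilde\sigma=2^{2/3}\sigma$. The Brownian motion tacnode kernel $$\begin{aligned} \mathbb K^{\rm tac}_{\rm br}(\tau_1,\xi_1;\tau_2,\xi_2)=&-\mathbf 1_{\tau_2<\tau_1}\,p(\tau_1-\tau_2;\xi_1,\xi_2)+K_{\rm Ai}^{(\tau_1,-\tau_2)}(\sigma-\xi_1,\sigma-\xi_2)+K_{\rm Ai}^{(\tau_1,-\tau_2)}(\sigma+\xi_1,\sigma+\xi_2)\\ &+2^{1/3}\int_{\tilde\sigma}^\infty\bigl((1-K_{\rm Ai})^{-1}_{\tilde\sigma}\mathcal A^{-\tau_2}_{\xi_2-\sigma}\bigr)(\kappa)\Bigl(\mathcal A^{\tau_1}_{\xi_1-\sigma}(\kappa)-{\rm Ai}^{(\tau_1)}(\xi_1-\sigma+2^{1/3}\kappa)\Bigr)d\kappa\\ &+2^{1/3}\int_{\tilde\sigma}^\infty\bigl((1-K_{\rm Ai})^{-1}_{\tilde\sigma}\mathcal A^{-\tau_2}_{-\xi_2-\sigma}\bigr)(\kappa)\Bigl(\mathcal A^{\tau_1}_{-\xi_1-\sigma}(\kappa)-{\rm Ai}^{(\tau_1)}(-\xi_1-\sigma+2^{1/3}\kappa)\Bigr)d\kappa \end{aligned}$$ is equivalent to any one of the three forms (i), (ii), (iii) of the tacnode kernel $\mathbb K^{\rm tac}$ given in the context; that is, $\mathbb K^{\rm tac}_{\rm br}(\tau_1,\xi_1;\tau_2,\xi_2)=\mathbb K^{\rm tac}(\tau_1,\xi_1;\tau_2,\xi_2)$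 for all real $\tau_1,\tau_2,\xi_1,\xi_2$.
   Context: ${\rm Ai}^{(s)}(x)=\frac1{2\pi i}\int e^{z^3/3+sz^2-zx}dz=e^{sx+\frac23s^3}{\rm Ai}(x+s^2)$, the contour running from $\infty e^{-i\pi/3}$ to $\infty e^{i\pi/3}$; $$K_{\rm Ai}^{(\alpha,-\beta)}(x,y)=\int_0^\infty{\rm Ai}^{(\alpha)}(x+u){\rm Ai}^{(-\beta)}(y+u)du,\qquad K_{\rm Ai}=K_{\rm Ai}^{(0,0)},$$ $$\mathcal A^\tau_\xi(\kappa)={\rm Ai}^{(\tau)}(\xi+2^{1/3}\kappa)-\int_0^\infty{\rm Ai}^{(\tau)}(-\xi+2^{1/3}\beta)\,{\rm Ai}(\kappa+\beta)\,d\beta,\qquad p(\tau;\xi_1,\xi_2)=\frac{e^{-(\xi_1-\xi_2)^2/(4\tau)}}{\sqrt{4\pi\tau}}.$$ $(1-K_{\rm Ai})^{-1}_{\tilde\sigma}$ is the inverse of $1-K_{\rm Ai}$ on $L^2(\tilde\sigma,\infty)$. The tacnode kernel $\mathbb K^{\rm tac}(\tau_1,\xi_1;\tau_2,\xi_2)$ has the following three equal forms. (i) $-\mathbf 1_{\tau_1>\tau_2}p(\tau_1-\tau_2;\xi_1,\xi_2)+K_{\rm Ai}^{(\tau_1,-\tau_2)}(\sigma-\xi_1,\sigma-\xi_2)+2^{1/3}\int_{\tilde\sigma}^\infty\bigl((1-K_{\rm Ai})^{-1}_{\tilde\sigma}\mathcal A^{\tau_1}_{\xi_1-\sigma}\bigr)(\lambda)\,\mathcal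 A^{-\tau_2}_{\xi_2-\sigma}(\lambda)\,d\lambda.$ (ii) $-\mathbf 1_{\tau_1>\tau_2}p(\tau_1-\tau_2;\xi_1,\xi_2)+2^{1/3}\int_{\tilde\sigma}^\infty\bigl[\bigl((1-K_{\rm Ai})^{-1}_{\tilde\sigma}\mathcal A^{\tau_1}_{\xi_1-\sigma}\bigr)(\lambda)\,{\rm Ai}^{(-\tau_2)}(\xi_2-\sigma+2^{1/3}\lambda)+\{\xi_1\to-\xi_1,\xi_2\to-\xi_2\}\bigr]d\lambda.$ (iii) With $E(u,v)=e^{\xi_1u-\xi_2v}+e^{-\xi_1u+\xi_2v}$ and any $\delta>0$, $$\begin{aligned} &-\mathbf 1_{\tau_2<\tau_1}p(\tau_1-\tau_2;\xi_1,\xi_2)+\mathcal C(\tau_1-\tau_2,\xi_1-\xi_2)\\ &+\frac1{(2\pi i)^2}\int_{\delta+i\mathbb R}du\int_{-\delta+i\mathbb R}dv\,\frac{e^{\frac{u^3}3-\sigma u+\tau_1u^2}}{e^{\frac{v^3}3-\sigma v+\tau_2v^2}}E(u,v)\frac{(1-\hat{\mathcal P}(u))(1-\hat{\mathcal P}(-v))}{u-v}\\ &-\frac1{(2\pi i)^2}\int_{2\delta+i\mathbb R}du\int_{\delta+i\mathbb R}dv\,\frac{e^{\frac{u^3}3-\sigma u+\tau_1u^2}}{e^{-\frac{v^3}3-\sigma v+\tau_2v^2}}E(u,v)\frac{(1-\hat{\mathcal P}(u))\hat{\mathcal Q}(-v)}{u-v}\\ &-\frac1{(2\pi i)^2}\int_{-\delta+i\mathbb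 R}du\int_{-2\delta+i\mathbb R}dv\,\frac{e^{-\frac{u^3}3-\sigma u+\tau_1u^2}}{e^{\frac{v^3}3-\sigma v+\tau_2v^2}}E(u,v)\frac{(1-\hat{\mathcal P}(-v))\hat{\mathcal Q}(u)}{u-v}\\ &+\frac1{(2\pi i)^2}\int_{-\delta+i\mathbb R}du\int_{\delta+i\mathbb R}dv\,\frac{e^{-\frac{u^3}3-\sigma u+\tau_1u^2}}{e^{-\frac{v^3}3-\sigma v+\tau_2v^2}}E(u,v)\frac{\hat{\mathcal Q}(u)\hat{\mathcal Q}(-v)}{u-v}, \end{aligned}$$ where $$\mathcal Q(\kappa)=\bigl[(1-K_{\rm Ai})^{-1}_{\tilde\sigma}{\rm Ai}\bigr](\kappa)\ (\kappa\ge\tilde\sigma),\quad\hat{\mathcal Q}(\zeta)=\int_{\tilde\sigma}^\infty\mathcal Q(\kappa)e^{2^{1/3}\kappa\zeta}d\kappa,\quad\hat{\mathcal P}(\zeta)=-\int_{\tilde\sigma}^\infty\mathcal Q(\kappa)d\kappa\int_0^\infty e^{-2^{1/3}\zeta\beta}{\rm Ai}(\kappa+\beta)d\beta,$$ $$\mathcal C(s,\xi)=2^{-1/3}\int_{\tilde\sigma}^\infty d\kappa\,\mathcal Q(\kappa)\Bigl[{\rm Ai}^{(2^{-2/3}s)}(\kappa+2^{-1/3}\xi)+\int_{\tilde\sigma}^\infty d\lambda\,\mathcal Q(\lambda)\int_0^\infty d\alpha\,{\rm Ai}(\alpha+\lambda){\rm Ai}^{(2^{-2/3}s)}(\alpha+\kappa+2^{-1/3}\xi)\Bigr]+(\xi\to-\xi)$$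 (the whole preceding expression with $\xi$ replaced by $-\xi$ is added).
   Formalization: Form (iii) is proved for every δ > max(0, −τ1, τ2) rather than any δ > 0: for δ < −τ1 or δ < τ2 the first double integral over the straight lines ±δ+iℝ diverges, and at equality it is not absolutely convergent. *)

(* Defs.v *)
From mathcomp Require Import all_boot all_order all_algebra.
From mathcomp Require Import all_classical all_reals all_analysis.
From mathcomp Require Import complex.

Set Implicit Arguments.
Unset Strict Implicit.
Unset Printing Implicit Defensive.

Import Order.TTheory GRing.Theory Num.Theory.
Import numFieldNormedType.Exports.

Local Open Scope classical_set_scope.
Local Open Scope ring_scope.
Local Open Scope complex_scope.

Section ComplexIntegrals.
Context {R : realType}.

Definition cexp (z : R[i]) : R[i] :=
  (expR (complex.Re z))%:C * (cos (complex.Im z) +i* sin (complex.Im z)).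

Definition cintegral (D : set R) (f : R -> R[i]) : R[i] :=
  (\int[lebesgue_measure]_(t in D) complex.Re (f t)) +i*
  (\int[lebesgue_measure]_(t in D) complex.Im (f t)).

Lemma Re_cintegral (D : set R) (f : R -> R[i]) :
  complex.Re (cintegral D f) = \int[lebesgue_measure]_(t in D) complex.Re (f t).
Proof. by []. Qed.

(* Integral of f dz along the ray from 0 to w * oo, parametrized by z = r w. *)
Definition ray_integral (w : R[i]) (f : R[i] -> R[i]) : R[i] :=
  cintegral `[0, +oo[ (fun r => f (r%:C * w) * w).

(* Integral of f dz along c + i R, oriented upwards. *)
Definition line_integral (c : R) (f : R[i] -> R[i]) : R[i] :=
  cintegral setT (fun t => f (c +i* t) * 'i).

Definition two_pi_i : R[i] := (2 * pi)%:C * 'i.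

End ComplexIntegrals.

Section Airy.
Context {R : realType}.

Definition airy_integrand (s x : R) (z : R[i]) : R[i] :=
  cexp (z ^+ 3 / 3%:R + s%:C * z ^+ 2 - x%:C * z).

(* The contour from oo e^(-i pi/3) to oo e^(i pi/3) consists of two rays. *)
Definition airyC (s x : R) : R[i] :=
  two_pi_i^-1 *
  (ray_integral (cexp (0 +i* (pi / 3%:R))) (airy_integrand s x) -
   ray_integral (cexp (0 +i* - (pi / 3%:R))) (airy_integrand s x)).

Definition airys (s x : R) : R := complex.Re (airyC s x).

Definition airy (x : R) : R := airys 0 x.

Lemma cexp_conj (z : R[i]) : cexp z^* = (cexp z)^*.
Proof.
case: z => a b; rewrite /cexp /= cosN sinN.
by apply/eqP; rewrite eq_complex /=; apply/andP; split; apply/eqP;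
  rewrite ?mul0r ?mulr0 ?subr0 ?addr0 ?oppr0 ?mulrN // ?subr0 ?addr0.
Qed.

Lemma conjc_real_complex (a : R) : (a%:C)^* = a%:C.
Proof. by rewrite /= oppr0. Qed.

Lemma airy_integrand_conj (s x : R) (z : R[i]) :
  airy_integrand s x z^* = (airy_integrand s x z)^*.
Proof.
rewrite /airy_integrand -cexp_conj; congr cexp.
rewrite -[z ^+ 3]/(z * (z * z)) -[z ^+ 2]/(z * z) -[z^* ^+ 3]/(z^* * (z^* * z^*)).
rewrite -[z^* ^+ 2]/(z^* * z^*) !rmorphB rmorphD !rmorphM fmorphV rmorph_nat.
by rewrite -[in RHS](conjc_real_complex s) -[in RHS](conjc_real_complex x) /= !oppr0.
Qed.

(* Taking the real part in airys loses nothing. *)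
Lemma airyCE (s x : R) : airyC s x = (airys s x)%:C.
Proof.
suff : complex.Im (airyC s x) = 0.
  by rewrite /airys; case: (airyC s x) => a b /= ->.
set f := airy_integrand s x.
set w := @cexp R (0 +i* (pi / 3%:R)).
have wE : @cexp R (0 +i* - (pi / 3%:R)) = w^*.
  by rewrite -cexp_conj /= ?oppr0.
have ReE : complex.Re (ray_integral w f) = complex.Re (ray_integral w^* f).
  rewrite /ray_integral !Re_cintegral; congr Rintegral; apply/funext => r.
  have rE : r%:C * w^* = (r%:C * w)^*.
    by rewrite -[in LHS](conjc_real_complex r) -rmorphM.
  have -> : f (r%:C * w^*) * w^* = (f (r%:C * w) * w)^*.
    by rewrite rE /f airy_integrand_conj -rmorphM.
  by case: (f _ * w).
rewrite /airyC wE /two_pi_i.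
move: ReE; case: (ray_integral w f) => a b; case: (ray_integral w^* f) => c d /= ->.
by rewrite subrr !mul0r !mulr0 !subr0 ?mul0r ?addr0 ?add0r ?mul0r ?mulr0 ?addr0.
Qed.

End Airy.

Section Resolvent.
Context {R : realType}.

Definition KAi_shift (s1 s2 x y : R) : R :=
  \int[lebesgue_measure]_(u in `[0, +oo[) (airys s1 (x + u) * airys s2 (y + u)).

Definition KAi (x y : R) : R := KAi_shift 0 0 x y.

(* L^2(a, +oo) is embedded in L^2(R) by extending functions by zero. *)
Definition L2 (a : R) (f : R -> R) : Prop :=
  f \_ `]a, +oo[ \in Lfun lebesgue_measure 2%:E.

Definition one_minus_KAi (a : R) (g : R -> R) (x : R) : R :=
  g x - \int[lebesgue_measure]_(y in `]a, +oo[) (KAi x y * g y).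

(* (1 - K_Ai)^-1 f on L^2(a, +oo): the solution g of (1 - K_Ai) g = f as elements
   of L^2(a, +oo). Since g is only determined up to a null set (and outside
   ]a, +oo[ not at all), some representative is chosen. *)
Definition KAi_resolvent (a : R) (f : R -> R) : R -> R :=
  get [set g | L2 a g /\
    one_minus_KAi a g = f %[ae lebesgue_measure in `]a, +oo[%classic]].

End Resolvent.

Section TacnodeKernels.
Context {R : realType}.
Implicit Types (sigma : R).

Definition cbrt2 : R := 2 `^ (1 / 3).

Definition sigma_tilde sigma : R := 2 `^ (2 / 3) * sigma.

Definition calA (tau xi kappa : R) : R :=
  airys tau (xi + cbrt2 * kappa) -
  \int[lebesgue_measure]_(beta in `[0, +oo[)
    (airys tau (- xi + cbrt2 * beta) * airy (kappa + beta)).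

Definition heat_p (tau xi1 xi2 : R) : R :=
  expR (- ((xi1 - xi2) ^+ 2 / (4 * tau))) / Num.sqrt (4 * pi * tau).

Definition heat_part (tau1 xi1 tau2 xi2 : R) : R :=
  if tau2 < tau1 then heat_p (tau1 - tau2) xi1 xi2 else 0.

Definition tacnode_br sigma (tau1 xi1 tau2 xi2 : R) : R :=
  let a := sigma_tilde sigma in
  - heat_part tau1 xi1 tau2 xi2
  + KAi_shift tau1 (- tau2) (sigma - xi1) (sigma - xi2)
  + KAi_shift tau1 (- tau2) (sigma + xi1) (sigma + xi2)
  + cbrt2 * \int[lebesgue_measure]_(kappa in `]a, +oo[)
      (KAi_resolvent a (calA (- tau2) (xi2 - sigma)) kappa *
       (calA tau1 (xi1 - sigma) kappa -
        airys tau1 (xi1 - sigma + cbrt2 * kappa)))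
  + cbrt2 * \int[lebesgue_measure]_(kappa in `]a, +oo[)
      (KAi_resolvent a (calA (- tau2) (- xi2 - sigma)) kappa *
       (calA tau1 (- xi1 - sigma) kappa -
        airys tau1 (- xi1 - sigma + cbrt2 * kappa))).

Definition tacnode_i sigma (tau1 xi1 tau2 xi2 : R) : R :=
  let a := sigma_tilde sigma in
  - heat_part tau1 xi1 tau2 xi2
  + KAi_shift tau1 (- tau2) (sigma - xi1) (sigma - xi2)
  + cbrt2 * \int[lebesgue_measure]_(lambda in `]a, +oo[)
      (KAi_resolvent a (calA tau1 (xi1 - sigma)) lambda *
       calA (- tau2) (xi2 - sigma) lambda).

Definition tacnode_ii sigma (tau1 xi1 tau2 xi2 : R) : R :=
  let a := sigma_tilde sigma in
  - heat_part tau1 xi1 tau2 xi2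
  + cbrt2 * \int[lebesgue_measure]_(lambda in `]a, +oo[)
      (KAi_resolvent a (calA tau1 (xi1 - sigma)) lambda *
       airys (- tau2) (xi2 - sigma + cbrt2 * lambda) +
       KAi_resolvent a (calA tau1 (- xi1 - sigma)) lambda *
       airys (- tau2) (- xi2 - sigma + cbrt2 * lambda)).

Definition calQ sigma : R -> R := KAi_resolvent (sigma_tilde sigma) airy.

Definition hatQ sigma (zeta : R[i]) : R[i] :=
  cintegral `]sigma_tilde sigma, +oo[
    (fun kappa => (calQ sigma kappa)%:C * cexp ((cbrt2 * kappa)%:C * zeta)).

Definition hatP sigma (zeta : R[i]) : R[i] :=
  - cintegral `]sigma_tilde sigma, +oo[
      (fun kappa => (calQ sigma kappa)%:C *
         cintegral `[0, +oo[ (fun beta =>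
           cexp (- (cbrt2 * beta)%:C * zeta) * (airy (kappa + beta))%:C)).

Definition calC_half sigma (s xi : R) : R :=
  let a := sigma_tilde sigma in
  let s' := 2 `^ (- (2 / 3)) * s in
  let xi' := 2 `^ (- (1 / 3)) * xi in
  2 `^ (- (1 / 3)) * \int[lebesgue_measure]_(kappa in `]a, +oo[)
    (calQ sigma kappa *
     (airys s' (kappa + xi') +
      \int[lebesgue_measure]_(lambda in `]a, +oo[)
        (calQ sigma lambda *
         \int[lebesgue_measure]_(alpha in `[0, +oo[)
           (airy (alpha + lambda) * airys s' (alpha + kappa + xi'))))).

Definition calC sigma (s xi : R) : R :=
  calC_half sigma s xi + calC_half sigma s (- xi).

Definition tacE (xi1 xi2 : R) (u v : R[i]) : R[i] :=
  cexp (xi1%:C * u - xi2%:C * v) + cexp (xi2%:C * v - xi1%:C * u).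

(* e^(z^3/3 - sigma z + tau z^2) and e^(-z^3/3 - sigma z + tau z^2) *)
Definition cubic_plus sigma (tau : R) (z : R[i]) : R[i] :=
  cexp (z ^+ 3 / 3%:R - sigma%:C * z + tau%:C * z ^+ 2).

Definition cubic_minus sigma (tau : R) (z : R[i]) : R[i] :=
  cexp (- (z ^+ 3 / 3%:R) - sigma%:C * z + tau%:C * z ^+ 2).

(* (2 pi i)^-2 times the integral of F(u, v) over u in cu + i R, v in cv + i R *)
Definition double_line_integral (cu cv : R) (F : R[i] -> R[i] -> R[i]) : R[i] :=
  (two_pi_i ^+ 2)^-1 *
  line_integral cu (fun u => line_integral cv (fun v => F u v)).

(* On the lines below, the integrands decay at least like
   e^(-(delta + tau1) (Im u)^2 - (delta - tau2) (Im v)^2) up to constants, hence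
   the integrals converge when delta > max(0, - tau1, tau2). When delta < - tau1
   or delta < tau2 the first one grows exponentially and diverges. *)
Definition tacnode_iii (delta sigma tau1 xi1 tau2 xi2 : R) : R[i] :=
  let P := hatP sigma in
  let Q := hatQ sigma in
  let E := tacE xi1 xi2 in
  - (heat_part tau1 xi1 tau2 xi2)%:C
  + (calC sigma (tau1 - tau2) (xi1 - xi2))%:C
  + double_line_integral delta (- delta) (fun u v =>
      cubic_plus sigma tau1 u / cubic_plus sigma tau2 v * E u v *
      ((1 - P u) * (1 - P (- v)) / (u - v)))
  - double_line_integral (2 * delta) delta (fun u v =>
      cubic_plus sigma tau1 u / cubic_minus sigma tau2 v * E u v *
      ((1 - P u) * Q (- v) / (u - v)))
  - double_line_integral (- delta) (- (2 * delta)) (fun u v =>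
      cubic_minus sigma tau1 u / cubic_plus sigma tau2 v * E u v *
      ((1 - P (- v)) * Q u / (u - v)))
  + double_line_integral (- delta) delta (fun u v =>
      cubic_minus sigma tau1 u / cubic_minus sigma tau2 v * E u v *
      (Q u * Q (- v) / (u - v))).

End TacnodeKernels.

(* Main.v *)
(* Write a = sigma_tilde, c = 2^(1/3), kappa = a + x, let T be the Hankel operator
   with kernel t(x + y) = Ai(a + x + y) on L^2(0, oo), so that K_Ai becomes T^2, and
   let R = (1 - T^2)^-1. With h_i^+-(x) = Ai^(s_i)(+-xi_i + sigma + c x), s_1 = tau_1,
   s_2 = - tau_2, one has A^(s_i)_(+-xi_i - sigma)(a + x) = h_i^+- - T h_i^-+, and T
   is symmetric and commutes with R; hence the Brownian form, (i) and (ii) all equal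
     - p + c sum_+- (<R h_1^+-, h_2^+-> - <R T h_1^-+, h_2^+->).

   For (iii), put q = R t, p = T q and (k * f)(w) = int_(x > 0) k(x) f(x + w) dx.
   The functions hatQ and 1 - hatP are Laplace transforms of q and of delta_0 + p, and
   1/z = int_0^oo e^(-z y) dy turns the four double contour integrals into integrals
   over w > 0 of products of (delta_0 + p) * h and q * h, taken at w or at - w. Two
   identities evaluate them:
     <R f, g> = int_(w > 0) ((f + p * f)(g + p * g) - (q * f)(q * g)),
     - <R T f, g> = int_(w > 0) ((f + p * f)(- w) (q * g)(w)
                                 - (q * f)(- w) (g + p * g)(w)).
   In the first one the difference of the right-hand sides for (f, g) and (T f, T g)
   is <f, g>, and T is a contraction; in the second one the cofactor of f vanishes on
   the negative axis, since correlations commute, which leaves the first identity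
   for (T f, g).
   The term C equals the integral of ((delta_0 + p) * h_1)(w) (q * h_2)(- w) over the
   whole line, by the convolution formula for Ai^(s), which follows from Parseval's
   identity on a vertical line. *)

Require Import Defs.
From mathcomp Require Import all_boot all_order all_algebra.
From mathcomp Require Import all_classical all_reals all_analysis.
From mathcomp Require Import measurable_realfun complex ring lra.

Set Implicit Arguments.
Unset Strict Implicit.
Unset Printing Implicit Defensive.

Import Order.TTheory GRing.Theory Num.Theory.
Import numFieldNormedType.Exports.

Local Open Scope classical_set_scope.
Local Open Scope ring_scope.
Local Open Scope complex_scope.

(** * Integration over the real line *)

Section Measurability.
Context {R : realType}.

(** The analysis rests on one number. On the line Re z = 1 the contour integral gives |Ai(x)| <= C
    e^(-x) with C = e^(1/3)/2 < 2, and since a >= 0 the same constant bounds the kernel t.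
    Integrating two decaying factors gains 1/2, so T contracts by C/2 < 1 in the norm sup |f(x)|
    e^x. Hence 1 - T^2 is inverted by a pointwise Neumann series, without spectral information on
    the Airy operator, and identities for R can be proved by iterating T. Three obstacles shape the
    rest. The resolvent of the statement is an arbitrary representative in L^2, so each pairing with
    it is first transferred almost everywhere to the Neumann resolvent. In (iii) the functions h are
    evaluated on the negative axis, where they may grow; on the whole line |h(x)| <= A e^(-m x) for
    every large m, and the rates m and m + 1 on two opposed factors leave e^(-|w|). Finally, Ai is
    defined on two rays, whereas estimates and Fourier analysis need vertical lines; Green's formula
    along a homotopy of contours makes the passage. *)

Definition mf d (T : measurableType d) (f : T -> R) := measurable_fun [set: T] f.

(** Half-line integrals are written as integrals over the whole line with this factor, so that
    translations, reflections and Fubini apply in one form. *)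
Definition pos (x : R) : R := ((0 < x)%R : nat)%:R.

Lemma pos_ge0 x : 0 <= pos x.
Proof. exact: ler0n. Qed.

Lemma pos_le1 x : pos x <= 1.
Proof. by rewrite /pos lern1 leq_b1. Qed.

Lemma pos1 x : 0 < x -> pos x = 1.
Proof. by rewrite /pos => ->. Qed.

Lemma pos0 x : x <= 0 -> pos x = 0.
Proof. by rewrite /pos ltNge => ->. Qed.

Section Generic.
Context d (T : measurableType d).
Implicit Types f g : T -> R.

Lemma mf_cst (k : R) : mf (fun _ : T => k).
Proof. exact: measurable_cst. Qed.

Lemma mfD f g : mf f -> mf g -> mf (fun x => f x + g x).
Proof. exact: measurable_funD. Qed.

Lemma mfN f : mf f -> mf (fun x => - f x).
Proof. exact: measurable_funN. Qed.

Lemma mfM f g : mf f -> mf g -> mf (fun x => f x * g x).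
Proof. exact: measurable_funM. Qed.

Lemma mfX f n : mf f -> mf (fun x => f x ^+ n).
Proof. exact: measurable_funX. Qed.

Lemma mf_comp (h : R -> R) f : mf h -> mf f -> mf (fun x => h (f x)).
Proof. by move=> mh mf0; exact: (measurableT_comp mh mf0). Qed.

Lemma mf_exp f : mf f -> mf (fun x => expR (f x)).
Proof. by apply: mf_comp; exact: measurable_expR. Qed.

Lemma mf_cos f : mf f -> mf (fun x => cos (f x)).
Proof.
by apply: mf_comp; apply: continuous_measurable_fun; exact: continuous_cos.
Qed.

Lemma mf_sin f : mf f -> mf (fun x => sin (f x)).
Proof.
by apply: mf_comp; apply: continuous_measurable_fun; exact: continuous_sin.
Qed.

Lemma mf_norm f : mf f -> mf (fun x => `|f x|).
Proof. by apply: mf_comp; exact: normr_measurable. Qed.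

Lemma mf_pos f : mf f -> mf (fun x => pos (f x)).
Proof.
apply: (@mf_comp pos).
have -> : pos = \1_(`]0, +oo[%classic : set R).
  by apply/funext => x; rewrite indicE mem_setE in_itv /= andbT.
exact: measurable_indic.
Qed.

End Generic.

Lemma mf_id : mf (fun x : R => x).
Proof. exact: measurable_id. Qed.

Lemma mf_fst : mf (fun z : R * R => z.1).
Proof. exact: measurable_fst. Qed.

Lemma mf_snd : mf (fun z : R * R => z.2).
Proof. exact: measurable_snd. Qed.

End Measurability.

Ltac mf_tac := repeat match goal with
  | H : mf ?f |- mf ?f => exact H
  | |- mf (fun _ => ?k) => exact: mf_cst
  | |- mf (fun x => x) => exact: mf_id
  | |- mf id => exact: mf_id
  | |- mf fst => exact: mf_fst
  | |- mf snd => exact: mf_snd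
  | |- mf (fun x => expR _) => apply: mf_exp
  | |- mf (fun x => cos _) => apply: mf_cos
  | |- mf (fun x => sin _) => apply: mf_sin
  | |- mf (fun x => (_ + _)%R) => apply: mfD
  | |- mf (fun x => (- _)%R) => apply: mfN
  | |- mf (fun x => (_ * _)%R) => apply: mfM
  | |- mf (fun x => (_ ^+ _)%R) => apply: mfX
  | |- mf (fun x => `| _ |%R) => apply: mf_norm
  | |- mf (-%R) => exact: (mfN mf_id)
  | |- mf ( *%R ?k) => exact: (mfM (mf_cst k) mf_id)
  | |- mf (+%R ?k) => exact: (mfD (mf_cst k) mf_id)
  | |- mf pos => exact: (mf_pos mf_id)
  | |- mf (fun x => pos _) => apply: mf_pos
  | H : mf ?h |- mf (fun x => ?h _) => apply: (mf_comp H)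
  end.

Section RealIntegral.
Context {R : realType}.
Implicit Types f g : R -> R.
Local Notation mu := (@lebesgue_measure R).

Definition I f : R := \int[mu]_x f x.
Definition J f : Prop := mu.-integrable setT (EFin \o f).

Lemma J_mf f : J f -> mf f.
Proof. by move=> /measurable_int /measurable_EFinP. Qed.

Lemma J_dom f g : mf f -> (forall x, `|f x| <= g x) -> J g -> J f.
Proof.
move=> mf0 fg Jg; apply: le_integrable Jg => //; first exact/measurable_EFinP.
by move=> x _ /=; rewrite lee_fin (le_trans (fg x))// ler_norm.
Qed.

Lemma EI f : J f -> (\int[mu]_x (f x)%:E)%E = (I f)%:E.
Proof. by move=> Jf; rewrite /I /Rintegral fineK//; exact: integrable_fin_num. Qed.

Lemma I_ext f g : f =1 g -> I f = I g.
Proof. by move=> /funext ->. Qed.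

Lemma J_ext f g : f =1 g -> J f -> J g.
Proof. by move=> /funext ->. Qed.

Lemma JD f g : J f -> J g -> J (fun x => f x + g x).
Proof. by move=> Jf Jg; have := integrableD measurableT Jf Jg. Qed.

Lemma JB f g : J f -> J g -> J (fun x => f x - g x).
Proof. by move=> Jf Jg; have := integrableB measurableT Jf Jg. Qed.

Lemma JZ k f : J f -> J (fun x => k * f x).
Proof. by move=> Jf; have := integrableZl measurableT k Jf. Qed.

Lemma JZr k f : J f -> J (fun x => f x * k).
Proof. by move=> Jf; have := integrableZr measurableT k Jf. Qed.

Lemma J_norm f : J f -> J (fun x => `|f x|).
Proof. by move=> Jf; have := integrable_norm Jf. Qed.

Lemma J0 : J (fun=> 0).
Proof. exact: integrable0. Qed.

Lemma ID f g : J f -> J g -> I (fun x => f x + g x) = I f + I g.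
Proof. by move=> Jf Jg; rewrite /I RintegralD. Qed.

Lemma IB f g : J f -> J g -> I (fun x => f x - g x) = I f - I g.
Proof. by move=> Jf Jg; rewrite /I RintegralB. Qed.

Lemma IZ k f : J f -> I (fun x => k * f x) = k * I f.
Proof. by move=> Jf; rewrite /I RintegralZl. Qed.

Lemma IZr k f : J f -> I (fun x => f x * k) = I f * k.
Proof. by move=> Jf; rewrite /I RintegralZr. Qed.

Lemma I0 : I (fun=> 0) = 0.
Proof. by rewrite /I /Rintegral integral0. Qed.

Lemma IN f : J f -> I (fun x => - f x) = - I f.
Proof.
move=> Jf; rewrite -[RHS]mulN1r -IZ//.
by apply: I_ext => x; rewrite mulN1r.
Qed.

Lemma I_le f g : J f -> J g -> (forall x, f x <= g x) -> I f <= I g.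
Proof. by move=> Jf Jg fg; apply: le_Rintegral. Qed.

Lemma I_ge0 f : (forall x, 0 <= f x) -> 0 <= I f.
Proof. by move=> f0; apply: Rintegral_ge0. Qed.

Lemma I_norm_le f g : mf f -> (forall x, `|f x| <= g x) -> J g -> `|I f| <= I g.
Proof.
move=> mf0 fg Jg; have Jf := J_dom mf0 fg Jg.
apply: le_trans (le_normr_Rintegral _ Jf) _ => //.
by apply: I_le => //; exact: J_norm.
Qed.

Lemma J_fin f M : mf f -> (forall x, 0 <= f x) ->
  (\int[mu]_x (f x)%:E <= M%:E)%E -> J f.
Proof.
move=> mf0 f0 fM; apply/integrableP; split; first exact/measurable_EFinP.
under eq_integral do rewrite /= ger0_norm//.
exact: le_lt_trans fM (ltry _).
Qed.

Section MeasurePreserving.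
Variables (k : R) (phi : R -> R).
Hypothesis k_gt0 : 0 < k.
Hypothesis mphi : measurable_fun setT (phi : measurableTypeR R -> measurableTypeR R).

Let kn : {nonneg R} := NngNum (ltW k_gt0).

Hypothesis phi_itv : forall p q : R,
  mu `]p, q]%classic = (k%:E * mu (phi @^-1` `]p, q]%classic))%E.

(** [k] times the pushforward of Lebesgue measure by [phi] agrees with Lebesgue measure on half-open
    intervals, hence on all measurable sets. *)
Let eintegral_phi (f : R -> R) : mf f -> (forall x, 0 <= f x) ->
  (\int[mu]_x (f x)%:E = k%:E * \int[mu]_x (f (phi x))%:E)%E.
Proof.
move=> mf0 f0.
rewrite -(@ge0_integral_pushforward _ _ (measurableTypeR R) (measurableTypeR R) _ phi mphi mu setT (EFin \o f))//=; last 2 first.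
  by apply/measurable_EFinP.
  by move=> y _; rewrite lee_fin.
rewrite -[k%:E]/((kn%:num)%:E) -ge0_integral_mscale//=; last 2 first.
  by apply/measurable_EFinP.
  by move=> x _; rewrite lee_fin.
apply: eq_measure_integral => A mA _.
apply: lebesgue_measure_unique => //= _ [[p q]] _ <-.
exact: phi_itv.
Qed.

Lemma change_of_variable f : J f ->
  J (fun x => f (phi x)) /\ I (fun x => f (phi x)) = k^-1 * I f.
Proof.
have k0 : k != 0 by rewrite gt_eqF.
have nonneg g : J g -> (forall x, 0 <= g x) ->
    J (fun x => g (phi x)) /\ I (fun x => g (phi x)) = k^-1 * I g.
  move=> Jg g0; have mg := J_mf Jg.
  have := eintegral_phi mg g0; rewrite (EI Jg) => E.
  have E' : (\int[mu]_x (g (phi x))%:E = (k^-1 * I g)%:E)%E.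
    rewrite EFinM E muleA -EFinM mulVf// mul1e//.
  have Jp : J (fun x => g (phi x)).
    apply: (@J_fin _ (k^-1 * I g)) => //; last by rewrite E'.
    exact: (measurableT_comp mg mphi).
  split=> //; have := EI Jp; rewrite E' => -[] ->//.
move=> Jf; have Jn := J_norm Jf; have Jd := JB Jn Jf.
have [|J1 I1] := nonneg _ Jn; first by [].
have [|J2 I2] := nonneg _ Jd; first by move=> x; rewrite subr_ge0 ler_norm.
(* Both terms of the difference are nonnegative and integrable, which reduces the signed case to the
   nonnegative one. *)
have fE x : f x = `|f x| - (`|f x| - f x) by rewrite subKr.
split; first by apply: J_ext (JB J1 J2) => x /=; rewrite -fE.
rewrite (@I_ext _ (fun x => `|f (phi x)| - (`|f (phi x)| - f (phi x)))) => [|x]; last by rewrite -fE.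
rewrite IB// I1 I2 -mulrBr; congr (_ * _).
by rewrite IB//; ring.
Qed.

End MeasurePreserving.

Section Substitutions.
Implicit Types a k : R.

Let affine f k a : 0 < k -> J f ->
  J (fun x => f (k * x + a)) /\ I (fun x => f (k * x + a)) = k^-1 * I f.
Proof.
move=> k0; apply: (@change_of_variable k (fun x => k * x + a)) => //.
  by apply: (@measurable_funD _ (measurableTypeR R)) => //; exact: mulrl_measurable.
move=> p q.
have -> : (fun x => k * x + a) @^-1` `]p, q]%classic =
    `](p - a) / k, (q - a) / k]%classic.
  by apply/seteqP; split => x; rewrite /= !in_itv /=
    ltr_pdivrMr// ler_pdivlMr// ltrBlDr lerBrDr (mulrC x).
rewrite !lebesgue_measure_itv/= !lte_fin ltr_pM2r ?invr_gt0// ltrD2r.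
case: ifP => _; last by rewrite mule0.
rewrite -!EFinB -EFinM; congr EFin.
by field; rewrite gt_eqF.
Qed.

Lemma J_shift f a : J f -> J (fun x => f (x + a)).
Proof. by move=> /(affine a ltr01)[Jf _]; apply: J_ext Jf => x; rewrite mul1r. Qed.

Lemma I_shift f a : J f -> I (fun x => f (x + a)) = I f.
Proof.
move=> /(affine a ltr01)[_]; rewrite invr1 mul1r => <-.
by apply: I_ext => x; rewrite mul1r.
Qed.

Lemma J_scale f k : 0 < k -> J f -> J (fun x => f (k * x)).
Proof. by move=> k0 /(affine 0 k0)[Jf _]; apply: J_ext Jf => x; rewrite addr0. Qed.

Lemma I_scale f k : 0 < k -> J f -> I (fun x => f (k * x)) = k^-1 * I f.
Proof.
move=> k0 /(affine 0 k0)[_ <-].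
by apply: I_ext => x; rewrite addr0.
Qed.

Let opp f : J f -> J (fun x => f (- x)) /\ I (fun x => f (- x)) = 1^-1 * I f.
Proof.
apply: (@change_of_variable 1 -%R) => //.
move=> p q; rewrite mul1e -(@lebesgue_measureN R)//.
Qed.

Lemma J_opp f : J f -> J (fun x => f (- x)).
Proof. by move=> /opp[]. Qed.

Lemma I_opp f : J f -> I (fun x => f (- x)) = I f.
Proof. by move=> /opp[_]; rewrite invr1 mul1r. Qed.

End Substitutions.

Section RealFubini.
Implicit Types F : R -> R -> R.

Lemma mf_section1 F x : mf (fun z : R * R => F z.1 z.2) -> mf (F x).
Proof. by move=> mF; exact: (measurableT_comp mF (pair1_measurable x)). Qed.

Lemma mf_section2 F y : mf (fun z : R * R => F z.1 z.2) -> mf (F ^~ y).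
Proof. by move=> mF; exact: (measurableT_comp mF (pair2_measurable y)). Qed.

Lemma mf_swap F : mf (fun z : R * R => F z.1 z.2) ->
  mf (fun z : R * R => F z.2 z.1).
Proof. by move=> mF; exact: (measurableT_comp mF (@measurable_swap _ _ _ _)). Qed.

Lemma mf_I F : mf (fun z : R * R => F z.1 z.2) -> mf (fun x => I (F x)).
Proof.
move=> mF; pose G (z : R * R) : \bar R := (F z.1 z.2)%:E.
have mG : measurable_fun setT G by apply/measurable_EFinP.
have mp : measurable_fun setT (fun x => \int[mu]_y G^\+%E (x, y))%E.
  by apply: (measurable_fun_fubini_tonelli_F (m2 := mu) (G^\+)%E) => //; exact: measurable_funepos.
have mn : measurable_fun setT (fun x => \int[mu]_y G^\-%E (x, y))%E.
  by apply: (measurable_fun_fubini_tonelli_F (m2 := mu) (G^\-)%E) => //; exact: measurable_funeneg.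
have -> : (fun x => I (F x)) =
    fine \o (fun x => \int[mu]_y G^\+%E (x, y) - \int[mu]_y G^\-%E (x, y))%E.
  apply/funext => x; rewrite /I /Rintegral /= integralE; congr (fine (_ - _)%E);
    by apply: eq_integral => y _; rewrite ?funeposE ?funenegE.
apply: measurableT_comp; first exact: fine_measurable.
exact: emeasurable_funB.
Qed.

Section Dominated.
Variables (F G : R -> R -> R) (A : R -> R).
Hypotheses (mF : mf (fun z : R * R => F z.1 z.2)) (JA : J A)
  (FG : forall x y, `|F x y| <= G x y) (JG : forall x, J (G x))
  (GA : forall x, I (G x) <= A x).

(** Only the sections [G x] have to be integrable, with integrals below [A]; this covers products
    [A x * B y] as well as dominants [A x * B (y + x)] of convolution type. *)
Let jF : (mu \x mu)%E.-integrable setT (fun z : R * R => (F z.1 z.2)%:E).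
Proof.
apply/integrable12ltyP => /=; first exact/measurable_EFinP.
apply: (@le_lt_trans _ _ (\int[mu]_x (A x)%:E)%E); last by rewrite EI ?ltry.
have FA x : (\int[mu]_y `|(F x y)%:E| <= (A x)%:E)%E.
  apply: (@le_trans _ _ (\int[mu]_y (G x y)%:E)%E).
    apply: ge0_le_integral => //.
    - by apply/measurable_EFinP; apply: mf_norm; exact: mf_section1.
    - by apply/measurable_EFinP; exact: J_mf.
    - by move=> y _; rewrite lee_fin.
  by rewrite EI// lee_fin.
apply: ge0_le_integral => //.
- by move=> x _; exact: integral_ge0.
- apply: (measurable_fun_fubini_tonelli_F (m2 := mu) (fun z => `|(F z.1 z.2)%:E|)%E) => //.
  by apply/measurable_EFinP; exact: mf_norm.
- by apply/measurable_EFinP; exact: J_mf.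
- by move=> x _; exact: FA.
Qed.

Lemma fubini_J1 x : J (F x).
Proof. by apply: J_dom (JG x) => //; exact: mf_section1. Qed.

Lemma fubini_J : J (fun x => I (F x)).
Proof.
apply: (@J_dom _ A) => //; first exact: mf_I.
move=> x; apply: le_trans (GA x); apply: I_norm_le => //.
exact: mf_section1.
Qed.

Lemma fubini_I : (forall y, J (F ^~ y)) ->
  I (fun x => I (F x)) = I (fun y => I (F ^~ y)).
Proof.
move=> J2; have := Fubini jF => /=.
have -> : (\int[mu]_x \int[mu]_y (F x y)%:E = \int[mu]_x (I (F x))%:E)%E.
  by apply: eq_integral => x _; rewrite EI//; exact: fubini_J1.
have -> : (\int[mu]_y \int[mu]_x (F x y)%:E = \int[mu]_y (I (F ^~ y))%:E)%E.
  by apply: eq_integral => y _; rewrite EI.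
by move=> E; rewrite /I /Rintegral; congr fine.
Qed.

Lemma fubini_J2 : (forall y, J (F ^~ y)) -> J (fun y => I (F ^~ y)).
Proof.
move=> J2; have mFE : measurable_fun setT (fun z : R * R => (F z.1 z.2)%:E) by exact/measurable_EFinP.
have mI : mf (fun y => I (F ^~ y)) by apply: (mf_I (F := fun y x => F x y)); exact: mf_swap.
apply/integrableP; split; first exact/measurable_EFinP.
apply: (@le_lt_trans _ _ (\int[mu]_y \int[mu]_x `|(F x y)%:E|)%E); last by have [+ _] := integrable21ltyP mu mu mFE; apply.
apply: ge0_le_integral => //.
- by apply: measurableT_comp => //; exact/measurable_EFinP.
- apply: (measurable_fun_fubini_tonelli_G (m1 := mu) (fun z => `|(F z.1 z.2)%:E|)%E) => //.
  by apply/measurable_EFinP; exact: mf_norm.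
- move=> y _ /=; rewrite -abse_EFin -(EI (J2 y)); apply: le_abse_integral => //.
  by apply/measurable_EFinP; exact: J_mf.
Qed.

End Dominated.

Lemma fubini_prod F A B : mf (fun z : R * R => F z.1 z.2) -> J A -> J B ->
  (forall x y, `|F x y| <= A x * B y) ->
  I (fun x => I (F x)) = I (fun y => I (F ^~ y)).
Proof.
move=> mF JA JB' FAB.
apply: (@fubini_I F (fun x y => A x * B y) (fun x => A x * I B)) => //.
- exact: JZr.
- by move=> x; exact: JZ.
- by move=> x; rewrite IZ.
- move=> y; apply: (@J_dom _ (fun x => A x * B y)) => //; last exact: JZr.
  exact: mf_section2.
Qed.

(** The bound on [B] makes [A x * B (y + x)] integrable in [x] for every fixed [y]; integrability of
    [A] and [B] gives this only for almost every [y]. *)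
Lemma fubini_conv F A B : mf (fun z : R * R => F z.1 z.2) -> J A -> J B ->
  (forall x y, `|F x y| <= A x * B (y + x)) -> (exists M, forall x, `|B x| <= M) ->
  I (fun x => I (F x)) = I (fun y => I (F ^~ y)).
Proof.
move=> mF JA JB' FAB [M BM].
apply: (@fubini_I F (fun x y => A x * B (y + x)) (fun x => A x * I B)) => //.
- exact: JZr.
- by move=> x; apply: JZ; exact: J_shift.
- by move=> x; rewrite IZ ?I_shift//; exact: J_shift.
- move=> y; apply: (@J_dom _ (fun x => `|A x| * M)) => //.
  + exact: mf_section2.
  + move=> x; apply: le_trans (FAB x y) _; apply: le_trans (ler_norm _) _.
    by rewrite normrM ler_wpM2l.
  + by apply: JZr; exact: J_norm.
Qed.

End RealFubini.

End RealIntegral.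

(** * Complex-valued integrals *)

Section ComplexToolkit.
Context {R : realType}.
Local Notation mu := (@lebesgue_measure R).
Local Notation C := R[i].

(** The modulus with values in [R], so that it can be compared with real dominating functions. *)
Definition cn (z : C) : R := Num.sqrt (complex.Re z ^+ 2 + complex.Im z ^+ 2).

Lemma cnM (z w : C) : cn (z * w) = cn z * cn w.
Proof. by have := @Normc.normcM R z w; case: z => a b; case: w => c d. Qed.

Lemma cn_normC (z : C) : (cn z)%:C = `|z|.
Proof. by rewrite normc_def. Qed.

Lemma cnD (z w : C) : cn (z + w) <= cn z + cn w.
Proof. by have := ler_normD z w; rewrite -!cn_normC -rmorphD lecR. Qed.

Lemma cnN (z : C) : cn (- z) = cn z.
Proof. by rewrite /cn; case: z => a b /=; rewrite !sqrrN. Qed.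

Lemma cnB (z w : C) : cn (z - w) <= cn z + cn w.
Proof. by rewrite -(cnN w); exact: cnD. Qed.

Lemma cnV (z : C) : cn z^-1 = (cn z)^-1.
Proof. by have := normfV z; rewrite -!cn_normC -fmorphV => -[]. Qed.

Lemma cn_ge0 (z : C) : 0 <= cn z.
Proof. exact: sqrtr_ge0. Qed.

Lemma cn_real (x : R) : cn x%:C = `|x|.
Proof. by rewrite /cn /= expr0n addr0 sqrtr_sqr. Qed.

Lemma cn1 : cn 1 = 1.
Proof. by rewrite (cn_real 1) normr1. Qed.

Lemma cnX (z : C) n : cn (z ^+ n) = cn z ^+ n.
Proof. by elim: n => [|n IH]; rewrite ?expr0 ?cn1// !exprS cnM IH. Qed.

Lemma Re_le_cn (z : C) : `|complex.Re z| <= cn z.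
Proof. by rewrite -sqrtr_sqr ler_sqrt ?lerDl ?addr_ge0 ?sqr_ge0. Qed.

Lemma Im_le_cn (z : C) : `|complex.Im z| <= cn z.
Proof. by rewrite -sqrtr_sqr ler_sqrt ?lerDr ?addr_ge0 ?sqr_ge0. Qed.

Lemma cn_le_ReIm (z : C) : cn z <= `|complex.Re z| + `|complex.Im z|.
Proof.
rewrite -[leRHS]ger0_norm ?addr_ge0// -sqrtr_sqr ler_sqrt ?sqr_ge0//.
rewrite sqrrD !real_normK ?num_real//.
by rewrite -addrA lerD2l addrC lerDl mulrn_wge0// mulr_ge0.
Qed.

Lemma cexpD (z w : C) : cexp (z + w) = cexp z * cexp w.
Proof.
case: z => a b; case: w => c d; rewrite /cexp /= expRD cosD sinD.
by apply/eqP; rewrite eq_complex /=; apply/andP; split; apply/eqP; ring.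
Qed.

Lemma cexp_real (x : R) : cexp x%:C = (expR x)%:C.
Proof.
by apply/eqP; rewrite eq_complex /= cos0 sin0 mulr1 !mul0r subr0 mulr0 addr0 !eqxx.
Qed.

Lemma cexp0 : cexp 0 = 1 :> C.
Proof. by rewrite -[0 : C]/((0 : R)%:C) cexp_real expR0. Qed.

Lemma cexp_neq0 (z : C) : cexp z != 0.
Proof.
apply/eqP => z0; have := cexpD z (- z); rewrite subrr cexp0 z0 mul0r.
by move/eqP; rewrite oner_eq0.
Qed.

Lemma cexpN (z : C) : cexp (- z) = (cexp z)^-1.
Proof.
apply: (mulfI (cexp_neq0 z)); rewrite divff ?cexp_neq0//.
by rewrite -cexpD subrr cexp0.
Qed.

Lemma cn_cexp (z : C) : cn (cexp z) = expR (complex.Re z).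
Proof.
rewrite /cexp cnM cn_real ger0_norm ?expR_ge0// /cn /= cos2Dsin2 sqrtr1.
by rewrite mulr1.
Qed.

Definition Cmf d (T : measurableType d) (f : T -> C) :=
  mf (fun x => complex.Re (f x)) /\ mf (fun x => complex.Im (f x)).

Section CMeasurability.
Context d (T : measurableType d).
Implicit Types f g : T -> C.

Lemma Cmf_cst (z : C) : Cmf (fun _ : T => z).
Proof. by split; mf_tac. Qed.

Lemma CmfD f g : Cmf f -> Cmf g -> Cmf (fun x => f x + g x).
Proof.
move=> [f1 f2] [g1 g2]; split.
  have -> : (fun x => complex.Re (f x + g x)) = fun x => complex.Re (f x) + complex.Re (g x).
    by apply/funext => x; case: (f x) => ? ?; case: (g x).
  by mf_tac.
have -> : (fun x => complex.Im (f x + g x)) = fun x => complex.Im (f x) + complex.Im (g x).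
  by apply/funext => x; case: (f x) => ? ?; case: (g x).
by mf_tac.
Qed.

Lemma CmfN f : Cmf f -> Cmf (fun x => - f x).
Proof.
move=> [f1 f2]; split.
  have -> : (fun x => complex.Re (- f x)) = fun x => - complex.Re (f x).
    by apply/funext => x; case: (f x) => ? ?.
  by mf_tac.
have -> : (fun x => complex.Im (- f x)) = fun x => - complex.Im (f x).
  by apply/funext => x; case: (f x) => ? ?.
by mf_tac.
Qed.

Lemma CmfM f g : Cmf f -> Cmf g -> Cmf (fun x => f x * g x).
Proof.
move=> [f1 f2] [g1 g2]; split.
  have -> : (fun x => complex.Re (f x * g x)) = fun x =>
      complex.Re (f x) * complex.Re (g x) + - (complex.Im (f x) * complex.Im (g x)).
    by apply/funext => x; case: (f x) => ? ?; case: (g x).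
  by mf_tac.
have -> : (fun x => complex.Im (f x * g x)) = fun x =>
    complex.Re (f x) * complex.Im (g x) + complex.Im (f x) * complex.Re (g x).
  by apply/funext => x; case: (f x) => ? ?; case: (g x).
by mf_tac.
Qed.

Lemma CmfX f n : Cmf f -> Cmf (fun x => f x ^+ n).
Proof.
move=> mf0; elim: n => [|n IH]; first exact: Cmf_cst.
have -> : (fun x => f x ^+ n.+1) = fun x => f x * f x ^+ n by apply/funext => x; rewrite exprS.
exact: CmfM.
Qed.

Lemma Cmf_real (f : T -> R) : mf f -> Cmf (fun x => (f x)%:C).
Proof. by move=> mf0; split => //=; mf_tac. Qed.

Lemma Cmf_line (f g : T -> R) : mf f -> mf g -> Cmf (fun x => f x +i* g x).
Proof. by move=> mf0 mg0; split. Qed.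

Lemma Cmf_exp f : Cmf f -> Cmf (fun x => cexp (f x)).
Proof.
move=> [f1 f2]; rewrite /cexp; apply: CmfM.
  by apply: Cmf_real; mf_tac.
by apply: Cmf_line; mf_tac.
Qed.

Lemma Cmf_comp (h : R -> C) (f : T -> R) : Cmf h -> mf f -> Cmf (fun x => h (f x)).
Proof. by move=> [h1 h2] mf0; split; [exact: (mf_comp h1 mf0)|exact: (mf_comp h2 mf0)]. Qed.

End CMeasurability.

Lemma Cmf_section1 (F : R -> R -> C) x : Cmf (fun z : R * R => F z.1 z.2) -> Cmf (F x).
Proof.
by move=> [m1 m2]; split; [exact: (mf_section1 (F := fun x y => complex.Re (F x y)))|exact: (mf_section1 (F := fun x y => complex.Im (F x y)))].
Qed.

Definition CI (f : R -> C) : C := cintegral setT f.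
Definition CJ (f : R -> C) : Prop :=
  J (fun x => complex.Re (f x)) /\ J (fun x => complex.Im (f x)).

Lemma CIE (f : R -> C) :
  CI f = I (fun x => complex.Re (f x)) +i* I (fun x => complex.Im (f x)).
Proof. by []. Qed.

Lemma CI_ext (f g : R -> C) : f =1 g -> CI f = CI g.
Proof. by move=> /funext ->. Qed.

Lemma CJ_ext (f g : R -> C) : f =1 g -> CJ f -> CJ g.
Proof. by move=> /funext ->. Qed.

Lemma CJ_dom (f : R -> C) (g : R -> R) : Cmf f -> (forall x, cn (f x) <= g x) ->
  J g -> CJ f.
Proof.
move=> [m1 m2] fg Jg; split; apply: J_dom Jg => // x; apply: le_trans (fg x).
  exact: Re_le_cn.
exact: Im_le_cn.
Qed.

(** The factor 2 comes from estimating the real and imaginary parts separately; the lemma serves to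
    supply finite constants. *)
Lemma cn_CI_le (f : R -> C) (g : R -> R) : Cmf f -> (forall x, cn (f x) <= g x) ->
  J g -> cn (CI f) <= 2 * I g.
Proof.
move=> [m1 m2] fg Jg; apply: le_trans (cn_le_ReIm _) _; rewrite mulr2n mulrDl mul1r CIE /=.
apply: lerD; apply: I_norm_le => // x; apply: le_trans (fg x).
  exact: Re_le_cn.
exact: Im_le_cn.
Qed.

Lemma CJ_real (f : R -> R) : J f -> CJ (fun x => (f x)%:C).
Proof. by move=> Jf; split => //=; exact: J0. Qed.

Lemma CI_real (f : R -> R) : CI (fun x => (f x)%:C) = (I f)%:C.
Proof. by rewrite CIE /= I0. Qed.

Lemma CJD (f g : R -> C) : CJ f -> CJ g -> CJ (fun x => f x + g x).
Proof.
move=> [f1 f2] [g1 g2]; split.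
  by apply: J_ext (JD f1 g1) => x; case: (f x) => ? ?; case: (g x).
by apply: J_ext (JD f2 g2) => x; case: (f x) => ? ?; case: (g x).
Qed.

Lemma CID (f g : R -> C) : CJ f -> CJ g -> CI (fun x => f x + g x) = CI f + CI g.
Proof.
move=> [f1 f2] [g1 g2]; rewrite !CIE; apply/eqP; rewrite eq_complex /=; apply/andP; split; apply/eqP.
  by rewrite -ID//; apply: I_ext => x; case: (f x) => ? ?; case: (g x).
by rewrite -ID//; apply: I_ext => x; case: (f x) => ? ?; case: (g x).
Qed.

Lemma CJZ (k : C) (f : R -> C) : CJ f -> CJ (fun x => k * f x).
Proof.
move=> [f1 f2]; case: k => a b; split.
  by apply: J_ext (JB (JZ a f1) (JZ b f2)) => x; case: (f x).
by apply: J_ext (JD (JZ a f2) (JZ b f1)) => x; case: (f x).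
Qed.

Lemma CIZ (k : C) (f : R -> C) : CJ f -> CI (fun x => k * f x) = k * CI f.
Proof.
move=> [f1 f2]; case: k => a b; rewrite !CIE; apply/eqP; rewrite eq_complex /=.
apply/andP; split; apply/eqP.
  rewrite -!IZ// -IB; [|exact: JZ|exact: JZ].
  by apply: I_ext => x; case: (f x).
rewrite -!IZ// -ID; [|exact: JZ|exact: JZ].
by apply: I_ext => x; case: (f x).
Qed.

Lemma CJZr (k : C) (f : R -> C) : CJ f -> CJ (fun x => f x * k).
Proof. by move=> /(CJZ k); apply: CJ_ext => x; rewrite mulrC. Qed.

Lemma CIZr (k : C) (f : R -> C) : CJ f -> CI (fun x => f x * k) = CI f * k.
Proof. by move=> Jf; rewrite mulrC -CIZ//; apply: CI_ext => x; rewrite mulrC. Qed.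

Lemma CI_opp (f : R -> C) : CJ f -> CI (fun x => f (- x)) = CI f.
Proof. by move=> [f1 f2]; rewrite !CIE -(I_opp f1) -(I_opp f2). Qed.

Lemma CJ_opp (f : R -> C) : CJ f -> CJ (fun x => f (- x)).
Proof. by move=> [/J_opp f1 /J_opp f2]. Qed.

Lemma CI_shift (f : R -> C) a : CJ f -> CI (fun x => f (x + a)) = CI f.
Proof. by move=> [f1 f2]; rewrite !CIE -(I_shift a f1) -(I_shift a f2). Qed.

Lemma CI_scale (f : R -> C) k : 0 < k -> CJ f ->
  CI (fun x => f (k * x)) = (k^-1)%:C * CI f.
Proof.
move=> k0 [f1 f2]; rewrite !CIE (I_scale k0 f1) (I_scale k0 f2).
by apply/eqP; rewrite eq_complex /= !mul0r subr0 addr0 !eqxx.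
Qed.

Lemma Cmf_CI (F : R -> R -> C) : Cmf (fun z : R * R => F z.1 z.2) ->
  Cmf (fun x => CI (F x)).
Proof.
by move=> [m1 m2]; split; [exact: (mf_I (F := fun x y => complex.Re (F x y)))|exact: (mf_I (F := fun x y => complex.Im (F x y)))].
Qed.

Lemma Cfubini_prod (F : R -> R -> C) A B : Cmf (fun z : R * R => F z.1 z.2) ->
  J A -> J B -> (forall x y, cn (F x y) <= A x * B y) ->
  CI (fun x => CI (F x)) = CI (fun y => CI (F ^~ y)).
Proof.
move=> [m1 m2] JA JB' FAB; rewrite !CIE.
have ext (a b a' b' : R) : a = a' -> b = b' -> a +i* b = a' +i* b' by move=> -> ->.
apply: ext.
  apply: (fubini_prod (F := fun x y => complex.Re (F x y))) JA JB' _ => //.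
  by move=> x y; apply: le_trans (FAB x y); exact: Re_le_cn.
apply: (fubini_prod (F := fun x y => complex.Im (F x y))) JA JB' _ => //.
by move=> x y; apply: le_trans (FAB x y); exact: Im_le_cn.
Qed.

Lemma Rint_oy a f : \int[mu]_(x in `]a, +oo[) f x = I (fun x => pos (x - a) * f x).
Proof.
rewrite /I [LHS]Rintegral_mkcond; congr Rintegral; apply/funext => x.
rewrite patchE mem_setE in_itv /= andbT /pos subr_gt0.
by case: ifP => _; rewrite ?mul1r ?mul0r.
Qed.

(** The interval contains the endpoint 0, where [pos] vanishes; measurability allows the endpoint to
    be dropped. *)
Lemma Rint_cy f : mf f -> \int[mu]_(x in `[0, +oo[) f x = I (fun x => pos x * f x).
Proof.
move=> mf0; have := Rint_oy 0 f.
under [X in _ = I X]eq_fun do rewrite subr0.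
move=> <-; rewrite /Rintegral integral_itv_obnd_cbnd//.
by apply/measurable_EFinP; exact: measurable_funTS.
Qed.

Lemma cint_oy a (f : R -> C) :
  cintegral `]a, +oo[ f = CI (fun x => (pos (x - a))%:C * f x).
Proof.
rewrite /cintegral !Rint_oy CIE; congr (_ +i* _); apply: I_ext => x;
  by case: (f x) => ? ? /=; rewrite mul0r ?subr0 ?addr0.
Qed.

Lemma cint_cy (f : R -> C) : Cmf f ->
  cintegral `[0, +oo[ f = CI (fun x => (pos x)%:C * f x).
Proof.
move=> [m1 m2]; rewrite /cintegral !Rint_cy// CIE; congr (_ +i* _); apply: I_ext => x;
  by case: (f x) => ? ? /=; rewrite mul0r ?subr0 ?addr0.
Qed.

End ComplexToolkit.

Ltac Cmf_tac := repeat match goal with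
  | H : Cmf ?f |- Cmf ?f => exact H
  | |- Cmf (fun _ => ?k) => exact: Cmf_cst
  | |- Cmf (fun x => cexp _) => apply: Cmf_exp
  | |- Cmf (fun x => (_ + _)%R) => apply: CmfD
  | |- Cmf (fun x => (- _)%R) => apply: CmfN
  | |- Cmf (fun x => (_ * _)%R) => apply: CmfM
  | |- Cmf (fun x => (_ ^+ _)%R) => apply: CmfX
  | |- Cmf (fun x => (_ %:C)%C) => apply: Cmf_real; mf_tac
  | |- Cmf (fun x => (_ +i* _)%C) => apply: Cmf_line; mf_tac
  | |- Cmf (complex.Complex ?k) => apply: (@Cmf_line _ _ (fun=> k) id); mf_tac
  | |- Cmf (real_complex_def _) => exact: (Cmf_real mf_id)
  | H : Cmf ?h |- Cmf (fun x => ?h _) => apply: (Cmf_comp H); mf_tac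
  end.

(** * Integration on half-lines and Green's formula *)

Section HalfLine.
Context {R : realType}.
Local Notation mu := (@lebesgue_measure R).

Lemma mf_continuous (f : R -> R) : continuous f -> mf f.
Proof. exact: continuous_measurable_fun. Qed.

Lemma FTC_segment (F f : R -> R) (a b : R) : a < b ->
  (forall x : R, is_derive x 1 F (f x)) -> continuous f ->
  \int[mu]_(x in `[a, b]) f x = F b - F a.
Proof.
move=> ab dF cf; rewrite /Rintegral (continuous_FTC2 (F := F) ab)//.
- exact: continuous_subspaceT.
- have cF x : {for x, continuous F}.
    by apply: differentiable_continuous; apply/derivable1_diffP; have := dF x; case.
  split.
  + by move=> x _; have := dF x; case.
  + by apply: cvg_at_right_filter; exact: cF.
  + by apply: cvg_at_left_filter; exact: cF.
- by move=> x _; rewrite derive1E; have := dF x; case.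
Qed.

Definition upto (b x : R) : R := pos x * (x <= b)%R%:R.

Lemma mf_upto b : mf (upto b).
Proof.
apply: mfM; first by apply: mf_pos; exact: mf_id.
have -> : (fun x : R => (x <= b)%R%:R : R) = \1_(`]-oo, b]%classic : set R).
  by apply/funext => x; rewrite indicE mem_setE in_itv.
exact: measurable_indic.
Qed.

Lemma upto_ge0 b x : 0 <= upto b x.
Proof. by rewrite mulr_ge0 ?pos_ge0. Qed.

Lemma I_upto (F f : R -> R) b : 0 < b ->
  (forall x : R, is_derive x 1 F (f x)) -> continuous f ->
  I (fun x => upto b x * f x) = F b - F 0.
Proof.
move=> b0 dF cf; rewrite -(@FTC_segment F f 0)// -Rintegral_itv_obnd_cbnd; last first.
  apply: (@integrableS _ _ _ mu `[0, b]%classic) => //.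
    by apply: subset_itv_oc_cc.
  by apply: continuous_compact_integrable; [exact: segment_compact|exact: continuous_subspaceT].
rewrite [RHS]Rintegral_mkcond /I; congr Rintegral; apply/funext => x.
rewrite patchE mem_setE in_itv /= /upto /pos.
by case: ltP => _ /=; rewrite ?mul0r ?mul1r//; case: leP => _; rewrite ?mul1r ?mul0r.
Qed.

(** Dominated convergence along the intervals []0, n+1]]: a limit of [F] along the integers
    suffices, and [f] may change sign. *)
Lemma FTC_halfline (F f : R -> R) (l : R) :
  (forall x : R, is_derive x 1 F (f x)) -> continuous f ->
  J (fun x => pos x * f x) -> F n.+1%:R @[n --> \oo] --> l ->
  I (fun x => pos x * f x) = l - F 0.
Proof.
move=> dF cf Jf Fl.
pose fn (n : nat) x : R := upto n.+1%:R x * f x.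
have mfn n : mf (fn n) by apply: mfM; [exact: mf_upto|exact: mf_continuous].
have fnE n : I (fn n) = F n.+1%:R - F 0 by apply: I_upto => //; rewrite ltr0n.
have Jn := J_norm Jf.
have [|||||_ _ dct] := @dominated_convergence _ _ _ mu setT measurableT (fun n x => (fn n x)%:E)
  (fun x => (pos x * f x)%:E) (fun x => `|pos x * f x|%:E).
- by move=> n; apply/measurable_EFinP; exact: mfn.
- by apply/measurable_EFinP; exact: J_mf.
- apply: aeW => x _; apply: cvg_EFin; first by near=> n.
  apply: cvg_near_cst; near=> n; rewrite /fn /= /upto.
  have -> : x <= n.+1%:R; last by rewrite mulr1.
  near: n; exists (Num.trunc `|x|)%N => // n /= xn.
  rewrite (le_trans (ler_norm x))// ltW// (lt_le_trans (Num.Theory.truncnS_gt _))//.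
  by rewrite ler_nat ltnS.
- exact: Jn.
- apply: aeW => x n _; rewrite lee_fin /fn /upto mulrAC normrM ler_piMr//.
  by rewrite normr_nat lern1 leq_b1.
have cv1 : I (fn n) @[n --> \oo] --> I (fun x => pos x * f x).
  apply: fine_cvg; rewrite -(EI Jf) in dct *.
  exact: dct.
have cv2 : I (fn n) @[n --> \oo] --> l - F 0.
  under eq_fun do rewrite fnE.
  by apply: cvgB => //; exact: cvg_cst.
exact: (cvg_unique _ cv1 cv2).
Unshelve. all: by end_near. Qed.

Let cauchy_ge0 (x : R) : 0 <= (1 + x ^+ 2)^-1.
Proof. by rewrite invr_ge0 addr_ge0 ?sqr_ge0. Qed.

Let eintegral_cauchy : (\int[mu]_x ((1 + x ^+ 2)^-1)%:E = pi%:E)%E.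
Proof.
have cf : continuous (fun t : R => (1 + t ^+ 2)^-1) by exact: continuous_oneDsqrV.
rewrite ge0_symfun_integralT//; last by move=> x /=; rewrite sqrrN.
have -> : [set x : R | 0 <= x] = `[0, +oo[%classic.
  by apply/seteqP; split => x /=; rewrite in_itv /= andbT.
rewrite (ge0_continuous_FTC2y (F := atan) (l := pi / 2))//.
- by rewrite atan0 -EFinB -EFinM subr0 mulrC -mulrA mulVf ?mulr1.
- exact: continuous_subspaceT.
- exact: cvgy_atan.
- by apply: cvg_at_right_filter; exact: continuous_atan.
- by move=> x _; rewrite derive1E; have := is_derive1_atan x; case.
Qed.

Lemma J_cauchy : J (fun t : R => (1 + t ^+ 2)^-1).
Proof.
apply: (@J_fin _ _ pi) => //; last by rewrite eintegral_cauchy.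
by apply: mf_continuous; exact: continuous_oneDsqrV.
Qed.

Lemma I_cauchy : I (fun t : R => (1 + t ^+ 2)^-1) = pi.
Proof. by rewrite /I /Rintegral eintegral_cauchy. Qed.

(* Linear terms are absorbed by completing the square, and [e^{-y} <= 1/(1+y)]. *)
Lemma gauss_dom (b k : R) : 0 < k ->
  exists2 M, 0 <= M & forall t, expR (b * t - k * t ^+ 2) <= M * (1 + t ^+ 2)^-1.
Proof.
move=> k0; have k20 : 0 < k / 2 by rewrite divr_gt0.
pose m := 1 + (k / 2)^-1; have m0 : 0 < m by rewrite addr_gt0 ?invr_gt0.
exists (expR (b ^+ 2 / (2 * k)) * m) => [|t].
  by rewrite mulr_ge0 ?expR_ge0// ltW.
have t2 : 0 <= t ^+ 2 by exact: sqr_ge0.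
have le1 : b * t - k * t ^+ 2 <= b ^+ 2 / (2 * k) - k / 2 * t ^+ 2.
  rewrite -subr_ge0.
  have -> : b ^+ 2 / (2 * k) - k / 2 * t ^+ 2 - (b * t - k * t ^+ 2) = (b - k * t) ^+ 2 / (2 * k).
    by field; rewrite gt_eqF.
  by rewrite divr_ge0 ?sqr_ge0// mulr_ge0// ltW.
apply: (@le_trans _ _ (expR (b ^+ 2 / (2 * k) - k / 2 * t ^+ 2))); first by rewrite ler_expR.
rewrite expRD -[leRHS]mulrA ler_pM2l ?expR_gt0// expRN.
rewrite ler_pdivlMr ?ltr_pwDl// mulrC ler_pdivrMr ?expR_gt0//.
apply: (@le_trans _ _ (m * (1 + k / 2 * t ^+ 2))).
  have -> : m * (1 + k / 2 * t ^+ 2) = 1 + k / 2 * t ^+ 2 + (k / 2)^-1 + t ^+ 2.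
    by rewrite /m; field; rewrite gt_eqF.
  have : 0 <= k / 2 * t ^+ 2 by rewrite mulr_ge0// ltW.
  have : 0 < (k / 2)^-1 by rewrite invr_gt0.
  lra.
by rewrite ler_pM2l// expR_ge1Dx.
Qed.

Lemma cvg_cauchy : (1 + (n.+1%:R : R) ^+ 2)^-1 @[n --> \oo] --> (0 : R).
Proof.
apply: (@squeeze_cvgr _ _ _ _ (fun=> 0) (fun n => (n.+1%:R : R)^-1)).
- near=> n; rewrite invr_ge0 addr_ge0 ?sqr_ge0//=.
  rewrite lef_pV2 ?posrE ?ltr_pwDl ?sqr_ge0//.
  rewrite (@le_trans _ _ (n.+1%:R ^+ 2))// ?lerDr// expr2 ler_peMr// ler1n.
  by [].
- exact: cvg_cst.
- exact: cvg_harmonic.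
Unshelve. all: by end_near. Qed.

Lemma J_upto1 : J (upto 1).
Proof.
apply: (@J_dom _ _ (fun t => 2 * (1 + t ^+ 2)^-1)).
- exact: mf_upto.
- move=> t; rewrite ger0_norm ?upto_ge0// ler_pdivlMr ?ltr_pwDl ?sqr_ge0//.
  rewrite /upto /pos; case: (ltP 0 t) => t0; rewrite ?mul0r//.
  case: (leP t 1) => t1; rewrite ?mulr0 ?mul0r// !mul1r; nra.
- by apply: JZ; exact: J_cauchy.
Qed.

(* Green's formula for the closed form [P dr + Q du] on [[0, 1] x [0, +oo[]. *)
Lemma green (P Q H : R -> R -> R) (A : R -> R) :
  (forall u r : R, is_derive u 1 (fun u => P u r) (H u r)) ->
  (forall u r : R, is_derive r 1 (Q u) (H u r)) ->
  (forall r, continuous (fun u => H u r)) -> (forall u, continuous (H u)) ->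
  mf (fun z : R * R => H z.1 z.2) ->
  J A -> (forall r, 0 <= A r) ->
  (forall u r, 0 < u -> u <= 1 -> 0 < r -> `|H u r| <= A r) ->
  (forall u, 0 < u -> u <= 1 -> Q u n.+1%:R @[n --> \oo] --> (0 : R)) ->
  (forall u, Q u 0 = 0) ->
  J (fun r => pos r * P 0 r) -> J (fun r => pos r * P 1 r) ->
  I (fun r => pos r * P 1 r) = I (fun r => pos r * P 0 r).
Proof.
move=> dP dQ c1 c2 mH JA A0 HA Qoo Q0 JP0 JP1.
apply/eqP; rewrite -subr_eq0 -IB//; apply/eqP.
have mu1 := mf_upto 1.
(* The difference is a double integral of [H]. After the order is exchanged, the inner integral in
   [r] is the increment of [Q u] from 0 to infinity, which vanishes. *)
transitivity (I (fun r => I (fun u => pos r * (upto 1 u * H u r)))).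
  apply: I_ext => r; rewrite -mulrBr -(I_upto ltr01 (dP ^~ r))//.
  case: (ltP 0 r) => r0; rewrite ?(pos1 r0) ?(pos0 r0) ?mul1r.
    by apply: I_ext => u; rewrite mul1r.
  by rewrite mul0r; symmetry; rewrite -[RHS]I0; apply: I_ext => u; rewrite mul0r.
have FA r u : `|pos r * (upto 1 u * H u r)| <= A r * upto 1 u.
  rewrite normrM (ger0_norm (pos_ge0 r)) normrM (ger0_norm (upto_ge0 1 u)).
  have := A0 r; rewrite /upto /pos.
  case: (ltP 0 r) => r0 Ar0; last by rewrite !mul0r mulr_ge0// mulr_ge0.
  case: (ltP 0 u) => u0; last by rewrite !(mul0r, mulr0).
  by case: (leP u 1) => u1; rewrite ?(mul0r, mulr0)// !mul1r mulr1 HA.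
rewrite (@fubini_prod _ (fun r u => pos r * (upto 1 u * H u r)) A (upto 1))//; last 2 first.
- exact: (mfM (mf_pos mf_fst) (mfM (mf_comp mu1 mf_snd) (mf_swap mH))).
- exact: J_upto1.
rewrite -[RHS]I0; apply: I_ext => u.
case: (boolP ((0 < u) && (u <= 1))) => [/andP[u0 u1]|nu].
  have uu : upto 1 u = 1 by rewrite /upto (pos1 u0) u1 mul1r.
  have -> : (fun r => pos r * (upto 1 u * H u r)) = fun r => pos r * H u r.
    by apply/funext => r; rewrite uu mul1r.
  rewrite (FTC_halfline (dQ u) (c2 u) _ (Qoo u u0 u1)) ?Q0 ?subr0//.
  apply: J_dom JA; first by apply: mfM; [exact: mf_pos mf_id|exact: (mf_section1 u mH)].
  move=> r; rewrite normrM (ger0_norm (pos_ge0 r)).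
  by case: (ltP 0 r) => r0; rewrite ?(pos1 r0) ?(pos0 r0) ?mul1r ?mul0r ?HA.
rewrite -[RHS]I0; apply: I_ext => r.
have -> : upto 1 u = 0; last by rewrite mul0r mulr0.
by rewrite /upto /pos; move: nu; case: ltP => _; case: leP => _ //= _; rewrite ?mul0r ?mulr0.
Qed.

End HalfLine.

(** * Derivatives of complex functions along a real parameter *)

Section ComplexDerivative.
Context {R : realType}.
Local Notation C := R[i].

Definition cderiv (F : R -> C) (x : R) (d : C) :=
  is_derive x 1 (fun y => complex.Re (F y)) (complex.Re d) /\
  is_derive x 1 (fun y => complex.Im (F y)) (complex.Im d).

Let dD (f g : R -> R) (x a b : R) : is_derive x 1 f a -> is_derive x 1 g b ->
  is_derive x 1 (fun y => f y + g y) (a + b).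
Proof. by move=> df dg; exact: is_deriveD. Qed.

Let dM (f g : R -> R) (x a b : R) : is_derive x 1 f a -> is_derive x 1 g b ->
  is_derive x 1 (fun y => f y * g y) (a * g x + f x * b).
Proof.
move=> df dg; apply: (@is_derive_eq _ _ _ (f * g)%R x 1 _ _ (is_deriveM df dg)).
by rewrite /= addrC [g x *: a]mulrC.
Qed.

Let dN (f : R -> R) (x a : R) : is_derive x 1 f a -> is_derive x 1 (fun y => - f y) (- a).
Proof. by move=> df; exact: is_deriveN. Qed.

Lemma cderiv_eq F x d d' : cderiv F x d -> d = d' -> cderiv F x d'.
Proof. by move=> H <-. Qed.

Lemma cderiv_cst (z : C) x : cderiv (fun=> z) x 0.
Proof. by split => /=; exact: is_derive_cst. Qed.

Lemma cderivD F G x d e : cderiv F x d -> cderiv G x e ->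
  cderiv (fun y => F y + G y) x (d + e).
Proof.
move=> [f1 f2] [g1 g2]; split.
  have -> : (fun y => complex.Re (F y + G y)) = fun y => complex.Re (F y) + complex.Re (G y).
    by apply/funext => y; case: (F y) => ? ?; case: (G y).
  have -> : complex.Re (d + e) = complex.Re d + complex.Re e by case: d {f1 f2}; case: e {g1 g2}.
  exact: dD.
have -> : (fun y => complex.Im (F y + G y)) = fun y => complex.Im (F y) + complex.Im (G y).
  by apply/funext => y; case: (F y) => ? ?; case: (G y).
have -> : complex.Im (d + e) = complex.Im d + complex.Im e by case: d {f1 f2}; case: e {g1 g2}.
exact: dD.
Qed.

Lemma cderivM F G x d e : cderiv F x d -> cderiv G x e ->
  cderiv (fun y => F y * G y) x (d * G x + F x * e).
Proof.
move=> [f1 f2] [g1 g2]; split.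
  have -> : (fun y => complex.Re (F y * G y)) = fun y =>
      complex.Re (F y) * complex.Re (G y) + - (complex.Im (F y) * complex.Im (G y)).
    by apply/funext => y; case: (F y) => ? ?; case: (G y).
  apply: (@is_derive_eq _ _ _ _ _ _ _ _ (dD (dM f1 g1) (dN (dM f2 g2)))).
  by case: (F x) => ? ?; case: (G x) => ? ?; case: d {f1 f2} => ? ?; case: e {g1 g2} => ? ? /=; ring.
have -> : (fun y => complex.Im (F y * G y)) = fun y =>
    complex.Re (F y) * complex.Im (G y) + complex.Im (F y) * complex.Re (G y).
  by apply/funext => y; case: (F y) => ? ?; case: (G y).
apply: (@is_derive_eq _ _ _ _ _ _ _ _ (dD (dM f1 g2) (dM f2 g1))).
by case: (F x) => ? ?; case: (G x) => ? ?; case: d {f1 f2} => ? ?; case: e {g1 g2} => ? ? /=; ring.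
Qed.

Lemma cderivZ (k : C) F x d : cderiv F x d -> cderiv (fun y => k * F y) x (k * d).
Proof.
move=> H; apply: cderiv_eq (cderivM (cderiv_cst k x) H) _.
by rewrite mul0r add0r.
Qed.

Lemma cderiv_cexp F x d : cderiv F x d -> cderiv (fun y => cexp (F y)) x (cexp (F x) * d).
Proof.
move=> [f1 f2].
have e1 : is_derive x 1 (fun y => expR (complex.Re (F y))) (expR (complex.Re (F x)) * complex.Re d).
  exact: (is_derive1_comp (f := expR)).
have c1 : is_derive x 1 (fun y => cos (complex.Im (F y))) (- sin (complex.Im (F x)) * complex.Im d).
  exact: (is_derive1_comp (f := cos)).
have s1 : is_derive x 1 (fun y => sin (complex.Im (F y))) (cos (complex.Im (F x)) * complex.Im d).
  exact: (is_derive1_comp (f := sin)).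
split.
  have -> : (fun y => complex.Re (cexp (F y))) =
      fun y => expR (complex.Re (F y)) * cos (complex.Im (F y)).
    by apply/funext => y; rewrite /cexp /= mul0r subr0.
  apply: (@is_derive_eq _ _ _ _ _ _ _ _ (dM e1 c1)).
  by rewrite /cexp; case: (F x) => ? ?; case: d {f1 f2 e1 c1 s1} => ? ? /=; ring.
have -> : (fun y => complex.Im (cexp (F y))) =
    fun y => expR (complex.Re (F y)) * sin (complex.Im (F y)).
  by apply/funext => y; rewrite /cexp /= mul0r addr0.
apply: (@is_derive_eq _ _ _ _ _ _ _ _ (dM e1 s1)).
by rewrite /cexp; case: (F x) => ? ?; case: d {f1 f2 e1 c1 s1} => ? ? /=; ring.
Qed.

Lemma cderiv_affine (z w : C) x : cderiv (fun y => z + w * y%:C) x w.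
Proof.
have lin (a b : R) : is_derive x 1 (fun y : R => a + b * y) b.
  apply: (@is_derive_eq _ _ _ _ _ _ _ _ (dD (is_derive_cst a x 1) (dM (is_derive_cst b x 1) (is_derive_id x 1)))).
  by rewrite mul0r !add0r mulr1.
split.
  have -> : (fun y : R => complex.Re (z + w * y%:C)) = fun y => complex.Re z + complex.Re w * y.
    by apply/funext => y; case: z => ? ?; case: w => ? ? /=; rewrite mulr0 subr0.
  exact: lin.
have -> : (fun y : R => complex.Im (z + w * y%:C)) = fun y => complex.Im z + complex.Im w * y.
  by apply/funext => y; case: z => ? ?; case: w => ? ? /=; rewrite mulr0 add0r.
exact: lin.
Qed.

Lemma cderiv_continuous F : (forall x, exists d, cderiv F x d) ->
  continuous (fun y => complex.Re (F y)) /\ continuous (fun y => complex.Im (F y)).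
Proof.
move=> dF; split => x; apply: differentiable_continuous; apply/derivable1_diffP;
  by have [d [[h1 _] [h2 _]]] := dF x.
Qed.

End ComplexDerivative.

(** * The Airy functions on vertical lines *)

Section AiryContour.
Context {R : realType}.
Local Notation C := R[i].

Lemma I_even (g : R -> R) : J g -> (forall x, g (- x) = g x) -> I g = 2 * I (fun x => pos x * g x).
Proof.
move=> Jg ge; have mg := J_mf Jg.
have E : I (fun x => pos x * g x) = I (fun x => (0 <= x)%R%:R * g x).
  rewrite -Rint_cy// [LHS]Rintegral_mkcond; apply: I_ext => x.
  rewrite patchE mem_setE in_itv /= andbT.
  by case: ifP => _; rewrite ?mul1r ?mul0r.
have Jp : J (fun x => pos x * g x).
  apply: J_dom (J_norm Jg); first by apply: mfM => //; exact: mf_pos mf_id.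
  by move=> x; rewrite normrM ler_piMl// ger0_norm ?pos_ge0 ?pos_le1.
have E2 : I (fun x => g x - pos x * g x) = I (fun x => (0 <= x)%R%:R * g x).
  rewrite -I_opp; last exact: JB.
  apply: I_ext => x; rewrite ge /pos oppr_gt0 ltNge.
  by case: (0 <= x) => /=; rewrite ?mul1r ?mul0r ?subr0 ?subrr.
by have := IB Jg Jp; rewrite E2 -E; lra.
Qed.

Lemma I_odd (g : R -> R) : J g -> (forall x, g (- x) = - g x) -> I g = 0.
Proof.
move=> Jg go; have := I_opp Jg.
have -> : I (fun x => g (- x)) = - I g by rewrite -IN//; apply: I_ext => x; rewrite go.
lra.
Qed.

(** The triple-angle formula with [cos pi = -1] factors as [(cos a + 1) (2 cos a - 1)^2 = 0], and
    positivity of the cosine excludes the first factor. *)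
Lemma cos_pi3 : cos (pi / 3 : R) = 1 / 2.
Proof.
have c0 : 0 < cos (pi / 3 : R).
  by apply: cos_gt0_pihalf; have := pi_gt0 R; lra.
set a : R := pi / 3 in c0 *.
have e3 : cos (a + (a + a)) = -1 by rewrite -[RHS](cospi R); congr cos; rewrite /a; lra.
have s2 := cos2Dsin2 a.
move: e3; rewrite cosD (cosD a a) (sinD a a) => e3.
have : (cos a + 1) * (2 * cos a - 1) ^+ 2 = 0.
  have -> : (cos a + 1) * (2 * cos a - 1) ^+ 2 = 4 * cos a ^+ 3 - 3 * cos a + 1 by ring.
  have ss : sin a ^+ 2 = 1 - cos a ^+ 2 by lra.
  have -> : 4 * cos a ^+ 3 - 3 * cos a = cos a * (cos a * cos a - sin a * sin a) - sin a * (sin a * cos a + cos a * sin a).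
    have -> : cos a * (cos a * cos a - sin a * sin a) - sin a * (sin a * cos a + cos a * sin a) = cos a ^+ 3 - 3 * cos a * sin a ^+ 2 by ring.
    by rewrite ss; ring.
  by rewrite e3; lra.
move/eqP; rewrite mulf_eq0 sqrf_eq0 => /orP[/eqP|/eqP]; lra.
Qed.

Definition sin_pi3 : R := sin (pi / 3).

Lemma sin_pi3_gt0 : 0 < sin_pi3.
Proof. by apply: sin_gt0_pi; have := pi_gt0 R; lra. Qed.

Lemma sin_pi3_sqr : sin_pi3 ^+ 2 = 3 / 4.
Proof. by have := cos2Dsin2 (pi / 3 : R); rewrite cos_pi3 -/sin_pi3; nra. Qed.

Lemma sin_pi3_le1 : sin_pi3 <= 1.
Proof. exact: sin_le1. Qed.

Lemma wE : cexp (0 +i* (pi / 3)) = (1 / 2) +i* sin_pi3 :> C.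
Proof. by rewrite /cexp /= expR0 cos_pi3 mul1r; apply/eqP; rewrite eq_complex /= !mul0r subr0 addr0 mul1r mul1r !eqxx. Qed.

Section Fixed.
Variables (s x c : R).
Hypotheses (c_gt0 : 0 < c) (sc : - s < c).

Let S (z : C) : C := z ^+ 3 / 3%:R + s%:C * z ^+ 2 - x%:C * z.
Let S' (z : C) : C := z ^+ 2 + (2 * s)%:C * z - x%:C.

(* A homotopy from the ray of direction [e^{i pi/3}] ([u = 0]) to the upper half of
   the vertical line through [c] ([u = 1]). *)
Let gam (u r : R) : C := (c * u + r * ((1 - u) / 2)) +i* (r * sin_pi3).
Let gamr (u : R) : C := ((1 - u) / 2) +i* sin_pi3.
Let gamu (r : R) : C := (c - r / 2)%:C.

Let E u r : C := cexp (S (gam u r)).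
Let P u r : C := E u r * gamr u.
Let Q u r : C := E u r * gamu r.
(** The common value of the [u]-derivative of [P] and the [r]-derivative of [Q]: the pullback of
    [exp (S z) dz] by [gam] is closed. *)
Let H u r : C := E u r * (S' (gam u r) * gamu r * gamr u - (1 / 2)%:C).

Let cderiv_S g y d : cderiv g y d -> cderiv (fun y => S (g y)) y (S' (g y) * d).
Proof.
move=> dg; rewrite /S /S'.
have e : (fun y => g y ^+ 3 / 3%:R + s%:C * g y ^+ 2 - x%:C * g y) =
   fun y => (3%:R^-1 * (g y * (g y * g y)) + s%:C * (g y * g y)) + (- x%:C) * g y.
  apply/funext => v; rewrite mulNr; congr (_ + _ - _).
  by rewrite mulrC.
rewrite e.
have dgg := cderivM dg dg; have dggg := cderivM dg dgg.
apply: cderiv_eq (cderivD (cderivD (cderivZ 3%:R^-1 dggg) (cderivZ s%:C dgg)) (cderivZ (- x%:C) dg)) _.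
by rewrite rmorphM /=; field.
Qed.

Let gam_u u r : cderiv (fun u => gam u r) u (gamu r).
Proof.
have -> : (fun u => gam u r) = fun u => ((r / 2) +i* (r * sin_pi3)) + gamu r * u%:C.
  by apply/funext => v; apply/eqP; rewrite eq_complex /=; apply/andP; split; apply/eqP; field.
exact: cderiv_affine.
Qed.

Let gam_r u r : cderiv (gam u) r (gamr u).
Proof.
have -> : gam u = fun r => (c * u)%:C + gamr u * r%:C.
  by apply/funext => v; apply/eqP; rewrite eq_complex /=; apply/andP; split; apply/eqP; field.
exact: cderiv_affine.
Qed.

Let gamr_u u : cderiv gamr u (- (1 / 2)%:C).
Proof.
have -> : gamr = fun u => ((1 / 2) +i* sin_pi3) + (- (1 / 2)%:C) * u%:C.
  by apply/funext => v; apply/eqP; rewrite eq_complex /=; apply/andP; split; apply/eqP; field.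
exact: cderiv_affine.
Qed.

Let gamu_r r : cderiv gamu r (- (1 / 2)%:C).
Proof.
have -> : gamu = fun u => c%:C + (- (1 / 2)%:C) * u%:C.
  by apply/funext => v; apply/eqP; rewrite eq_complex /=; apply/andP; split; apply/eqP; field.
exact: cderiv_affine.
Qed.

Let E_u u r := cderiv_cexp (cderiv_S (gam_u u r)).
Let E_r u r := cderiv_cexp (cderiv_S (gam_r u r)).

Let P_u u r : cderiv (fun u => P u r) u (H u r).
Proof. by apply: cderiv_eq (cderivM (E_u u r) (gamr_u u)) _; rewrite /H /E; ring. Qed.

Let Q_r u r : cderiv (Q u) r (H u r).
Proof. by apply: cderiv_eq (cderivM (E_r u r) (gamu_r r)) _; rewrite /H /E; ring. Qed.

Let S'_d g y d : cderiv g y d -> exists d', cderiv (fun y => S' (g y)) y d'.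
Proof.
move=> dg; eexists; rewrite /S'.
have -> : (fun y => g y ^+ 2 + (2 * s)%:C * g y - x%:C) =
  fun y => (g y * g y + (2 * s)%:C * g y) + - x%:C by [].
exact: cderivD (cderivD (cderivM dg dg) (cderivZ _ dg)) (cderiv_cst _ _).
Qed.

Let H_u r : continuous (fun u => complex.Im (H u r)).
Proof.
apply: (cderiv_continuous (F := fun u => H u r) _).2 => u.
have [d' dS] := S'_d (gam_u u r); eexists.
apply: cderivM (E_u u r) _; apply: cderivD (cderiv_cst _ _).
exact: cderivM (cderivM dS (cderiv_cst _ _)) (gamr_u u).
Qed.

Let H_r u : continuous (fun r => complex.Im (H u r)).
Proof.
apply: (cderiv_continuous (F := H u) _).2 => r.
have [d' dS] := S'_d (gam_r u r); eexists.
apply: cderivM (E_r u r) _; apply: cderivD (cderiv_cst _ _).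
exact: cderivM (cderivM dS (gamu_r r)) (cderiv_cst _ _).
Qed.

Let ReS (X Y : R) : complex.Re (S (X +i* Y)) =
  X ^+ 3 / 3 - X * Y ^+ 2 + s * (X ^+ 2 - Y ^+ 2) - x * X.
Proof.
have -> : S (X +i* Y) = 3^-1%:C * ((X +i* Y) * ((X +i* Y) * (X +i* Y)))
   + s%:C * ((X +i* Y) * (X +i* Y)) - x%:C * (X +i* Y).
  rewrite /S fmorphV rmorph_nat; congr (_ + _ - _).
  by rewrite mulrC.
by rewrite /=; field.
Qed.

Let kap : R := (c + s) / 2.
Let kap_gt0 : 0 < kap.
Proof. by rewrite /kap; have := sc; lra. Qed.

(** Write [k = (1 - u) / 2]. The quadratic term is at most [(- u kap + k (3/2) |s|) r^2], where
    [kap] is half of [c + s] because [3/4 - k^2 >= 1/2]. This misses [- kap r^2] by a multiple of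
    [k], and the cubic term, at most [- (2/3) k r^3], absorbs the defect. *)
Let ReS_bound : exists C0 C1 : R, forall u r, 0 <= u -> u <= 1 -> 0 < r ->
  complex.Re (S (gam u r)) <= C0 + C1 * r - kap * r ^+ 2.
Proof.
(* [M] is the defect per unit of [k]: [(3/2) |s|] from the quadratic term and [2 kap] from
   [u = 1 - 2 k]. [C2] bounds [M r^2 - (2/3) r^3], which is nonpositive once [r >= (3/2) M]. *)
pose M := (3 / 2) * `|s| + 2 * kap.
have M0 : 0 <= M.
  by rewrite /M; have := kap_gt0; have : 0 <= `|s| by []; lra.
pose C2 := M * (3 / 2 * M) ^+ 2.
have C20 : 0 <= C2 by rewrite mulr_ge0 ?sqr_ge0.
exists (c ^+ 3 / 3 + `|s| * c ^+ 2 + `|x| * c + C2), (c ^+ 2 + 2 * `|s| * c + `|x|).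
move=> u r u0 u1 r0; rewrite ReS.
pose b := c * u; pose k := (1 - u) / 2.
have b0 : 0 <= b by rewrite mulr_ge0// ltW.
have bc : b <= c by rewrite ler_piMr// ltW.
have k0 : 0 <= k by rewrite divr_ge0// subr_ge0.
have k1 : k <= 1 / 2 by rewrite /k; lra.
rewrite -/b -/k exprMn sin_pi3_sqr.
have -> : (b + r * k) ^+ 3 / 3 - (b + r * k) * (r ^+ 2 * (3 / 4)) + s * ((b + r * k) ^+ 2 - r ^+ 2 * (3 / 4)) - x * (b + r * k)
  = (b ^+ 3 / 3 + s * b ^+ 2 - x * b) + (b ^+ 2 * k + 2 * s * b * k - x * k) * r
    - (b + s) * (3 / 4 - k ^+ 2) * r ^+ 2 - k * (3 / 4 - k ^+ 2 / 3) * r ^+ 3 by field.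
have s1 : s <= `|s| by exact: ler_norm.
have s2 : - s <= `|s| by rewrite -normrN; exact: ler_norm.
have x1 : - x <= `|x| by rewrite -normrN; exact: ler_norm.
have sn : 0 <= `|s| by [].
have xn : 0 <= `|x| by [].
have b2 : b ^+ 2 <= c ^+ 2 by rewrite ler_sqr ?nnegrE// ltW.
have b3 : b ^+ 3 <= c ^+ 3 by rewrite lerXn2r ?nnegrE// ltW.
have bsq0 : 0 <= b ^+ 2 by exact: sqr_ge0.
have t0 : b ^+ 3 / 3 + s * b ^+ 2 - x * b <= c ^+ 3 / 3 + `|s| * c ^+ 2 + `|x| * c.
  have h1 : s * b ^+ 2 <= `|s| * c ^+ 2.
    by apply: (@le_trans _ _ (`|s| * b ^+ 2)); rewrite ?ler_wpM2r ?ler_wpM2l.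
  have h2 : - x * b <= `|x| * c.
    by apply: (@le_trans _ _ (`|x| * b)); rewrite ?ler_wpM2r ?ler_wpM2l.
  lra.
have t1 : b ^+ 2 * k + 2 * s * b * k - x * k <= c ^+ 2 + 2 * `|s| * c + `|x|.
  have h1 : b ^+ 2 * k <= c ^+ 2 by apply: le_trans b2; rewrite ler_piMr//; lra.
  have h2 : s * b * k <= `|s| * c.
    apply: (@le_trans _ _ (`|s| * b * k)).
      by rewrite ler_wpM2r// ler_wpM2r.
    apply: (@le_trans _ _ (`|s| * b)); last by rewrite ler_wpM2l.
    by rewrite ler_piMr ?mulr_ge0//; lra.
  have h3 : - x * k <= `|x|.
    apply: (@le_trans _ _ (`|x| * k)); first by rewrite ler_wpM2r.
    by rewrite ler_piMr//; lra.
  lra.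
have k2 : k ^+ 2 <= 1 / 4 by nra.
have k2' : 0 <= k ^+ 2 by exact: sqr_ge0.
have r2 : 0 <= r ^+ 2 by exact: sqr_ge0.
have r3 : 0 <= r ^+ 3 by rewrite exprn_ge0// ltW.
have t3 : - (k * (3 / 4 - k ^+ 2 / 3) * r ^+ 3) <= - (2 / 3 * k * r ^+ 3).
  rewrite lerN2 ler_wpM2r// mulrC ler_wpM2l//; lra.
have t2 : - ((b + s) * (3 / 4 - k ^+ 2) * r ^+ 2) <= - (u * kap * r ^+ 2) + k * (3 / 2 * `|s|) * r ^+ 2.
  have bs : b + s = u * (2 * kap) + 2 * k * s by rewrite /b /kap /k; field.
  have h1 : u * kap <= u * (2 * kap) * (3 / 4 - k ^+ 2).
    have : 0 <= u * kap by rewrite mulr_ge0// ltW.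
    nra.
  have h2 : - (2 * k * s * (3 / 4 - k ^+ 2)) <= k * (3 / 2 * `|s|).
    have h4 : 0 <= 2 * k * (3 / 4 - k ^+ 2) by rewrite mulr_ge0 ?mulr_ge0//; lra.
    have h3 : - s * (2 * k * (3 / 4 - k ^+ 2)) <= `|s| * (2 * k * (3 / 4 - k ^+ 2)) by rewrite ler_wpM2r.
    have h5 : `|s| * (2 * k * (3 / 4 - k ^+ 2)) <= `|s| * (k * (3 / 2)).
      by rewrite ler_wpM2l// -mulrA mulrCA ler_wpM2l//; lra.
    lra.
  have hq : - ((b + s) * (3 / 4 - k ^+ 2)) <= - (u * kap) + k * (3 / 2 * `|s|).
    by rewrite bs; lra.
  have := ler_wpM2r r2 hq; lra.
have t4 : k * (M * r ^+ 2 - 2 / 3 * r ^+ 3) <= C2.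
  have h : M * r ^+ 2 - 2 / 3 * r ^+ 3 <= C2.
    have -> : M * r ^+ 2 - 2 / 3 * r ^+ 3 = (M - 2 / 3 * r) * r ^+ 2 by ring.
    case: (lerP (3 / 2 * M) r) => rM.
      by apply: le_trans C20; rewrite mulr_le0_ge0//; lra.
    apply: (@le_trans _ _ (M * r ^+ 2)); first by rewrite ler_wpM2r//; lra.
    by rewrite ler_wpM2l// ler_sqr ?nnegrE; lra.
  apply: (@le_trans _ _ (k * C2)); first by rewrite ler_wpM2l.
  by rewrite ler_piMl//; lra.
have t1r := ler_wpM2r (ltW r0) t1.
have uk : u = 1 - 2 * k by rewrite /k; field.
rewrite /M uk in t2 t4 *.
lra.
Qed.

Let gam_dom : exists2 M, 0 <= M & forall u r, 0 <= u -> u <= 1 -> 0 < r ->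
  expR (complex.Re (S (gam u r))) * (1 + r) ^+ 3 <= M * (1 + r ^+ 2)^-1.
Proof.
have [C0 [C1 SB]] := ReS_bound.
(* The 3 pays for [(1 + r)^3 <= e^(3 r)]; the power 3 is the degree in [r] that the factor of [E] in
   [H] is allowed. *)
have [M M0 HM] := gauss_dom (C1 + 3) kap_gt0.
exists (expR C0 * M) => [|u r u0 u1 r0]; first by rewrite mulr_ge0 ?expR_ge0.
apply: (@le_trans _ _ (expR C0 * expR ((C1 + 3) * r - kap * r ^+ 2))); last first.
  by rewrite -[leRHS]mulrA ler_wpM2l ?expR_ge0.
have r1 : 0 <= 1 + r by rewrite addr_ge0// ltW.
apply: (@le_trans _ _ (expR (C0 + C1 * r - kap * r ^+ 2) * expR (3 * r))); last first.
  by rewrite -!expRD ler_expR; lra.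
rewrite ler_pM ?expR_ge0 ?exprn_ge0 ?ler_expR ?SB//.
rewrite mulrC expRM_natr lerXn2r ?nnegrE ?expR_ge0//.
exact: expR_ge1Dx.
Qed.

Let cn_gam u r : 0 <= u -> u <= 1 -> 0 < r -> cn (gam u r) <= (c + 2) * (1 + r).
Proof.
move=> u0 u1 r0; apply: le_trans (cn_le_ReIm _) _; rewrite /=.
have h0 := sin_pi3_gt0; have h1 := sin_pi3_le1.
have cu : 0 <= c * u by rewrite mulr_ge0// ltW.
have cu1 : c * u <= c by rewrite ler_piMr// ltW.
have rk : 0 <= r * ((1 - u) / 2) by rewrite mulr_ge0 ?(ltW r0)// divr_ge0// subr_ge0.
have rk1 : r * ((1 - u) / 2) <= r by rewrite ler_piMr ?(ltW r0)//; lra.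
have rh : 0 <= r * sin_pi3 by rewrite mulr_ge0 ?ltW.
have rh1 : r * sin_pi3 <= r by rewrite ler_piMr// ltW.
rewrite !ger0_norm ?addr_ge0//.
have : 0 < c * r by rewrite mulr_gt0.
have := c_gt0; lra.
Qed.

Let cn_gamr u : 0 <= u -> u <= 1 -> cn (gamr u) <= 2.
Proof.
move=> u0 u1; apply: le_trans (cn_le_ReIm _) _; rewrite /=.
have h0 := sin_pi3_gt0; have h1 := sin_pi3_le1.
by rewrite !ger0_norm ?(ltW h0)//; lra.
Qed.

Let cn_gamu r : 0 < r -> cn (gamu r) <= (c + 2) * (1 + r).
Proof.
move=> r0; rewrite cn_real; apply: le_trans (ler_normB _ _) _.
have c0 := c_gt0.
have : 0 < c * r by rewrite mulr_gt0.
by rewrite !ger0_norm; lra.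
Qed.

Let cn_E u r : cn (E u r) = expR (complex.Re (S (gam u r))).
Proof. exact: cn_cexp. Qed.

Let c2_ge0 : 0 <= c + 2.
Proof. by have := c_gt0; lra. Qed.

Let pow_le (r : R) (m n : nat) : 0 < r -> (m <= n)%N -> (1 + r) ^+ m <= (1 + r) ^+ n.
Proof. by move=> r0 mn; rewrite ler_weXn2l// lerDl ltW. Qed.

Let K : R := (c + 2) ^+ 2 + 2 * `|s| * (c + 2) + `|x|.
Let K0 : 0 <= K.
Proof. by rewrite /K !addr_ge0 ?sqr_ge0// mulr_ge0// mulr_ge0. Qed.

Let cn_S' u r : 0 <= u -> u <= 1 -> 0 < r -> cn (S' (gam u r)) <= K * (1 + r) ^+ 2.
Proof.
move=> u0 u1 r0; have g := cn_gam u0 u1 r0.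
have r1 : 0 <= 1 + r by rewrite addr_ge0// ltW.
apply: le_trans (cnB _ _) _; rewrite /K [leRHS]mulrDl; apply: lerD; last first.
  rewrite cn_real ler_peMr// -(expr0 (1 + r)); exact: pow_le.
apply: le_trans (cnD _ _) _; rewrite [leRHS]mulrDl; apply: lerD.
  by rewrite cnX -exprMn lerXn2r ?nnegrE ?cn_ge0// mulr_ge0.
rewrite cnM cn_real normrM (ger0_norm (ler0n R 2)) -(mulrA (2 * `|s|)) ler_wpM2l ?mulr_ge0//.
apply: le_trans g _; rewrite ler_wpM2l// -{1}(expr1 (1 + r)); exact: pow_le.
Qed.

Let dom_E F M : (forall u r, 0 <= u -> u <= 1 -> 0 < r -> cn (F u r) <= M * (1 + r) ^+ 3) -> 0 <= M ->
  exists2 A, 0 <= A & forall u r, 0 <= u -> u <= 1 -> 0 < r -> cn (E u r * F u r) <= A * (1 + r ^+ 2)^-1.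
Proof.
move=> FM M0; have [A A0 HA] := gam_dom.
exists (A * M) => [|u r u0 u1 r0]; first by rewrite mulr_ge0.
rewrite cnM cn_E; apply: (@le_trans _ _ (expR (complex.Re (S (gam u r))) * (M * (1 + r) ^+ 3))).
  by rewrite ler_wpM2l ?expR_ge0// FM.
by rewrite mulrCA [leRHS]mulrAC [leRHS]mulrC ler_wpM2l// HA.
Qed.

Let H_dom : exists2 A, 0 <= A & forall u r, 0 <= u -> u <= 1 -> 0 < r -> cn (H u r) <= A * (1 + r ^+ 2)^-1.
Proof.
apply: (@dom_E (fun u r => S' (gam u r) * gamu r * gamr u - (1 / 2)%:C) (K * (c + 2) * 2 + 1)); last first.
  by rewrite addr_ge0// !mulr_ge0.
move=> u r u0 u1 r0; apply: le_trans (cnB _ _) _; rewrite [leRHS]mulrDl; apply: lerD.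
  rewrite !cnM.
  have -> : K * (c + 2) * 2 * (1 + r) ^+ 3 = (K * (1 + r) ^+ 2) * ((c + 2) * (1 + r)) * 2 by ring.
  have r1 : 0 <= 1 + r by rewrite addr_ge0// ltW.
  by rewrite ler_pM ?mulr_ge0 ?cn_ge0 ?cn_gamr// ler_pM ?cn_ge0 ?cn_S' ?cn_gamu.
rewrite cn_real [leRHS]mul1r ger0_norm//; apply: (@le_trans _ _ 1); first by lra.
by rewrite -(expr0 (1 + r)); exact: pow_le.
Qed.

Let Q_dom : exists2 A, 0 <= A & forall u r, 0 <= u -> u <= 1 -> 0 < r -> cn (Q u r) <= A * (1 + r ^+ 2)^-1.
Proof.
apply: (@dom_E (fun u r => gamu r) (c + 2)) => // u r u0 u1 r0.
apply: le_trans (cn_gamu r0) _; rewrite ler_wpM2l// -{1}(expr1 (1 + r)); exact: pow_le.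
Qed.

Let P_dom : exists2 A, 0 <= A & forall u r, 0 <= u -> u <= 1 -> 0 < r -> cn (P u r) <= A * (1 + r ^+ 2)^-1.
Proof.
apply: (@dom_E (fun u r => gamr u) 2) => // u r u0 u1 r0.
apply: le_trans (cn_gamr u0 u1) _; rewrite ler_peMr// -(expr0 (1 + r)); exact: pow_le.
Qed.

Let mgam : Cmf (fun z : R * R => gam z.1 z.2).
Proof. by apply: Cmf_line; mf_tac. Qed.

Let mE : Cmf (fun z : R * R => E z.1 z.2).
Proof. by rewrite /E /S; Cmf_tac. Qed.

Let mH : Cmf (fun z : R * R => H z.1 z.2).
Proof. by rewrite /H /S' /gamu /gamr; Cmf_tac. Qed.

Let mP : Cmf (fun z : R * R => P z.1 z.2).
Proof. by rewrite /P /gamr; Cmf_tac. Qed.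

Let JP u : 0 <= u -> u <= 1 -> J (fun r => pos r * complex.Im (P u r)).
Proof.
move=> u0 u1; have [A A0 HA] := P_dom.
apply: (@J_dom _ _ (fun r => A * (1 + r ^+ 2)^-1)).
- apply: mfM; [exact: mf_pos mf_id|exact: (Cmf_section1 u mP).2].
- move=> r; rewrite normrM (ger0_norm (pos_ge0 r)).
  case: (ltP 0 r) => r0; last by rewrite pos0// mul0r mulr_ge0// invr_ge0 addr_ge0 ?sqr_ge0.
  rewrite pos1// mul1r (le_trans (Im_le_cn _))// HA//.
- by apply: JZ; exact: J_cauchy.
Qed.

(** The two rays of the definition contribute conjugate values, so that only the imaginary part has
    to be moved to the vertical line. *)
Lemma ray_line : I (fun r => pos r * complex.Im (P 1 r)) = I (fun r => pos r * complex.Im (P 0 r)).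
Proof.
have [A A0 HA] := H_dom; have [B B0 HB] := Q_dom.
apply: (@green _ (fun u r => complex.Im (P u r)) (fun u r => complex.Im (Q u r)) (fun u r => complex.Im (H u r)) (fun r => A * (1 + r ^+ 2)^-1)).
- by move=> u r; have [] := P_u u r.
- by move=> u r; have [] := Q_r u r.
- exact: H_u.
- exact: H_r.
- exact: mH.2.
- by apply: JZ; exact: J_cauchy.
- by move=> r; rewrite mulr_ge0// invr_ge0 addr_ge0 ?sqr_ge0.
- move=> u r u0 u1 r0; rewrite (le_trans (Im_le_cn _))// HA// ltW//.
- move=> u u0 u1; apply/norm_cvg0P.
  apply: (@squeeze_cvgr _ _ _ _ (fun=> 0) (fun n => B * (1 + (n.+1%:R : R) ^+ 2)^-1)).
  + apply: nearW => n; rewrite normr_ge0; apply: le_trans (Im_le_cn _) _.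
    by apply: HB => //; exact: ltW.
  + exact: cvg_cst.
  + by rewrite -[X in _ --> X](mulr0 B); apply: cvgMr; exact: cvg_cauchy.
(* For [r = 0] the contour runs along the real segment from 0 to [c], where the form is real and its
   imaginary part vanishes. *)
- move=> u.
  have -> : Q u 0 = (expR ((c * u) ^+ 3 / 3 + s * (c * u) ^+ 2 - x * (c * u)) * c)%:C.
    rewrite /Q /E /gam /gamu !mul0r addr0 subr0 [RHS]rmorphM /= -cexp_real; congr (cexp _ * _).
    rewrite -[c * u +i* 0]/((c * u)%:C) /S; move: (c * u) => v.
    rewrite -[v%:C ^+ 3]/(v%:C * (v%:C * v%:C)) -[v%:C ^+ 2]/(v%:C * v%:C).
    rewrite -[v ^+ 3]/(v * (v * v)) -[v ^+ 2]/(v * v).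
    by rewrite rmorphB rmorphD !rmorphM fmorphV rmorph_nat.
  by [].
- by apply: JP.
- by apply: JP.
Unshelve. all: by end_near. Qed.

Let f (z : C) : C := airy_integrand s x z.

Let Cmf_f (g : R -> C) : Cmf g -> Cmf (fun r => f (g r)).
Proof. by move=> mg; rewrite /f /airy_integrand; Cmf_tac. Qed.

Let P0E r : f (r%:C * cexp (0 +i* (pi / 3))) * cexp (0 +i* (pi / 3)) = P 0 r.
Proof.
have g0 : gamr 0 = cexp (0 +i* (pi / 3)) by rewrite wE /gamr subr0.
have -> : r%:C * cexp (0 +i* (pi / 3)) = gam 0 r.
  rewrite wE /gam; apply/eqP; rewrite eq_complex /=; apply/andP; split; apply/eqP; ring.
by rewrite -g0.
Qed.

Let mline : Cmf (fun y : R => c +i* y).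
Proof. exact: (Cmf_line (mf_cst c) mf_id). Qed.

Let ReF y : R := complex.Re (f (c +i* y)).

Let P1E r : complex.Im (P 1 r) = sin_pi3 * ReF (sin_pi3 * r).
Proof.
rewrite /P /gamr subrr mul0r /ReF /f /airy_integrand /E /S /gam mulr1 subrr mul0r mulr0 addr0.
rewrite (mulrC r); case: (cexp _) => p q /=; ring.
Qed.

Lemma cn_airy_line y : cn (airy_integrand s x (c +i* y)) =
  expR (c ^+ 3 / 3 + s * c ^+ 2 - x * c) * expR (- (c + s) * y ^+ 2).
Proof. by rewrite cn_cexp -expRD -/(S _) ReS; congr expR; field. Qed.

Let mReF : mf ReF.
Proof. exact: (Cmf_f mline).1. Qed.

Let J_line : CJ (fun y => f (c +i* y)).
Proof.
have cs : 0 < c + s by have := sc; lra.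
have [M M0 HM] := gauss_dom 0 cs.
apply: (@CJ_dom _ _ (fun y => expR (c ^+ 3 / 3 + s * c ^+ 2 - x * c) * (M * (1 + y ^+ 2)^-1))).
- exact: (Cmf_f mline).
- move=> y; rewrite cn_airy_line ler_wpM2l ?expR_ge0//; apply: le_trans (HM y).
  by rewrite mul0r sub0r mulNr.
- by apply: JZ; apply: JZ; exact: J_cauchy.
Qed.

Let f_conj z : f (z^*)%C = (f z)^*%C.
Proof. exact: airy_integrand_conj. Qed.

Let airys_Re : airys s x = pi^-1 * I (fun r => pos r * ReF r).
Proof.
set w : C := cexp (0 +i* (pi / 3)).
have wc : cexp (0 +i* - (pi / 3)) = (w^*)%C by rewrite -cexp_conj /= ?oppr0.
have rc r : r%:C * (w^*)%C = ((r%:C * w)^*)%C.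
  by rewrite -[in LHS](conjc_real_complex r) -rmorphM.
have mw (v : C) : Cmf (fun r : R => r%:C * v).
  by apply: CmfM; [exact: (Cmf_real mf_id)|exact: Cmf_cst].
have Jg := JP (lexx 0) ler01.
have ImCI (g : R -> C) : complex.Im (CI g) = I (fun r => complex.Im (g r)) by [].
have E1 : complex.Im (ray_integral w f) = I (fun r => pos r * complex.Im (P 0 r)).
  have -> : ray_integral w f = CI (fun r => (pos r)%:C * P 0 r).
    rewrite /ray_integral cint_cy; last by apply: CmfM; [exact: (Cmf_f (mw _))|exact: Cmf_cst].
    by apply: CI_ext => r; rewrite P0E.
  rewrite ImCI; apply: I_ext => r.
  by case: (P 0 r) => p q /=; rewrite mul0r addr0.
have E2 : complex.Im (ray_integral (w^*)%C f) = - I (fun r => pos r * complex.Im (P 0 r)).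
  have -> : ray_integral (w^*)%C f = CI (fun r => (pos r)%:C * (P 0 r)^*%C).
    rewrite /ray_integral cint_cy; last by apply: CmfM; [exact: (Cmf_f (mw _))|exact: Cmf_cst].
    by apply: CI_ext => r; rewrite rc f_conj -rmorphM P0E.
  rewrite ImCI -IN//; apply: I_ext => r.
  by case: (P 0 r) => p q /=; rewrite mul0r addr0 mulrN.
have E3 : two_pi_i * airyC s x = ray_integral w f - ray_integral (w^*)%C f.
  rewrite /airyC wc mulrA divff ?mul1r//.
  by rewrite /two_pi_i mulf_neq0// ?complexI ?eq_complex /= ?oner_eq0 ?andbF// mulf_eq0 negb_and; have := pi_gt0 R; rewrite pnatr_eq0 /= => /gt_eqF ->.
have ImB (z z' : C) : complex.Im (z - z') = complex.Im z - complex.Im z'.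
  by case: z => ? ?; case: z'.
have Im2 (v : R) : complex.Im (two_pi_i * v%:C) = 2 * pi * v.
  by rewrite /two_pi_i /=; ring.
have EA : 2 * pi * airys s x = 2 * I (fun r => pos r * complex.Im (P 1 r)).
  by rewrite -Im2 -airyCE E3 ImB E1 E2 -ray_line; ring.
move: EA.
have -> : I (fun r => pos r * complex.Im (P 1 r)) = I (fun r => pos r * ReF r).
  have Jp : J (fun r => pos r * ReF r).
    apply: J_dom (J_norm J_line.1); first by mf_tac.
    by move=> r; rewrite normrM ler_piMl// ger0_norm ?pos_ge0 ?pos_le1.
  (* At [u = 1] the parameter [r] stands for the height [r * sin_pi3], and the rescaling removes
     this factor. *)
  transitivity (I (fun r => sin_pi3 * (pos (sin_pi3 * r) * ReF (sin_pi3 * r)))).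
    apply: I_ext => r; rewrite P1E mulrCA.
    by have -> : pos (sin_pi3 * r) = pos r by rewrite /pos pmulr_rgt0 ?sin_pi3_gt0.
  rewrite IZ; last exact: (J_scale sin_pi3_gt0 Jp).
  by rewrite (I_scale sin_pi3_gt0 Jp) mulrA mulfV ?mul1r// lt0r_neq0// sin_pi3_gt0.
move=> EA; have := pi_gt0 R => p0.
apply: (mulfI (lt0r_neq0 p0)); rewrite mulrA mulfV ?lt0r_neq0// mul1r.
by move: EA; lra.
Qed.

(** The homotopy carries the definition to the upper half of the line, and conjugation symmetry adds
    the lower half. On the line the integrand has modulus a multiple of [e^(-(c + s) y^2)], hence
    the condition [- s < c]. *)
Lemma airy_line : (airys s x)%:C =
  ((2 * pi)^-1)%:C * CI (fun y => airy_integrand s x (c +i* y)).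
Proof.
have fc y : f (c +i* - y) = (f (c +i* y))^*%C by rewrite -f_conj.
have Im0 : I (fun y => complex.Im (f (c +i* y))) = 0.
  apply: I_odd; first exact: J_line.2.
  by move=> y; rewrite fc; case: (f _).
move: airys_Re; set X := I (fun r => pos r * ReF r) => AR.
have Re2 : I (fun y => complex.Re (f (c +i* y))) = 2 * X.
  apply: I_even; first exact: J_line.1.
  by move=> y; rewrite fc; case: (f _).
rewrite CIE Im0 Re2 AR.
move: X {AR Re2} => X; apply/eqP; rewrite eq_complex /= !(mul0r, mulr0, subr0, addr0) eqxx andbT.
by rewrite invfM mulrACA mulVf ?mul1r// pnatr_eq0.
Qed.

End Fixed.
End AiryContour.

(** * Correlations of exponentially decaying functions *)

Section Weighted.
Context {R : realType}.
Implicit Types f g k l : R -> R.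

Lemma I_except0 f g : mf f -> mf g -> (forall x, x != 0 -> f x = g x) -> I f = I g.
Proof.
move=> mf0 mg fg; rewrite /I /Rintegral; congr fine.
apply: ae_eq_integral => //; [exact/measurable_EFinP|exact/measurable_EFinP|].
exists [set 0]; split => //; first exact: lebesgue_measure_set1.
move=> x /=; apply: contra_notP => x0 _; congr EFin; apply: fg.
exact/eqP.
Qed.

Definition wt (x : R) : R := pos x * expR (- x).

Lemma wt_ge0 x : 0 <= wt x.
Proof. by rewrite mulr_ge0 ?pos_ge0 ?expR_ge0. Qed.

Lemma wt_le1 x : wt x <= 1.
Proof.
rewrite /wt; case: (ltP 0 x) => x0; last by rewrite pos0// mul0r.
by rewrite pos1// mul1r -expR0 ler_expR lerNl oppr0 ltW.
Qed.

Lemma wt_neg x : x <= 0 -> wt x = 0.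
Proof. by move=> x0; rewrite /wt pos0// mul0r. Qed.

Lemma eintegral_exp (a : R) : 0 < a ->
  (\int[@lebesgue_measure R]_x (pos x * expR (- a * x))%:E = (a^-1)%:E)%E.
Proof.
move=> a0.
have mE : mf (fun x => pos x * expR (- a * x)).
  by apply: mfM; [exact: mf_pos mf_id|apply: mf_exp; apply: mfM; [exact: mf_cst|exact: mf_id]].
have dE (x : R) : is_derive x 1 (fun y : R => - a^-1 * expR (- a * y)) (expR (- a * x)).
  have h : is_derive x 1 (fun y : R => expR (- a * y)) (expR (- a * x) * (- a)).
    apply: (is_derive1_comp (f := expR) (g := fun y => - a * y)).
    apply: (@is_derive_eq _ _ _ (- a \*: id) x 1 _ _ (is_deriveZ _ _)).
    by rewrite /= -[_ *: _]/(_ * _) mulr1.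
  apply: (@is_derive_eq _ _ _ (- a^-1 \*: (fun y : R => expR (- a * y))) x 1 _ _ (is_deriveZ _ _)).
  by rewrite -[_ *: _]/(_ * _); field; rewrite gt_eqF.
have cF : {for (0 : R), continuous (fun y : R => - a^-1 * expR (- a * y))}.
  by apply: differentiable_continuous; apply/derivable1_diffP; have := dE 0; case.
have cE : continuous (fun y : R => expR (- a * y)).
  move=> x; apply: (@continuous_comp _ _ _ (fun y => - a * y) expR); last exact: continuous_expR.
  by apply: mulrl_continuous.
have -> : (fun x => (pos x * expR (- a * x))%:E) =
    (fun x => (expR (- a * x))%:E) \_ `]0, +oo[%classic.
  apply/funext => x; rewrite patchE mem_setE in_itv /= andbT /pos.
  by case: ltP => _; rewrite ?mul1r ?mul0r.
rewrite -integral_mkcond integral_itv_obnd_cbnd; last first.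
  by apply/measurable_EFinP; apply: measurable_funTS; apply: mf_continuous.
rewrite (ge0_continuous_FTC2y (F := fun y => - a^-1 * expR (- a * y)) (l := 0)).
- by rewrite mulr0 expR0 mulr1 -EFinB sub0r opprK.
- by move=> x _; exact: expR_ge0.
- exact: continuous_subspaceT.
- rewrite -[X in _ --> X](mulr0 (- a^-1)); apply: cvgMr.
  have -> : (fun x : R => expR (- a * x)) = (fun x => expR (- x)) \o (fun x => a * x).
    by apply/funext => x /=; rewrite mulNr.
  apply: (cvg_comp _ _ _ (@cvgr_expR R)).
  exact: gt0_cvgMry.
- by move=> x _; have := dE x; case.
- by apply: cvg_at_right_filter; exact: cF.
- by move=> x _; rewrite derive1E; have := dE x; case.
Qed.

Lemma J_exp (a : R) : 0 < a -> J (fun x => pos x * expR (- a * x)).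
Proof.
move=> a0; apply: (@J_fin _ _ a^-1); last by rewrite eintegral_exp.
  by apply: mfM; [exact: mf_pos mf_id|apply: mf_exp; apply: mfM; [exact: mf_cst|exact: mf_id]].
by move=> x; rewrite mulr_ge0 ?pos_ge0 ?expR_ge0.
Qed.

Lemma I_exp (a : R) : 0 < a -> I (fun x => pos x * expR (- a * x)) = a^-1.
Proof. by move=> a0; rewrite /I /Rintegral eintegral_exp. Qed.

Lemma J_wt : J wt.
Proof. by apply: J_ext (J_exp ltr01) => x; rewrite /wt mulN1r. Qed.

Lemma I_wt : I (wt) = 1.
Proof.
transitivity (I (fun x : R => pos x * expR (- 1 * x))); last by rewrite I_exp ?ltr01// invr1.
by apply: I_ext => x; rewrite /wt mulN1r.
Qed.

(* [dec M f]: [f] vanishes on the negative axis and decays like [M e^{-x}] on the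
   positive one. *)
Definition dec (M : R) f := mf f /\ forall x, `|f x| <= M * wt x.

Definition tr f x := pos x * f x.

Lemma trE f x : tr f x = pos x * f x.
Proof. by []. Qed.

Lemma mf_tr f : mf f -> mf (tr f).
Proof. by move=> m; apply: mfM => //; exact: mf_pos mf_id. Qed.

Lemma tr_pos f x : 0 < x -> tr f x = f x.
Proof. by move=> x0; rewrite /tr pos1// mul1r. Qed.

Lemma tr_neg f x : x <= 0 -> tr f x = 0.
Proof. by move=> x0; rewrite /tr pos0// mul0r. Qed.

Lemma dec_tr M f : 0 <= M -> mf f -> (forall x, 0 < x -> `|f x| <= M * expR (- x)) -> dec M (tr f).
Proof.
move=> M0 m fM; split; first exact: mf_tr.
move=> x; case: (ltP 0 x) => x0; last by rewrite tr_neg// normr0 mulr_ge0 ?wt_ge0.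
by rewrite tr_pos// /wt pos1// mul1r fM.
Qed.

Lemma dec_neg M f x : dec M f -> x <= 0 -> f x = 0.
Proof. by move=> [_ fM] x0; have := fM x; rewrite wt_neg// mulr0 normr_le0 => /eqP. Qed.

Lemma dec_bnd M f x : dec M f -> `|f x| <= M.
Proof.
move=> [_ fM]; apply: le_trans (fM x) _.
have M0 : 0 <= M.
  have := le_trans (normr_ge0 _) (fM 1); rewrite /wt pos1// mul1r.
  by rewrite pmulr_lge0// expR_gt0.
by rewrite ler_piMr// wt_le1.
Qed.

Lemma dec_ge0 M f : dec M f -> 0 <= M.
Proof. by move=> d; apply: le_trans (normr_ge0 (f 0)) (dec_bnd 0 d). Qed.

Lemma dec_tr_id M f x : dec M f -> tr f x = f x.
Proof.
move=> d; case: (ltP 0 x) => x0; first by rewrite tr_pos.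
by rewrite tr_neg// (dec_neg d).
Qed.

Lemma decD M N f g : dec M f -> dec N g -> dec (M + N) (fun x => f x + g x).
Proof.
move=> [m1 f1] [m2 g1]; split; first by mf_tac.
by move=> x; apply: le_trans (ler_normD _ _) _; rewrite mulrDl lerD.
Qed.

Lemma decN M f : dec M f -> dec M (fun x => - f x).
Proof. by move=> [m1 f1]; split; [mf_tac|move=> x; rewrite normrN]. Qed.

Lemma decB M N f g : dec M f -> dec N g -> dec (M + N) (fun x => f x - g x).
Proof. by move=> d1 d2; exact: decD d1 (decN d2). Qed.

Lemma dec_le M N f : M <= N -> dec M f -> dec N f.
Proof.
move=> MN [m1 f1]; split=> // x; apply: le_trans (f1 x) _.
by rewrite ler_wpM2r ?wt_ge0.
Qed.

Definition star k f (w : R) : R := I (fun x => k x * f (x + w)).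

Lemma starE k f w : star k f w = I (fun x => k x * f (x + w)).
Proof. by []. Qed.

Lemma J_star M B k f w : dec M k -> mf f -> (forall x, `|f x| <= B) -> J (fun x => k x * f (x + w)).
Proof.
move=> d mf0 fB; have [mk kM] := d; apply: (@J_dom _ _ (fun x => M * wt x * B)).
- by apply: mfM => //; apply: (mf_comp mf0); mf_tac.
- by move=> x; rewrite normrM ler_pM.
- by apply: JZr; apply: JZ; exact: J_wt.
Qed.

Lemma mf_star k f : mf k -> mf f -> mf (star k f).
Proof.
move=> mk mf0; apply: (mf_I (F := fun w x => k x * f (x + w))).
by apply: mfM; [apply: (mf_comp mk)|apply: (mf_comp mf0)]; mf_tac.
Qed.

Lemma star_bnd M B k f w : dec M k -> mf f -> (forall x, `|f x| <= B) -> `|star k f w| <= M * B.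
Proof.
move=> d mf0 fB; have [mk kM] := d.
have -> : M * B = I (fun x => M * B * wt x).
  rewrite IZ; last exact: J_wt.
  have -> : I wt = 1; last by rewrite mulr1.
  by rewrite -[RHS]invr1 -(I_exp ltr01); apply: I_ext => x; rewrite /wt mulN1r.
apply: I_norm_le; last by apply: JZ; exact: J_wt.
  by apply: mfM => //; apply: (mf_comp mf0); mf_tac.
by move=> x; rewrite normrM mulrAC ler_pM.
Qed.

(* Both factors decay, which gains the factor [1/2 = int e^{-2x} dx]. *)
Lemma star_decay M N k f w : dec M k -> mf f -> (forall x, 0 < x -> `|f x| <= N * expR (- x)) ->
  0 <= w -> `|star k f w| <= M * N / 2 * expR (- w).
Proof.
move=> d mf0 fN w0; have [mk kM] := d.
have e : M * N / 2 * expR (- w) = I (fun x => M * N * expR (- w) * (pos x * expR (- 2 * x))).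
  by rewrite IZ ?I_exp//; [ring|exact: J_exp].
rewrite e; apply: I_norm_le; last by apply: JZ; exact: J_exp.
  by apply: mfM => //; apply: (mf_comp mf0); mf_tac.
move=> x; case: (ltP 0 x) => x0; last by rewrite (dec_neg d)// pos0// !(mul0r, mulr0, normr0).
have := kM x; rewrite /wt pos1// !mul1r => kx.
have fx := fN (x + w) (ltr_wpDr w0 x0).
rewrite normrM; apply: le_trans (ler_pM _ _ kx fx) _ => //.
have -> : M * N * expR (- w) * expR (- 2 * x) = M * expR (- x) * (N * expR (- (x + w))).
  have -> : - 2 * x = - x + - x by ring.
  by rewrite opprD !expRD; ring.
by [].
Qed.

Lemma dec_star M N k f : dec M k -> dec N f -> dec (M * N / 2) (tr (star k f)).
Proof.
move=> d d'; have [mk _] := d; have [mf0 fN] := d'.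
apply: dec_tr; first by rewrite !mulr_ge0 ?(dec_ge0 d) ?(dec_ge0 d').
  exact: mf_star.
move=> x x0; apply: star_decay d mf0 _ (ltW x0).
by move=> y y0; have := fN y; rewrite /wt pos1// mul1r.
Qed.

Lemma star_tr M k f w : dec M k -> 0 <= w -> star k (tr f) w = star k f w.
Proof.
move=> d w0; apply: I_ext => x; case: (ltP 0 x) => x0; last by rewrite (dec_neg d)// !mul0r.
by rewrite tr_pos// ltr_wpDr.
Qed.

Lemma starD M B B' k f g w : dec M k -> mf f -> mf g -> (forall x, `|f x| <= B) ->
  (forall x, `|g x| <= B') ->
  star k (fun x => f x + g x) w = star k f w + star k g w.
Proof.
move=> d m1 m2 b1 b2; rewrite /star -ID; [|exact: J_star d m1 b1|exact: J_star d m2 b2].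
by apply: I_ext => x; rewrite mulrDr.
Qed.

Lemma starBl M N B k l f w : dec M k -> dec N l -> mf f -> (forall x, `|f x| <= B) ->
  star (fun x => k x - l x) f w = star k f w - star l f w.
Proof.
move=> d1 d2 m1 b1; rewrite /star -IB; [|exact: J_star d1 m1 b1|exact: J_star d2 m1 b1].
by apply: I_ext => x; rewrite mulrBl.
Qed.

(** Both sides are the double integral of [k x * l y * f (x + y + w)]. *)
Lemma star_comm M N B k l f w : dec M k -> dec N l -> mf f -> (forall x, `|f x| <= B) ->
  star k (star l f) w = star l (star k f) w.
Proof.
move=> d1 d2 mf0 fB; have [mk kM] := d1; have [ml lN] := d2.
have B0 : 0 <= B by apply: le_trans (normr_ge0 _) (fB 0).
transitivity (I (fun x => I (fun y => k x * (l y * f (y + (x + w)))))).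
  by apply: I_ext => x; rewrite IZ//; exact: J_star d2 mf0 fB.
rewrite (@fubini_prod _ (fun x y => k x * (l y * f (y + (x + w)))) (fun x => M * wt x) (fun y => N * wt y * B)).
- apply: I_ext => y.
  transitivity (I (fun x => l y * (k x * f (x + (y + w))))).
    by apply: I_ext => x; rewrite mulrCA; congr (_ * (_ * f _)); ring.
  by rewrite IZ//; exact: J_star d1 mf0 fB.
- by apply: mfM; [apply: (mf_comp mk)|apply: mfM; [apply: (mf_comp ml)|apply: (mf_comp mf0)]]; mf_tac.
- by apply: JZ; exact: J_wt.
- by apply: JZr; apply: JZ; exact: J_wt.
- by move=> x y; rewrite !normrM ler_pM ?mulr_ge0// ler_pM.
Qed.

Lemma star_opp M B k f w : dec M k -> mf f -> (forall x, `|f x| <= B) ->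
  star f k (- w) = star k f w.
Proof.
move=> d mf0 fB; have [mk kM] := d.
rewrite -[RHS](@I_shift _ _ (- w)); last exact: J_star d mf0 fB.
by apply: I_ext => x; rewrite subrK mulrC.
Qed.

Definition ip f g : R := I (fun x => f x * g x).

Lemma ipE f g : ip f g = I (fun x => f x * g x).
Proof. by []. Qed.

Lemma star0 k f : star k f 0 = ip k f.
Proof. by apply: I_ext => x; rewrite addr0. Qed.

Lemma J_ip M B f g : dec M f -> mf g -> (forall x, `|g x| <= B) -> J (fun x => f x * g x).
Proof.
move=> d m b; apply: J_ext (J_star 0 d m b) => x; by rewrite addr0.
Qed.

Lemma ipC f g : ip f g = ip g f.
Proof. by apply: I_ext => x; rewrite mulrC. Qed.

Lemma ip_tr M f g : dec M f -> ip f (tr g) = ip f g.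
Proof. by move=> d; rewrite -!star0 (star_tr _ d). Qed.

Lemma ip_bnd M B f g : dec M f -> mf g -> (forall x, `|g x| <= B) -> `|ip f g| <= M * B.
Proof. by move=> d m b; rewrite -star0; exact: star_bnd d m b. Qed.

(* The correlations [f * k] and [g * k] are integrated over the whole line, so the
   integral only depends on the autocorrelation of [k], an even function. *)
Lemma correlation_product M N P f g k : dec M f -> dec N g -> dec P k ->
  I (fun w => star f k w * star g k w) =
  ip f (star (tr (star k k)) g) + ip g (star (tr (star k k)) f).
Proof.
move=> df dg dk; have [mf0 fM] := df; have [mg gN] := dg; have [mk kP] := dk.
have kb x := dec_bnd x dk.
set r := star k k.
have mr : mf r by exact: mf_star.
have rb x : `|r x| <= P * P by exact: star_bnd dk mk kb.
have re z : r (- z) = r z by exact: star_opp dk mk kb.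
have mG : mf (star g k) by exact: mf_star.
have Gb w : `|star g k w| <= N * P by exact: star_bnd dg mk kb.
have M0 := dec_ge0 df; have N0 := dec_ge0 dg; have P0 := dec_ge0 dk.
transitivity (I (fun x => f x * I (fun y => g y * r (y - x)))).
  transitivity (I (fun w => I (fun x => star g k w * (f x * k (x + w))))).
    by apply: I_ext => w; rewrite mulrC -[star f k w]/(I (fun x => f x * k (x + w))) -IZ//; exact: J_star df mk kb.
  rewrite -(@fubini_conv _ (fun x w => star g k w * (f x * k (x + w))) (fun x => N * P * (M * wt x)) (fun x => P * wt x)).
  - apply: I_ext => x.
    transitivity (I (fun w => I (fun y => f x * k (x + w) * (g y * k (y + w))))).
      by apply: I_ext => w; rewrite mulrC -[star g k w]/(I (fun x => g x * k (x + w))) -IZ//; [exact: J_star dg mk kb].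
    rewrite -(@fubini_conv _ (fun y w => f x * k (x + w) * (g y * k (y + w))) (fun y => `|f x| * P * (N * wt y)) (fun x => P * wt x)).
    + transitivity (I (fun y => f x * (g y * r (y - x)))).
        apply: I_ext => y.
        have Jk : J (fun w => k w * k (w + (y - x))) by exact: J_star dk mk kb.
        rewrite /r /star -(I_shift x Jk) mulrA -IZ; last exact: J_shift x Jk.
        apply: I_ext => w; rewrite [x + w]addrC.
        have -> : w + x + (y - x) = y + w by ring.
        ring.
      rewrite IZ//; apply: (@J_ext _ (fun y => g y * r (y + (- x)))) => [y|]; first by [].
      exact: J_star dg mr rb.
    + by apply: mfM; [apply: mfM; [exact: mf_cst|apply: (mf_comp mk)]|apply: mfM; [apply: (mf_comp mg)|apply: (mf_comp mk)]]; mf_tac.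
    + by apply: JZ; apply: JZ; exact: J_wt.
    + by apply: JZ; exact: J_wt.
    + move=> y w; rewrite -(mulrA (`|f x| * P)) normrM (normrM (f x)).
      apply: ler_pM; rewrite ?mulr_ge0 ?ler_wpM2l// normrM [w + y]addrC.
      exact: ler_pM.
    + by exists P => v; rewrite ger0_norm ?mulr_ge0 ?wt_ge0// ler_piMr ?wt_le1.
  - by apply: mfM; [apply: (mf_comp mG)|apply: mfM; [apply: (mf_comp mf0)|apply: (mf_comp mk)]]; mf_tac.
  - by apply: JZ; apply: JZ; exact: J_wt.
  - by apply: JZ; exact: J_wt.
  - move=> x w; rewrite -mulrA normrM; apply: ler_pM => //.
    by rewrite normrM [w + x]addrC; exact: ler_pM.
  - by exists P => v; rewrite ger0_norm ?mulr_ge0 ?wt_ge0// ler_piMr ?wt_le1.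
have Jgr x : J (fun z => r z * g (z + x)).
  apply: J_ext (J_shift x (J_star (- x) dg mr rb)) => z.
  by rewrite addrK mulrC.
have dr : dec (P * P / 2) (tr r) by exact: dec_star.
have Jtr x : J (fun z => tr r z * g (z + x)) by exact: (J_star x dr mg (fun y => dec_bnd y dg)).
(* The autocorrelation is split at [z = 0]; evenness turns its negative half into [tr r] against
   [g (x - z)], and only the null point [z = 0] is mistreated. *)
have inner x : I (fun y => g y * r (y - x)) = star (tr r) g x + I (fun z => tr r z * g (x - z)).
  have -> : I (fun y => g y * r (y - x)) = I (fun z => r z * g (z + x)).
    rewrite -(@I_shift _ _ x); last exact: J_star (- x) dg mr rb.
    by apply: I_ext => z; rewrite addrK mulrC.
  have -> : I (fun z => r z * g (z + x)) = star (tr r) g x + I (fun z => r z * g (z + x) - tr r z * g (z + x)).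
    by rewrite IB// /star addrC subrK.
  congr (_ + _); rewrite -I_opp; last exact: JB.
  apply: I_except0.
  - by apply: mfD; [apply: mfM; [apply: (mf_comp mr)|apply: (mf_comp mg)]|apply: mfN; apply: mfM; [apply: (mf_comp (mf_tr mr))|apply: (mf_comp mg)]]; mf_tac.
  - by apply: mfM; [exact: mf_tr|apply: (mf_comp mg); mf_tac].
  - move=> z z0; rewrite re -mulrBl [- z + x]addrC; congr (_ * _).
    rewrite /tr re /pos oppr_gt0.
    by case: ltrgtP z0 => //= _ _; ring.
have mrg : mf (fun x : R => I (fun z => tr r z * g (x - z))).
  apply: (mf_I (F := fun x z => tr r z * g (x - z))).
  by apply: mfM; [apply: (mf_comp (mf_tr mr))|apply: (mf_comp mg)]; mf_tac.
have brg x : `|I (fun z => tr r z * g (x - z))| <= P * P / 2 * N.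
  apply: le_trans (ler_norm _) _; rewrite normr_id.
  have -> : P * P / 2 * N = I (fun z => P * P / 2 * N * wt z).
    rewrite IZ; last exact: J_wt.
    have -> : I wt = 1; last by rewrite mulr1.
    by rewrite -[RHS]invr1 -(I_exp ltr01); apply: I_ext => z; rewrite /wt mulN1r.
  apply: I_norm_le; last by apply: JZ; exact: J_wt.
    by apply: mfM; [exact: mf_tr|apply: (mf_comp mg); mf_tac].
  by move=> z; rewrite normrM mulrAC ler_pM ?(dec_bnd _ dg)//; exact: dr.2.
have bsg x : `|star (tr r) g x| <= P * P / 2 * N by exact: star_bnd dr mg (fun y => dec_bnd y dg).
have msg : mf (star (tr r) g) by apply: mf_star => //; exact: mf_tr.
transitivity (I (fun x => f x * star (tr r) g x + f x * I (fun z => tr r z * g (x - z)))).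
  by apply: I_ext => x; rewrite inner mulrDr.
rewrite ID; [|exact: J_ip df msg bsg|exact: J_ip df mrg brg]; congr (_ + _).
rewrite -star0 -(star_comm 0 dr dg mf0 (fun y => dec_bnd y df)).
transitivity (I (fun x => I (fun z => f x * (tr r z * g (x - z))))).
  apply: I_ext => x; rewrite IZ//.
  apply: (@J_dom _ _ (fun z => P * P / 2 * wt z * N)).
  - by apply: mfM; [exact: mf_tr|apply: (mf_comp mg); mf_tac].
  - by move=> z; rewrite normrM ler_pM ?(dec_bnd _ dg)//; exact: dr.2.
  - by apply: JZr; apply: JZ; exact: J_wt.
rewrite (@fubini_prod _ (fun x z => f x * (tr r z * g (x - z))) (fun x => M * wt x) (fun z => P * P / 2 * wt z * N)).
- apply: I_ext => z; rewrite addr0 -(star_opp z dg mf0 (fun y => dec_bnd y df)) /star -IZ; last exact: J_star df mg (fun y => dec_bnd y dg).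
  by apply: I_ext => x; ring.
- by apply: mfM; [apply: (mf_comp mf0)|apply: mfM; [apply: (mf_comp (mf_tr mr))|apply: (mf_comp mg)]]; mf_tac.
- by apply: JZ; exact: J_wt.
- by apply: JZr; apply: JZ; exact: J_wt.
- move=> x z; rewrite normrM; apply: ler_pM => //.
  by rewrite normrM; apply: ler_pM; rewrite ?(dec_bnd _ dg)//; exact: dr.2.
Qed.

End Weighted.

(** * Laplace and Fourier integrals of exponentials *)

Section HalfLineTransform.
Context {R : realType}.
Local Notation C := R[i].

Lemma Re_realM (k : R) (z : C) : complex.Re (k%:C * z) = k * complex.Re z.
Proof. by case: z => a b /=; rewrite mul0r subr0. Qed.

Lemma Im_realM (k : R) (z : C) : complex.Im (k%:C * z) = k * complex.Im z.
Proof. by case: z => a b /=; rewrite mul0r addr0. Qed.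
Local Notation mu := (@lebesgue_measure R).

Lemma Re_cexp (z : C) : complex.Re (cexp z) = expR (complex.Re z) * cos (complex.Im z).
Proof. by rewrite /cexp Re_realM. Qed.

Lemma cexp_im (b : R) : cexp (b%:C * 'i) = cos b +i* sin b.
Proof.
have -> : b%:C * 'i = 0 +i* b by apply/eqP; rewrite eq_complex /= !(mul0r, mulr0, mulr1, subr0, addr0) !eqxx.
by rewrite /cexp /= expR0 mul1r.
Qed.

Lemma I_dct (f_ : nat -> R -> R) (f g : R -> R) : (forall n, mf (f_ n)) -> mf f -> J g ->
  (forall n x, `|f_ n x| <= g x) -> (forall x, f_ n x @[n --> \oo] --> f x) ->
  I (f_ n) @[n --> \oo] --> I f.
Proof.
move=> mf_ mf0 Jg fg fcv.
have gf x : `|f x| <= g x.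
  rewrite -(cvg_lim (@Rhausdorff R) (cvg_norm (fcv x))).
  by apply: limr_le; [apply/cvg_ex; exists `|f x|; exact: (cvg_norm (fcv x))|exact: nearW].
have Jf : J f := J_dom mf0 gf Jg.
have [|||||_ _ dct] := @dominated_convergence _ _ _ mu setT measurableT (fun n x => (f_ n x)%:E)
  (fun x => (f x)%:E) (fun x => (g x)%:E).
- by move=> n; apply/measurable_EFinP; exact: mf_.
- by apply/measurable_EFinP; exact: mf0.
- by apply: aeW => x _; apply: cvg_EFin; [exact: nearW|exact: fcv].
- exact: Jg.
- by apply: aeW => x n _; rewrite lee_fin.
by apply: fine_cvg; rewrite -(EI Jf) in dct *; exact: dct.
Qed.

Lemma ae_imp (P Q : R -> Prop) : (forall x, P x -> Q x) ->
  (\forall x \ae mu, P x) -> \forall x \ae mu, Q x.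
Proof. by move=> PQ; apply: (@filterS _ _ (ae_filter_ringOfSetsType mu)). Qed.

Lemma I_ae (f g : R -> R) : mf f -> mf g -> (\forall x \ae mu, f x = g x) -> I f = I g.
Proof.
move=> m1 m2 fg; rewrite /I /Rintegral; congr fine.
apply: ae_eq_integral => //; [exact/measurable_EFinP|exact/measurable_EFinP|].
by apply: ae_imp fg => x /= -> _.
Qed.

Lemma J_ae (f g : R -> R) : mf f -> J g -> (\forall x \ae mu, f x = g x) -> J f.
Proof.
move=> m1 Jg fg; have m2 := J_mf Jg; apply/integrableP; split; first exact/measurable_EFinP.
have /integrableP[_] := Jg; congr (_ < _)%E.
apply: ae_eq_integral => //.
- by apply: measurableT_comp => //; exact/measurable_EFinP.
- by apply: measurableT_comp => //; exact/measurable_EFinP.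
- by apply: ae_imp fg => x /= -> _.
Qed.

Lemma expR_le_inv (x : R) : 0 <= x -> expR (- x) <= (1 + x)^-1.
Proof.
move=> x0; rewrite expRN lef_pV2 ?posrE ?expR_gt0 ?expR_ge1Dx//.
by rewrite ltr_pwDl.
Qed.

Lemma cvg_expRN (a : R) : 0 < a -> expR (- a * n.+1%:R) @[n --> \oo] --> (0 : R).
Proof.
move=> a0; apply: (@squeeze_cvgr _ _ _ _ (fun=> 0) (fun n => a^-1 * (n.+1%:R : R)^-1)).
- near=> n; rewrite expR_ge0/= mulNr; apply: le_trans (expR_le_inv _) _.
    by rewrite mulr_ge0// ltW.
  rewrite -invfM lef_pV2 ?posrE ?mulr_gt0 ?ltr_pwDl ?mulr_ge0// ?(ltW a0)//.
  by rewrite lerDr.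
- exact: cvg_cst.
- rewrite -[X in _ --> X](mulr0 a^-1); apply: cvgMr.
  exact: cvg_harmonic.
Unshelve. all: by end_near. Qed.

Lemma CI_exp (z : C) : 0 < complex.Re z ->
  CJ (fun y => (pos y)%:C * cexp (- z * y%:C)) /\ CI (fun y => (pos y)%:C * cexp (- z * y%:C)) = z^-1.
Proof.
move=> z0; have zn0 : z != 0 by apply: contraTneq z0 => ->; rewrite ltxx.
have me : Cmf (fun y : R => cexp (- z * y%:C)).
  by apply: Cmf_exp; apply: CmfM; [exact: Cmf_cst|exact: Cmf_real mf_id].
have cne y : cn (cexp (- z * y%:C)) = expR (- complex.Re z * y).
  by rewrite cn_cexp; congr expR; case: (z) => a b /=; rewrite mulr0 subr0.
have Je : CJ (fun y => (pos y)%:C * cexp (- z * y%:C)).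
  apply: (@CJ_dom _ _ (fun y => pos y * expR (- complex.Re z * y))); last exact: J_exp.
    by apply: CmfM => //; exact: Cmf_real (mf_pos mf_id).
  by move=> y; rewrite cnM cne cn_real ger0_norm ?pos_ge0.
split=> //.
pose F y : C := - z^-1 * cexp (- z * y%:C).
have dF y : cderiv F y (cexp (- z * y%:C)).
  have := cderivZ (- z^-1) (cderiv_cexp (cderiv_affine 0 (- z) y)).
  rewrite add0r mulrCA mulrNN mulVf// mulr1.
  by under eq_fun do rewrite add0r.
have [c1 c2] : continuous (fun y : R => complex.Re (cexp (- z * y%:C))) /\
               continuous (fun y : R => complex.Im (cexp (- z * y%:C))).
  apply: cderiv_continuous => x; have := cderiv_cexp (cderiv_affine 0 (- z) x).
  by under eq_fun do rewrite add0r; move=> H; eexists; exact: H.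
have cv0 (u : nat -> R) : (forall n, `|u n| <= cn (F n.+1%:R)) -> u n @[n --> \oo] --> (0 : R).
  move=> uF; apply/norm_cvg0P.
  apply: (@squeeze_cvgr _ _ _ _ (fun=> 0) (fun n => cn z^-1 * expR (- complex.Re z * n.+1%:R))).
  - by apply: nearW => n; rewrite normr_ge0 /= (le_trans (uF n))// /F cnM cnN cne.
  - exact: cvg_cst.
  - by rewrite -[X in _ --> X](mulr0 (cn z^-1)); apply: cvgMr; exact: cvg_expRN.
rewrite CIE.
have [j1 j2] := Je.
have ReE y : complex.Re ((pos y)%:C * cexp (- z * y%:C)) = pos y * complex.Re (cexp (- z * y%:C)).
  by case: (cexp _) => p q /=; rewrite mul0r subr0.
have ImE y : complex.Im ((pos y)%:C * cexp (- z * y%:C)) = pos y * complex.Im (cexp (- z * y%:C)).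
  by case: (cexp _) => p q /=; rewrite mul0r addr0.
rewrite (I_ext ReE) (I_ext ImE).
rewrite (@FTC_halfline _ (fun y => complex.Re (F y)) _ 0 (fun y => (dF y).1) c1); first last.
- by apply: cv0 => n; exact: Re_le_cn.
- by apply: J_ext j1; exact: ReE.
rewrite (@FTC_halfline _ (fun y => complex.Im (F y)) _ 0 (fun y => (dF y).2) c2); first last.
- by apply: cv0 => n; exact: Im_le_cn.
- by apply: J_ext j2; exact: ImE.
by rewrite /F mulr0 cexp0 mulr1 !sub0r; case: (z^-1) => p q /=; rewrite !opprK.
Qed.

Lemma J_exp_abs (eta : R) : 0 < eta -> J (fun y : R => expR (- eta * `|y|)).
Proof.
move=> eta0.
(* The last summand covers the point 0, where both [pos] factors vanish. *)
apply: (@J_dom _ _ (fun y => pos y * expR (- eta * y) + pos (- y) * expR (- eta * - y) + (1 + y ^+ 2)^-1)).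
- by apply: mf_exp; apply: mfM; [exact: mf_cst|exact: (mf_norm mf_id)].
- move=> y; rewrite ger0_norm ?expR_ge0//; case: (ltrgtP 0 y) => y0.
  + rewrite ger0_norm ?(ltW y0)// (pos1 y0) mul1r -addrA lerDl.
    by rewrite addr_ge0 ?invr_ge0 ?addr_ge0 ?sqr_ge0// mulr_ge0 ?pos_ge0 ?expR_ge0.
  + have y1 : 0 < - y by rewrite oppr_gt0.
    rewrite ltr0_norm// (pos1 y1) mul1r [leRHS]addrAC lerDr.
    by rewrite addr_ge0 ?invr_ge0 ?addr_ge0 ?sqr_ge0// mulr_ge0 ?pos_ge0 ?expR_ge0.
  + rewrite -y0 normr0 mulr0 expR0 expr0n addr0 invr1 lerDr.
    by rewrite addr_ge0// mulr_ge0 ?pos_ge0 ?expR_ge0.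
- apply: JD; last exact: J_cauchy.
  by apply: JD; [exact: J_exp|apply: J_opp (J_exp eta0)].
Qed.

(* The Fourier transform of [e^{-eta |y|}], the regularising factor below, is a
   Poisson kernel. *)
Lemma CI_poisson (eta l : R) : 0 < eta ->
  CI (fun y => (expR (- eta * `|y|))%:C * cexp ((l * y)%:C * 'i)) = (2 * eta / (eta ^+ 2 + l ^+ 2))%:C.
Proof.
move=> eta0; pose g y : C := (expR (- eta * `|y|))%:C * cexp ((l * y)%:C * 'i).
have mg : Cmf g.
  apply: CmfM; first by apply: Cmf_real; apply: mf_exp; apply: mfM; [exact: mf_cst|exact: (mf_norm mf_id)].
  by apply: Cmf_exp; apply: CmfM; [apply: Cmf_real; apply: mfM; [exact: mf_cst|exact: mf_id]|exact: Cmf_cst].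
have Jg : CJ g.
  apply: (@CJ_dom _ _ (fun y => expR (- eta * `|y|))) => //; last exact: J_exp_abs.
  move=> y; rewrite /g cnM cn_real cn_cexp ger0_norm ?expR_ge0//.
  have -> : complex.Re ((l * y)%:C * 'i) = 0 by rewrite /= mulr0 mul0r subr0.
  by rewrite expR0 mulr1.
have e1 y : complex.Re (g y) = expR (- eta * `|y|) * cos (l * y).
  by rewrite /g Re_realM; rewrite cexp_im.
have e2 y : complex.Im (g y) = expR (- eta * `|y|) * sin (l * y).
  by rewrite /g Im_realM; rewrite cexp_im.
rewrite CIE (I_odd Jg.2); last by move=> y; rewrite !e2 normrN mulrN sinN mulrN.
rewrite (I_even Jg.1); last by move=> y; rewrite !e1 normrN mulrN cosN.
have -> : I (fun y => pos y * complex.Re (g y)) =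
          complex.Re (CI (fun y => (pos y)%:C * cexp (- (eta -i* l) * y%:C))).
  apply: I_ext => y; rewrite e1 Re_realM Re_cexp; case: (ltP 0 y) => y0; last by rewrite (pos0 y0) !mul0r.
  rewrite (ger0_norm (ltW y0)); congr (_ * (expR _ * cos _)).
    by rewrite /= mulr0 subr0.
  by rewrite /= mulr0 add0r opprK.
have [_ ->] := CI_exp (z := eta -i* l) eta0.
have -> : (eta -i* l)^-1 = (eta / (eta ^+ 2 + l ^+ 2)) +i* (l / (eta ^+ 2 + l ^+ 2)).
  by rewrite /GRing.inv /= sqrrN mulNr opprK.
by rewrite /= mulrA.
Qed.

End HalfLineTransform.

(** * Exponential bounds for the Airy functions *)

Section AiryEstimates.
Context {R : realType}.
Local Notation C := R[i].

Section Line.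
Variables (s c : R).
Hypotheses (c_gt0 : 0 < c) (sc : - s < c).

Let cs : 0 < c + s. Proof. by have := sc; lra. Qed.

Lemma J_gauss (k : R) : 0 < k -> J (fun y : R => expR (- k * y ^+ 2)).
Proof.
move=> k0; have [M M0 HM] := gauss_dom 0 k0.
apply: (@J_dom _ _ (fun y => M * (1 + y ^+ 2)^-1)); [by mf_tac| |by apply: JZ; exact: J_cauchy].
by move=> y; rewrite ger0_norm ?expR_ge0//; apply: le_trans (HM y); rewrite mul0r sub0r mulNr.
Qed.

Lemma Cmf_airy_line : Cmf (fun z : R * R => airy_integrand s z.1 (c +i* z.2)).
Proof. by rewrite /airy_integrand; Cmf_tac. Qed.

Lemma CJ_airy_line x : CJ (fun y => airy_integrand s x (c +i* y)).
Proof.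
apply: (@CJ_dom _ _ (fun y => expR (c ^+ 3 / 3 + s * c ^+ 2 - x * c) * expR (- (c + s) * y ^+ 2))).
- exact: (Cmf_section1 x (F := fun x y => airy_integrand s x (c +i* y)) Cmf_airy_line).
- by move=> y; rewrite cn_airy_line.
- by apply: JZ; exact: J_gauss.
Qed.

Lemma airys_line x : airys s x = (2 * pi)^-1 * I (fun y => complex.Re (airy_integrand s x (c +i* y))).
Proof.
by have /(congr1 (@complex.Re R)) := airy_line x c_gt0 sc; rewrite Re_realM.
Qed.

Definition airy_cst : R :=
  (2 * pi)^-1 * expR (c ^+ 3 / 3 + s * c ^+ 2) * I (fun y => expR (- (c + s) * y ^+ 2)).

Lemma airys_le x : `|airys s x| <= airy_cst * expR (- c * x).
Proof.
have Jg := J_gauss cs.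
rewrite airys_line normrM ger0_norm ?invr_ge0 ?mulr_ge0 ?pi_ge0// /airy_cst.
have -> (a e i f : R) : a * e * i * f = a * (e * f * i) by ring.
rewrite ler_wpM2l ?invr_ge0 ?mulr_ge0 ?pi_ge0// -expRD.
apply: le_trans (I_norm_le (g := fun y => expR (c ^+ 3 / 3 + s * c ^+ 2 - x * c) * expR (- (c + s) * y ^+ 2)) _ _ _) _.
- exact: J_mf (CJ_airy_line x).1.
- by move=> y; rewrite -cn_airy_line; exact: Re_le_cn.
- exact: JZ.
by rewrite IZ// [x * c]mulrC mulNr.
Qed.

End Line.

Lemma mf_airys s : mf (@airys R s).
Proof.
have h1 : 0 < `|s| + 1 by rewrite ltr_wpDl.
have h2 : - s < `|s| + 1 by rewrite (le_lt_trans (ler_norm _))// normrN ltrDl.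
have -> : airys s = fun x => (2 * pi)^-1 * I (fun y => complex.Re (airy_integrand s x ((`|s| + 1) +i* y))).
  by apply/funext => x; exact: airys_line.
apply: mfM; first exact: mf_cst.
exact: (Cmf_CI (F := fun x y => airy_integrand s x ((`|s| + 1) +i* y)) (Cmf_airy_line _ _)).1.
Qed.

(** The line through 1 gives [(2 pi)^-1 e^(1/3)] times the integral of [e^(-y^2)], which is
    estimated by that of [1 / (1 + y^2)], namely [pi]. A value below 2 makes the Hankel operator a
    contraction. *)
Definition airy_bound : R := expR (1 / 3) / 2.

Lemma airy_bound_lt2 : airy_bound < 2.
Proof.
rewrite /airy_bound ltr_pdivrMr//.
have h : (2 / 3 : R) <= expR (- (1 / 3)) by apply: le_trans (expR_ge1Dx _); lra.
have p0 := expR_gt0 (1 / 3 : R).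
have e1 : expR (1 / 3 : R) * expR (- (1 / 3)) = 1 by rewrite -expRD subrr expR0.
nra.
Qed.

Lemma airy_le x : `|@airy R x| <= airy_bound * expR (- x).
Proof.
have h : - (0 : R) < 1 by rewrite oppr0.
have := airys_le ltr01 h x; rewrite mulN1r; move/le_trans; apply.
rewrite ler_wpM2r ?expR_ge0// /airy_cst expr1n mul0r addr0 /airy_bound.
have -> : expR (1 / 3 : R) / 2 = (2 * pi)^-1 * expR (1 / 3) * pi.
  have p0 : pi != 0 :> R by rewrite gt_eqF ?pi_gt0.
  by move: (expR _) p0 => e; move: pi => p p0; field.
have c0 : 0 <= (2 * pi)^-1 * expR (1 / 3 : R) by rewrite mulr_ge0 ?expR_ge0// invr_ge0 mulr_ge0 ?pi_ge0.
rewrite ler_wpM2l// -I_cauchy; apply: I_le.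
- by apply: J_gauss; rewrite addr0.
- exact: J_cauchy.
- by move=> y; rewrite addr0 mulN1r; exact: expR_le_inv (sqr_ge0 _).
Qed.

End AiryEstimates.

Opaque cexp.

(** * Parseval's identity and Airy convolutions *)

Section Parseval.
Context {R : realType}.
Local Notation C := R[i].

Definition ccvg (u : nat -> C) (l : C) :=
  complex.Re (u n) @[n --> \oo] --> complex.Re l /\ complex.Im (u n) @[n --> \oo] --> complex.Im l.

Lemma ccvg_unique u l l' : ccvg u l -> ccvg u l' -> l = l'.
Proof.
case: l => a b; case: l' => c d [/= h1 h2] [/= h3 h4].
have /= -> := cvg_unique (@Rhausdorff R) h1 h3.
by have /= -> := cvg_unique (@Rhausdorff R) h2 h4.
Qed.

Lemma ccvgM u v l l' : ccvg u l -> ccvg v l' -> ccvg (fun n => u n * v n) (l * l').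
Proof.
move=> [h1 h2] [h3 h4]; split.
  have -> : (fun n => complex.Re (u n * v n)) = fun n => complex.Re (u n) * complex.Re (v n) - complex.Im (u n) * complex.Im (v n).
    by apply/funext => n; case: (u n) => ? ?; case: (v n).
  have -> : complex.Re (l * l') = complex.Re l * complex.Re l' - complex.Im l * complex.Im l'.
    by case: (l) => ? ?; case: (l').
  by apply: cvgB; apply: cvgM.
have -> : (fun n => complex.Im (u n * v n)) = fun n => complex.Re (u n) * complex.Im (v n) + complex.Im (u n) * complex.Re (v n).
  by apply/funext => n; case: (u n) => ? ?; case: (v n).
have -> : complex.Im (l * l') = complex.Re l * complex.Im l' + complex.Im l * complex.Re l'.
  by case: (l) => ? ?; case: (l').
by apply: cvgD; apply: cvgM.
Qed.

Lemma ccvg_cst z : ccvg (fun=> z) z.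
Proof. by split; exact: cvg_cst. Qed.

Lemma ccvg_real (u : nat -> R) (l : R) : u n @[n --> \oo] --> l -> ccvg (fun n => (u n)%:C) l%:C.
Proof. by move=> h; split => //=; exact: cvg_cst. Qed.

Lemma CI_dct (f_ : nat -> R -> C) (f : R -> C) (g : R -> R) : (forall n, Cmf (f_ n)) -> Cmf f -> J g ->
  (forall n x, cn (f_ n x) <= g x) -> (forall x, ccvg (fun n => f_ n x) (f x)) ->
  ccvg (fun n => CI (f_ n)) (CI f).
Proof.
move=> mf_ [m1 m2] Jg fg fc; split; apply: I_dct Jg _ _ => //.
- by move=> n; exact: (mf_ n).1.
- by move=> n x; exact: le_trans (Re_le_cn _) (fg n x).
- by move=> x; exact: (fc x).1.
- by move=> n; exact: (mf_ n).2.
- by move=> n x; exact: le_trans (Im_le_cn _) (fg n x).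
- by move=> x; exact: (fc x).2.
Qed.

Local Notation e a := (cexp (a%:C * 'i)).

Lemma cn_e (a : R) : cn (e a) = 1.
Proof. by rewrite cn_cexp /= mulr0 mul0r subr0 expR0. Qed.

Lemma cn_eM (a : R) z : cn (e a * z) = cn z.
Proof. by rewrite cnM cn_e mul1r. Qed.

Lemma cn_Me (a : R) z : cn (z * e a) = cn z.
Proof. by rewrite cnM cn_e mulr1. Qed.

Lemma e_add (a b : R) : e a * e b = e (a + b).
Proof. by rewrite -cexpD -mulrDl -rmorphD. Qed.

Variables (F1 F2 : R -> C) (N1 N2 : R -> R) (K : R).
Hypotheses (m1 : Cmf F1) (m2 : Cmf F2) (J1 : J N1) (J2 : J N2).
Hypotheses (b1 : forall t, cn (F1 t) <= N1 t) (b2 : forall t, cn (F2 t) <= N2 t) (bK : forall t, N2 t <= K).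
Hypothesis c2 : forall (u : nat -> R) t, u n @[n --> \oo] --> (0 : R) -> ccvg (fun n => F2 (u n + t)) (F2 t).

Definition fourier (F : R -> C) (y : R) : C := CI (fun t => F t * e (t * y)).

(** The reflection in [H1] makes the integral of [H1 * H2] correspond to that of [F1 * F2], without
    a complex conjugate. *)
Let H1 y := fourier F1 (- y).
Let H2 y := fourier F2 y.
Let h l := CI (fun t => F1 t * F2 (l + t)).

Let K0 : 0 <= K.
Proof. exact: le_trans (le_trans (cn_ge0 _) (b2 0)) (bK 0). Qed.
Let N10 t : 0 <= N1 t. Proof. exact: le_trans (cn_ge0 _) (b1 t). Qed.
Let N20 t : 0 <= N2 t. Proof. exact: le_trans (cn_ge0 _) (b2 t). Qed.

Lemma Cmf_fourier (F : R -> C) : Cmf F -> Cmf (fourier F).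
Proof.
move=> mF; apply: (Cmf_CI (F := fun y t => F t * e (t * y))).
apply: CmfM; first by apply: (Cmf_comp mF); mf_tac.
by apply: Cmf_exp; apply: CmfM; [apply: Cmf_real; mf_tac|exact: Cmf_cst].
Qed.

Let CJF1 y : CJ (fun t => F1 t * e (t * y)).
Proof.
apply: CJ_dom J1; last by move=> t; rewrite cnM cn_e mulr1.
apply: CmfM => //.
by apply: Cmf_exp; apply: CmfM; [apply: Cmf_real; mf_tac|exact: Cmf_cst].
Qed.

Let CJF2 y : CJ (fun t => F2 t * e (t * y)).
Proof.
apply: CJ_dom J2; last by move=> t; rewrite cnM cn_e mulr1.
apply: CmfM => //.
by apply: Cmf_exp; apply: CmfM; [apply: Cmf_real; mf_tac|exact: Cmf_cst].
Qed.

Let H2b y : cn (H2 y) <= 2 * I N2.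
Proof.
apply: cn_CI_le J2; last by move=> t; rewrite cnM cn_e mulr1.
apply: CmfM => //.
by apply: Cmf_exp; apply: CmfM; [apply: Cmf_real; mf_tac|exact: Cmf_cst].
Qed.

Let hb l : cn (h l) <= 2 * I (fun t => N1 t * K).
Proof.
apply: cn_CI_le.
- by apply: CmfM => //; apply: (Cmf_comp m2); mf_tac.
- by move=> t; rewrite cnM ler_pM ?cn_ge0// (le_trans (b2 _)).
- exact: JZr.
Qed.

Let mh : Cmf h.
Proof.
apply: (Cmf_CI (F := fun l t => F1 t * F2 (l + t))).
by apply: CmfM; [apply: (Cmf_comp m1)|apply: (Cmf_comp m2)]; mf_tac.
Qed.

Section Regularised.
Variable eta : R.
Hypothesis eta0 : 0 < eta.
Let E (y : R) : R := expR (- eta * `|y|).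
Let kap (l : R) : R := 2 * eta / (eta ^+ 2 + l ^+ 2).

Let mE : mf E. Proof. by apply: mf_exp; apply: mfM; [exact: mf_cst|exact: (mf_norm mf_id)]. Qed.
Let JE : J E. Proof. exact: J_exp_abs. Qed.
Let E0 y : 0 <= E y. Proof. exact: expR_ge0. Qed.
Let cnE y : cn (E y)%:C = E y. Proof. by rewrite cn_real ger0_norm. Qed.

Let kap0 l : 0 <= kap l.
Proof. by rewrite /kap divr_ge0 ?mulr_ge0 ?addr_ge0 ?sqr_ge0// ltW. Qed.

Let kapE x : kap (eta * x) = eta^-1 * (2 * (1 + x ^+ 2)^-1).
Proof.
have e0 : eta != 0 by rewrite gt_eqF.
have -> : kap (eta * x) = 2 * eta / (eta * (eta * (1 + x ^+ 2))) by rewrite /kap; congr (_ / _); ring.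
by rewrite !invfM; move: (1 + x ^+ 2)^-1 => v; field.
Qed.

Let Jkap : J kap.
Proof.
have i0 : 0 < eta^-1 by rewrite invr_gt0.
have := J_scale i0 (JZ (eta^-1 * 2) J_cauchy); apply: J_ext => l.
by rewrite -[in RHS](mulVKf (lt0r_neq0 eta0) l) kapE mulrA.
Qed.

(** Integrating over [y] first turns the regularised exponentials into the Poisson kernel centred at
    [t]. *)
Let inner t : CI (fun y => (E y)%:C * (e (- t * y) * H2 y)) = CI (fun l => F2 (l + t) * (kap l)%:C).
Proof.
transitivity (CI (fun y => CI (fun r => (E y)%:C * (e (- t * y) * (F2 r * e (r * y)))))).
  by apply: CI_ext => y; rewrite CIZ ?CIZ//; apply: CJZ.
rewrite (@Cfubini_prod _ (fun y r => (E y)%:C * (e (- t * y) * (F2 r * e (r * y)))) E N2)//; first last.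
- by move=> y r; rewrite cnM cnE cn_eM cn_Me ler_wpM2l.
- apply: CmfM; first by apply: Cmf_real; apply: (mf_comp mE); mf_tac.
  apply: CmfM; first by apply: Cmf_exp; apply: CmfM; [apply: Cmf_real; mf_tac|exact: Cmf_cst].
  apply: CmfM; first by apply: (Cmf_comp m2); mf_tac.
  by apply: Cmf_exp; apply: CmfM; [apply: Cmf_real; mf_tac|exact: Cmf_cst].
transitivity (CI (fun r => F2 r * (kap (r - t))%:C)).
  apply: CI_ext => r; rewrite /kap -CI_poisson// -CIZ.
    by apply: CI_ext => y; rewrite mulrDl -e_add; rewrite /E; ring.
  apply: CJ_dom JE; last by move=> y; rewrite cnM cn_e cnE mulr1.
  apply: CmfM; first exact: Cmf_real.
  by apply: Cmf_exp; apply: CmfM; [apply: Cmf_real; apply: mfM; [exact: mf_cst|exact: mf_id]|exact: Cmf_cst].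
rewrite -[LHS](CI_shift t).
  by apply: CI_ext => l; rewrite addrK.
apply: (@CJ_dom _ _ (fun r => K * kap (r - t))).
- apply: CmfM => //; apply: Cmf_real; apply: (mf_comp (J_mf Jkap)); mf_tac.
- move=> r; rewrite cnM cn_real ger0_norm// ler_wpM2r// (le_trans (b2 _))//.
- by apply: JZ; exact: (J_shift (- t) Jkap).
Qed.

(* As [eta] tends to 0 the left-hand side tends to the integral of [H1 * H2], and the
   right-hand side to [2 pi * h 0]. *)
Lemma parseval_regularised :
  CI (fun y => (E y)%:C * (H1 y * H2 y)) = CI (fun x => (2 * (1 + x ^+ 2)^-1)%:C * h (eta * x)).
Proof.
have mH2 : Cmf H2 by exact: Cmf_fourier.
transitivity (CI (fun y => CI (fun t => (E y)%:C * (F1 t * e (t * - y) * H2 y)))).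
  by apply: CI_ext => y; rewrite CIZ ?CIZr//; apply: CJZr.
rewrite (@Cfubini_prod _ (fun y t => (E y)%:C * (F1 t * e (t * - y) * H2 y)) (fun y => E y * (2 * I N2)) N1)//; first last.
- move=> y t; rewrite cnM cnE -[leRHS]mulrA ler_wpM2l// [leRHS]mulrC cnM cn_Me.
  by rewrite ler_pM ?cn_ge0.
- exact: JZr.
- apply: CmfM; first by apply: Cmf_real; apply: (mf_comp mE); mf_tac.
  apply: CmfM; last by apply: (Cmf_comp mH2); mf_tac.
  apply: CmfM; first by apply: (Cmf_comp m1); mf_tac.
  by apply: Cmf_exp; apply: CmfM; [apply: Cmf_real; mf_tac|exact: Cmf_cst].
have Jl t : CJ (fun l => F2 (l + t) * (kap l)%:C).
  apply: (@CJ_dom _ _ (fun l => K * kap l)).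
  - by apply: CmfM; [apply: (Cmf_comp m2); mf_tac|apply: Cmf_real; exact: J_mf Jkap].
  - by move=> r; rewrite cnM cn_real ger0_norm// ler_wpM2r// (le_trans (b2 _)).
  - exact: JZ.
transitivity (CI (fun t => CI (fun l => F1 t * (F2 (l + t) * (kap l)%:C)))).
  apply: CI_ext => t; rewrite CIZ// -inner -CIZ.
    by apply: CI_ext => y; rewrite mulrN -mulNr; ring.
  apply: (@CJ_dom _ _ (fun y => E y * (2 * I N2))).
  - apply: CmfM; first exact: Cmf_real.
    apply: CmfM => //; apply: Cmf_exp; apply: CmfM; last exact: Cmf_cst.
    by apply: Cmf_real; apply: mfM; [exact: mf_cst|exact: mf_id].
  - by move=> y; rewrite cnM cnE cn_eM ler_wpM2l.
  - exact: JZr.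
rewrite (@Cfubini_prod _ (fun t l => F1 t * (F2 (l + t) * (kap l)%:C)) N1 (fun l => K * kap l))//; first last.
- move=> t l; rewrite !cnM ler_pM ?mulr_ge0 ?cn_ge0// cn_real ger0_norm// ler_wpM2r//.
  exact: le_trans (b2 _) _.
- exact: JZ.
- apply: CmfM; first by apply: (Cmf_comp m1); mf_tac.
  apply: CmfM; first by apply: (Cmf_comp m2); mf_tac.
  by apply: Cmf_real; apply: (mf_comp (J_mf Jkap)); mf_tac.
have JF l : CJ (fun t => F1 t * F2 (l + t)).
  apply: (@CJ_dom _ _ (fun t => N1 t * K)).
  - by apply: CmfM => //; apply: (Cmf_comp m2); mf_tac.
  - by move=> t; rewrite cnM ler_pM ?cn_ge0// (le_trans (b2 _)).
  - exact: JZr.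
transitivity (CI (fun l => (kap l)%:C * h l)).
  apply: CI_ext => l; rewrite -CIZ//.
  by apply: CI_ext => t; ring.
have Jkh : CJ (fun l => (kap l)%:C * h l).
  apply: (@CJ_dom _ _ (fun l => kap l * (2 * I (fun t => N1 t * K)))).
  - by apply: CmfM => //; apply: Cmf_real; exact: J_mf Jkap.
  - by move=> l; rewrite cnM cn_real ger0_norm// ler_wpM2l.
  - exact: JZr.
have e0 : eta != 0 by rewrite gt_eqF.
have -> : CI (fun l => (kap l)%:C * h l) = eta%:C * CI (fun x => (kap (eta * x))%:C * h (eta * x)).
  by rewrite (CI_scale eta0 Jkh) mulrA -rmorphM (mulfV e0) mul1r.
rewrite -CIZ; last first.
  split; [exact: J_scale eta0 Jkh.1|exact: J_scale eta0 Jkh.2].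
by apply: CI_ext => x; rewrite kapE mulrA -rmorphM (mulrA eta) (mulfV e0) mul1r.
Qed.

End Regularised.

(** Dominated convergence along [eta = 1 / (n + 1)]: on the left the integrability of [H1 * H2]
    provides the dominant, on the right [h (eta x)] tends to [h 0] by the continuity of [F2]. The
    constant [2 pi] is the integral of [2 / (1 + x^2)]. *)
Lemma parseval : CJ (fun y => H1 y * H2 y) ->
  CI (fun y => H1 y * H2 y) = (2 * pi)%:C * CI (fun t => F1 t * F2 t).
Proof.
move=> JH; pose et n : R := n.+1%:R^-1.
have et0 n : 0 < et n by rewrite invr_gt0.
have cet : et n @[n --> \oo] --> (0 : R) by exact: cvg_harmonic.
have mH1 : Cmf H1 by apply: (Cmf_comp (Cmf_fourier m1)); mf_tac.
have mH2 : Cmf H2 := Cmf_fourier m2.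
have l1 : ccvg (fun n => CI (fun y => (expR (- et n * `|y|))%:C * (H1 y * H2 y))) (CI (fun y => H1 y * H2 y)).
  apply: (@CI_dct _ _ (fun y => `|complex.Re (H1 y * H2 y)| + `|complex.Im (H1 y * H2 y)|)).
  - move=> n; apply: CmfM; last exact: CmfM.
    by apply: Cmf_real; apply: mf_exp; apply: mfM; [exact: mf_cst|exact: (mf_norm mf_id)].
  - exact: CmfM.
  - by apply: JD; apply: J_norm; [exact: JH.1|exact: JH.2].
  - move=> n y; apply: le_trans (cn_le_ReIm _); rewrite cnM cn_real ger0_norm ?expR_ge0//.
    by rewrite ler_piMl ?cn_ge0// -expR0 ler_expR mulNr oppr_le0 mulr_ge0// ltW.
  - move=> y; rewrite -[X in ccvg _ X]mul1r; apply: ccvgM; last exact: ccvg_cst.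
    apply: ccvg_real; rewrite -[X in _ --> X]expR0; apply: cvg_comp; last exact: continuous_expR.
    by rewrite -(mul0r `|y|) -oppr0; apply: cvgMl; exact: cvgN.
have h0 : h 0 = CI (fun t => F1 t * F2 t) by apply: CI_ext => t; rewrite add0r.
have l2 : ccvg (fun n => CI (fun x => (2 * (1 + x ^+ 2)^-1)%:C * h (et n * x)))
               (CI (fun x => (2 * (1 + x ^+ 2)^-1)%:C * h 0)).
  have mc : mf (fun x : R => 2 * (1 + x ^+ 2)^-1) by exact: J_mf (JZ 2 J_cauchy).
  have c0 (x : R) : 0 <= 2 * (1 + x ^+ 2)^-1 by rewrite mulr_ge0// invr_ge0 addr_ge0 ?sqr_ge0.
  apply: (@CI_dct _ _ (fun x => 2 * (1 + x ^+ 2)^-1 * (2 * I (fun t => N1 t * K)))).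
  - move=> n; apply: CmfM; first exact: Cmf_real.
    by apply: (Cmf_comp mh); apply: mfM; [exact: mf_cst|exact: mf_id].
  - by apply: CmfM; [exact: Cmf_real|exact: Cmf_cst].
  - by apply: JZr; apply: JZ; exact: J_cauchy.
  - by move=> n x; rewrite cnM cn_real ger0_norm// ler_wpM2l.
  - move=> x; apply: ccvgM; first exact: ccvg_cst.
    rewrite h0; apply: (@CI_dct _ _ (fun t => N1 t * K)).
    + by move=> n; apply: CmfM => //; apply: (Cmf_comp m2); mf_tac.
    + exact: CmfM.
    + exact: JZr.
    + by move=> n t; rewrite cnM ler_pM ?cn_ge0// (le_trans (b2 _)).
    + move=> t; apply: ccvgM; first exact: ccvg_cst.
      by apply: c2; rewrite -[X in _ --> X](mul0r x); apply: cvgMl.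
have eqn : (fun n => CI (fun y => (expR (- et n * `|y|))%:C * (H1 y * H2 y))) =
    fun n => CI (fun x => (2 * (1 + x ^+ 2)^-1)%:C * h (et n * x)).
  by apply/funext => n; exact: parseval_regularised.
rewrite eqn in l1; rewrite (ccvg_unique l1 l2) CIZr; last by apply: CJ_real; apply: JZ; exact: J_cauchy.
by rewrite CI_real IZ ?I_cauchy ?h0//; exact: J_cauchy.
Qed.

End Parseval.

Section AiryConvolution.
Context {R : realType}.
Local Notation C := R[i].
Local Notation e a := (cexp (a%:C * 'i)).

Lemma airy_integrandD (s A y : R) z :
  airy_integrand s (A + y) z = airy_integrand s A z * cexp (- y%:C * z).
Proof. by rewrite /airy_integrand -cexpD; congr cexp; rewrite rmorphD; ring. Qed.

Lemma lineE (c t : R) : c +i* t = c%:C + 'i * t%:C.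
Proof. by apply/eqP; rewrite eq_complex /= !(mul0r, mulr0, mul1r, subr0, addr0, add0r) !eqxx. Qed.

Lemma cexp_line (c t y : R) : cexp (- y%:C * (c +i* t)) = (expR (- c * y))%:C * e (t * - y).
Proof.
by rewrite -cexp_real -cexpD; congr cexp; rewrite lineE rmorphM !rmorphN /=; rewrite rmorphM rmorphN /=; ring.
Qed.

Section Line.
Variables (s c : R).
Hypotheses (c_gt0 : 0 < c) (sc : - s < c).

Lemma airys_fourier A y : (airys s (A + y))%:C =
  ((2 * pi)^-1 * expR (- c * y))%:C * fourier (fun t => airy_integrand s A (c +i* t)) (- y).
Proof.
rewrite (airy_line (A + y) c_gt0 sc) rmorphM -mulrA; congr (_ * _).
rewrite /fourier -CIZ.
  by apply: CI_ext => t; rewrite airy_integrandD cexp_line mulrCA.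
apply: (@CJ_dom _ _ (fun t => cn (airy_integrand s A (c +i* t)))).
- apply: CmfM; first exact: (Cmf_section1 A (F := fun x y => airy_integrand s x (c +i* y)) (Cmf_airy_line s c)).
  by apply: Cmf_exp; apply: CmfM; [apply: Cmf_real; mf_tac|exact: Cmf_cst].
- by move=> t; rewrite cn_Me.
- apply: J_ext (JZ (expR (c ^+ 3 / 3 + s * c ^+ 2 - A * c)) (J_gauss _)).
    by move=> t; rewrite cn_airy_line.
  by have := sc; lra.
Qed.

Lemma airy_line_ccvg A (u : nat -> R) t : u n @[n --> \oo] --> (0 : R) ->
  ccvg (fun n => airy_integrand s A (c +i* (u n + t))) (airy_integrand s A (c +i* t)).
Proof.
move=> u0.
have d1 x : cderiv (fun y : R => c +i* y) x 'i.
  by have := cderiv_affine c%:C 'i x; under eq_fun do rewrite -lineE.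
have [h1 h2] : continuous (fun y : R => complex.Re (airy_integrand s A (c +i* y))) /\
               continuous (fun y : R => complex.Im (airy_integrand s A (c +i* y))).
  apply: cderiv_continuous => x; eexists.
  rewrite /airy_integrand; apply: cderiv_cexp.
  apply: cderivD; last first.
    have := cderivZ (- A%:C) (d1 x); under eq_fun do rewrite mulNr; exact.
  apply: cderivD; last by apply: cderivZ; apply: cderivM; exact: d1.
  have := cderivZ (3%:R^-1) (cderivM (d1 x) (cderivM (d1 x) (d1 x))).
  by under eq_fun do rewrite mulrC; exact.
have ut : u n + t @[n --> \oo] --> t.
  by rewrite -[X in _ --> X]add0r; apply: cvgD => //; exact: cvg_cst.
by split; [exact: (cvg_comp _ _ ut (h1 t))|exact: (cvg_comp _ _ ut (h2 t))].
Qed.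

End Line.

Lemma J_airys_product (s1 s2 A B : R) : J (fun y => airys s1 (A + y) * airys s2 (B - y)).
Proof.
pose d : R := `|s1| + `|s2| + 1.
have n1 := normr_ge0 s1; have n2 := normr_ge0 s2.
have l1 := ler_norm (- s1); have l2 := ler_norm (- s2); rewrite !normrN in l1 l2.
have d0 : 0 < d by rewrite /d; lra.
have d1 : 0 < d + 1 by lra.
have b1 : - s1 < d by rewrite /d; lra.
have b1' : - s1 < d + 1 by rewrite /d; lra.
have b2 : - s2 < d by rewrite /d; lra.
have b2' : - s2 < d + 1 by rewrite /d; lra.
(* For [y >= 0] the first factor is bounded at rate [d + 1] and the second at rate [d], which leaves
   [e^(-y)]; for [y < 0] the rates are exchanged. *)
pose K1 := airy_cst s1 (d + 1) * airy_cst s2 d * expR (- (d + 1) * A - d * B).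
pose K2 := airy_cst s1 d * airy_cst s2 (d + 1) * expR (- d * A - (d + 1) * B).
have pr (k1 k2 a b E x y : R) : `|x| <= k1 * expR a -> `|y| <= k2 * expR b -> a + b = E ->
    `|x * y| <= k1 * k2 * expR E.
  move=> h1 h2 <-; rewrite normrM expRD [leRHS]mulrACA; exact: ler_pM.
apply: (@J_dom _ _ (fun y : R => (`|K1| + `|K2|) * expR (- (1 : R) * `|y|))).
- by apply: mfM; [apply: (mf_comp (mf_airys s1))|apply: (mf_comp (mf_airys s2))]; mf_tac.
- move=> y; case: (lerP 0 y) => y0.
    apply: le_trans (pr _ _ _ _ (- (d + 1) * A - d * B + - y) _ _ (airys_le d1 b1' _) (airys_le d0 b2 _) _) _.
      by ring.
    rewrite (ger0_norm y0) mulN1r expRD mulrA -/K1 ler_wpM2r ?expR_ge0//.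
    by apply: le_trans (ler_norm _) _; rewrite lerDl.
  apply: le_trans (pr _ _ _ _ (- d * A - (d + 1) * B + y) _ _ (airys_le d0 b1 _) (airys_le d1 b2' _) _) _.
    by ring.
  rewrite (ltr0_norm y0) mulN1r opprK expRD mulrA -/K2 ler_wpM2r ?expR_ge0//.
  by apply: le_trans (ler_norm _) _; rewrite lerDr.
- by apply: JZ; exact: J_exp_abs.
Qed.

(** On a common vertical line the two exponents add up to [2 z^3 / 3 + (s1 + s2) z^2 - (A + B) z],
    and the substitution [k z] with [k^3 = 2] restores the normalised cubic. Parseval's identity
    brings the two contour integrals to one line. *)
Lemma airys_convolution (k s1 s2 A B : R) : 0 < k -> k ^+ 3 = 2 ->
  I (fun y => airys s1 (A + y) * airys s2 (B - y)) =
  k^-1 * airys (k^-1 ^+ 2 * (s1 + s2)) (k^-1 * (A + B)).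
Proof.
move=> k0 k3; pose d : R := `|s1| + `|s2| + 1.
have n1 := normr_ge0 s1; have n2 := normr_ge0 s2.
have l1 := ler_norm (- s1); have l2 := ler_norm (- s2); rewrite !normrN in l1 l2.
have d0 : 0 < d by rewrite /d; lra.
have b1 : - s1 < d by rewrite /d; lra.
have b2 : - s2 < d by rewrite /d; lra.
have dd : - (s1 + s2) < 2 * d by rewrite /d; lra.
pose F1 (t : R) := airy_integrand s1 A (d +i* t); pose F2 (t : R) := airy_integrand s2 B (d +i* t).
(* The arguments move in opposite directions, so the factors [e^(-d y)] and [e^(d y)] of the two
   Fourier representations cancel. *)
have PE (y : R) : (airys s1 (A + y) * airys s2 (B - y))%:C =
    ((2 * pi)^-1 ^+ 2)%:C * (fourier F1 (- y) * fourier F2 y).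
  have -> (a b : R) : (a * b)%:C = a%:C * b%:C :> C by exact: rmorphM.
  rewrite (airys_fourier d0 b1) (airys_fourier d0 b2) opprK mulrACA -rmorphM.
  congr (_%:C * _); rewrite mulrACA -expRD mulrN -mulNr opprK mulNr addNr expR0 mulr1 expr2.
  by [].
have p0 : pi != 0 :> R by rewrite gt_eqF ?pi_gt0.
have tp0 : (2 * pi)^-1 ^+ 2 != 0 :> R by rewrite expf_neq0// invr_neq0// mulf_neq0// pnatr_eq0.
have JP := CJ_real (J_airys_product s1 s2 A B).
have JF : CJ (fun y => fourier F1 (- y) * fourier F2 y).
  apply: CJ_ext (CJZ ((2 * pi)^-1 ^+ 2)%:C^-1 JP) => y.
  by rewrite PE mulKf// fmorph_eq0.
(* This is [dd] divided by [k^2], because [k^3 = 2]. *)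
have kd : - (k^-1 ^+ 2 * (s1 + s2)) < k * d.
  rewrite -mulrN mulrC -ltr_pdivlMr ?exprn_gt0 ?invr_gt0//.
  have -> : k * d = k ^+ 3 * d / k ^+ 2 by field; rewrite gt_eqF.
  by rewrite k3 exprVn invrK divfK ?expf_neq0 ?gt_eqF.
have E : CI (fun t => F1 t * F2 t) = (k^-1)%:C * ((2 * pi)%:C * (airys (k^-1 ^+ 2 * (s1 + s2)) (k^-1 * (A + B)))%:C).
  rewrite (airy_line _ (mulr_gt0 k0 d0) kd).
  rewrite (mulrA (2 * pi)%:C) -rmorphM mulfV ?mul1r; last by rewrite mulf_neq0// pnatr_eq0.
  rewrite -(CI_scale k0 (CJ_airy_line kd _)).
  apply: CI_ext => t; rewrite /F1 /F2 /airy_integrand -cexpD; congr cexp.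
  have -> : (k * d) +i* (k * t) = k%:C * (d +i* t).
    by apply/eqP; rewrite eq_complex /= !(mul0r, subr0, addr0) !eqxx.
  move: (d +i* t) => z.
  have -> : (k^-1 ^+ 2 * (s1 + s2))%:C = k%:C^-1 * k%:C^-1 * (s1%:C + s2%:C) :> C.
    by rewrite expr2 !rmorphM rmorphD fmorphV.
  have -> : (k^-1 * (A + B))%:C = k%:C^-1 * (A%:C + B%:C) :> C by rewrite rmorphM rmorphD fmorphV.
  have kc : k%:C ^+ 3 = 2 :> C by rewrite -rmorphXn k3 rmorph_nat.
  have kn : k%:C != 0 :> C by rewrite fmorph_eq0 gt_eqF.
  have -> : (k%:C * z) ^+ 3 = 2 * z ^+ 3 by rewrite exprMn kc.
  by field.
have q1 : 0 < d + s1 by rewrite /d; lra.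
have q2 : 0 < d + s2 by rewrite /d; lra.
pose K1 := expR (d ^+ 3 / 3 + s1 * d ^+ 2 - A * d); pose K2 := expR (d ^+ 3 / 3 + s2 * d ^+ 2 - B * d).
have := @parseval _ F1 F2 (fun t => K1 * expR (- (d + s1) * t ^+ 2)) (fun t => K2 * expR (- (d + s2) * t ^+ 2)) K2
  (Cmf_section1 A (F := fun x y => airy_integrand s1 x (d +i* y)) (Cmf_airy_line s1 d))
  (Cmf_section1 B (F := fun x y => airy_integrand s2 x (d +i* y)) (Cmf_airy_line s2 d))
  (JZ K1 (J_gauss q1)) (JZ K2 (J_gauss q2)) _ _ _ (fun u t => @airy_line_ccvg s2 d B u t) JF.
have PI : CI (fun y => fourier F1 (- y) * fourier F2 y) =
    ((2 * pi)^-1 ^+ 2)%:C^-1 * (I (fun y => airys s1 (A + y) * airys s2 (B - y)))%:C.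
  rewrite -CI_real -CIZ//; apply: CI_ext => y.
  by rewrite PE mulKf// fmorph_eq0.
rewrite {}PI {}E; move: (I _) (airys _ _) => P1 P2 H; apply: (@complexI R).
have {}H : ((2 * pi)^-1 ^+ 2)%:C^-1 * P1%:C = (2 * pi)%:C * ((k^-1)%:C * ((2 * pi)%:C * P2%:C)).
  apply: H.
  - by move=> t; rewrite cn_airy_line.
  - by move=> t; rewrite cn_airy_line.
  - move=> t; rewrite ler_piMr ?expR_ge0// -expR0 ler_expR mulNr oppr_le0 mulr_ge0 ?sqr_ge0// ltW//.
have tc : (2 * pi)%:C != 0 :> C by rewrite fmorph_eq0 mulf_neq0 ?pnatr_eq0.
rewrite rmorphM; apply: (mulfI (mulf_neq0 tc tc)).
move: H; have -> : ((2 * pi)^-1 ^+ 2)%:C^-1 = (2 * pi)%:C * (2 * pi)%:C :> C.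
  by rewrite expr2 rmorphM invfM fmorphV invrK.
by move=> ->; ring.
Qed.

End AiryConvolution.

(** * Double contour integrals as half-line integrals *)

Section LineTransform.
Context {R : realType}.
Local Notation C := R[i].

Lemma rcM (x y : R) : (x * y)%:C = x%:C * y%:C :> C.
Proof. exact: rmorphM. Qed.

Lemma rcD (x y : R) : (x + y)%:C = x%:C + y%:C :> C.
Proof. exact: rmorphD. Qed.

Variable c : R.
Hypothesis c_gt0 : 0 < c.

(** The Laplace transform at [c z] of the measure [e0 delta_0 + k(x) dx]; the atom is present for
    [1 - hatP] and absent for [hatQ]. *)
Definition lap (e0 : R) (k : R -> R) (z : C) : C :=
  e0%:C + CI (fun x => (k x)%:C * cexp (- (c * x)%:C * z)).

Section Single.
Variables (s B m e0 M : R) (k : R -> R).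
Hypotheses (m_gt0 : 0 < m) (sm : - s < m) (dk : dec M k).

Let M0 : 0 <= M. Proof. exact: dec_ge0 dk. Qed.
Let mk : mf k. Proof. exact: dk.1. Qed.

Let kb x t : cn ((k x)%:C * cexp (- (c * x)%:C * (m +i* t))) <= M * wt x.
Proof.
rewrite cnM cn_real; case: (ltP 0 x) => x0; last by rewrite (dec_neg dk x0) normr0 mul0r mulr_ge0 ?wt_ge0.
apply: le_trans (dk.2 x); rewrite ler_piMr// cn_cexp -expR0 ler_expR /= oppr0 mul0r subr0 mulNr oppr_le0.
by rewrite !mulr_ge0// ltW.
Qed.

Let mF : Cmf (fun z : R * R => (k z.2)%:C * cexp (- (c * z.2)%:C * (m +i* z.1))).
Proof.
apply: CmfM; first by apply: Cmf_real; apply: (mf_comp mk); mf_tac.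
by apply: Cmf_exp; apply: CmfM; [apply: CmfN; apply: Cmf_real; mf_tac|apply: Cmf_line; mf_tac].
Qed.

Let mFt t : Cmf (fun x => (k x)%:C * cexp (- (c * x)%:C * (m +i* t))).
Proof. exact: (Cmf_section1 t (F := fun t x => (k x)%:C * cexp (- (c * x)%:C * (m +i* t)))). Qed.

Lemma CJ_lap t : CJ (fun x => (k x)%:C * cexp (- (c * x)%:C * (m +i* t))).
Proof. by apply: CJ_dom (mFt t) (fun x => kb x t) _; apply: JZ; exact: J_wt. Qed.

Lemma Cmf_lap : Cmf (fun t => lap e0 k (m +i* t)).
Proof.
apply: CmfD; first exact: Cmf_cst.
exact: (Cmf_CI (F := fun t x => (k x)%:C * cexp (- (c * x)%:C * (m +i* t)))).
Qed.

Lemma lap_bnd t : cn (lap e0 k (m +i* t)) <= `|e0| + 2 * M.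
Proof.
apply: le_trans (cnD _ _) _; rewrite cn_real lerD2l.
have -> : 2 * M = 2 * I (fun x => M * wt x) by rewrite IZ ?I_wt ?mulr1//; exact: J_wt.
by apply: cn_CI_le (fun x => kb x t) _ => //; apply: JZ; exact: J_wt.
Qed.

Definition lap_airy (t : R) : C := airy_integrand s B (m +i* t) * lap e0 k (m +i* t).

Lemma Cmf_lap_airy : Cmf lap_airy.
Proof.
apply: CmfM; last exact: Cmf_lap.
exact: (Cmf_section1 B (F := fun x y => airy_integrand s x (m +i* y)) (Cmf_airy_line s m)).
Qed.

Lemma lap_airy_bnd : exists2 N, J N & forall t, cn (lap_airy t) <= N t.
Proof.
exists (fun t => cn (airy_integrand s B (m +i* t)) * (`|e0| + 2 * M)).
  apply: JZr; apply: J_ext (JZ (expR (m ^+ 3 / 3 + s * m ^+ 2 - B * m)) (J_gauss (k := m + s) _)).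
    by move=> t; rewrite cn_airy_line.
  by have := sm; lra.
by move=> t; rewrite cnM ler_wpM2l ?cn_ge0// lap_bnd.
Qed.

Definition lap_value (y : R) : R := e0 * airys s (B + y) + I (fun x => k x * airys s (B + y + c * x)).

(** A factor [e^(-c x z)] shifts the Airy argument by [c x], so the Laplace transform acts on the
    line integral as a correlation. *)
Lemma lap_airyE (y : R) : CI (fun t => lap_airy t * cexp (- y%:C * (m +i* t))) =
  (2 * pi)%:C * (lap_value y)%:C.
Proof.
have p0 : (2 * pi)%:C != 0 :> C by rewrite fmorph_eq0 mulf_neq0 ?pnatr_eq0// gt_eqF ?pi_gt0.
have line B' : CI (fun t => airy_integrand s B' (m +i* t)) = (2 * pi)%:C * (airys s B')%:C.
  rewrite (airy_line B' m_gt0 sm) mulrA -rmorphM mulfV ?mul1r// mulf_neq0 ?pnatr_eq0// gt_eqF ?pi_gt0//.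
pose g t := airy_integrand s (B + y) (m +i* t).
have mg : Cmf g := Cmf_section1 (B + y) (F := fun x y => airy_integrand s x (m +i* y)) (Cmf_airy_line s m).
have Jg : CJ g := CJ_airy_line sm (B + y).
have Jcg : J (fun t => cn (g t)).
  apply: J_ext (JZ (expR (m ^+ 3 / 3 + s * m ^+ 2 - (B + y) * m)) (J_gauss (k := m + s) _)).
    by move=> t; rewrite /g cn_airy_line.
  by have := sm; lra.
pose F t x := g t * ((k x)%:C * cexp (- (c * x)%:C * (m +i* t))).
have mFF : Cmf (fun z : R * R => F z.1 z.2).
  by apply: CmfM => //; apply: (Cmf_comp mg); mf_tac.
have Fb t x : cn (F t x) <= cn (g t) * (M * wt x).
  by rewrite /F cnM ler_wpM2l ?cn_ge0.
have Jw : J (fun x => M * wt x) by apply: JZ; exact: J_wt.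
have JF t : CJ (F t) by apply: CJZ; exact: CJ_lap.
have JCF : CJ (fun t => CI (F t)).
  apply: (@CJ_dom _ _ (fun t => 2 * (cn (g t) * M))); [exact: Cmf_CI|move=> t|by apply: JZ; exact: JZr].
  have -> : cn (g t) * M = I (fun x => cn (g t) * (M * wt x)).
    by rewrite IZ// IZ ?I_wt ?mulr1//; exact: J_wt.
  apply: cn_CI_le; [exact: (Cmf_section1 t mFF)|exact: Fb|exact: JZ].
transitivity (CI (fun t => e0%:C * g t + CI (F t))).
  apply: CI_ext => t; rewrite /lap_airy /lap -mulrA [(_ + _) * _]mulrC mulrA -airy_integrandD -/(g t).
  by rewrite mulrDr [g t * _]mulrC /F CIZ//; exact: CJ_lap.
rewrite CID//; last exact: CJZ.
rewrite CIZ// /g line (Cfubini_prod mFF Jcg Jw Fb).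
have -> : CI (fun x => CI (F ^~ x)) = CI (fun x => (2 * pi)%:C * (k x * airys s (B + y + c * x))%:C).
  apply: CI_ext => x; rewrite [X in _ = _ * X]rmorphM mulrCA -line -CIZ; last exact: CJ_airy_line sm _.
  by apply: CI_ext => t; rewrite /F mulrCA airy_integrandD.
rewrite CIZ; last first.
  apply: CJ_real; apply: (@J_dom _ _ (fun x => airy_cst s m * expR (- m * (B + y)) * (M * wt x))).
  - by apply: mfM => //; apply: (mf_comp (mf_airys s)); mf_tac.
  - move=> x; case: (ltP 0 x) => x0; last first.
      by rewrite (dec_neg dk x0) (wt_neg x0) mulr0 mulr0 mul0r normr0.
    rewrite normrM mulrC ler_pM//; last exact: dk.2.
    apply: le_trans (airys_le m_gt0 sm _) _; rewrite ler_wpM2l//.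
      rewrite /airy_cst !mulr_ge0 ?invr_ge0 ?mulr_ge0 ?expR_ge0 ?pi_ge0//.
      by apply: I_ge0 => z; exact: expR_ge0.
    by rewrite ler_expR !mulNr lerN2 ler_pM2l// lerDl mulr_ge0// ltW.
  - exact: JZ.
rewrite CI_real.
have -> : (lap_value y)%:C = e0%:C * (airys s (B + y))%:C + (I (fun x => k x * airys s (B + y + c * x)))%:C.
  by rewrite -rcM -rcD.
by rewrite [RHS]mulrDr mulrCA.
Qed.

Lemma CJ_lap_airy y : CJ (fun t => lap_airy t * cexp (- y%:C * (m +i* t))).
Proof.
have [N JN bN] := lap_airy_bnd.
apply: (@CJ_dom _ _ (fun t => N t * expR (- m * y))); last exact: JZr.
  apply: CmfM; first exact: Cmf_lap_airy.
  by apply: Cmf_exp; apply: CmfM; [exact: Cmf_cst|apply: Cmf_line; mf_tac].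
move=> t; rewrite cnM; apply: ler_pM; rewrite ?cn_ge0//.
by rewrite cexp_line cn_Me cn_real ger0_norm ?expR_ge0.
Qed.

Lemma mf_lap_value : mf lap_value.
Proof.
apply: mfD; first by apply: mfM; [exact: mf_cst|apply: (mf_comp (mf_airys s)); mf_tac].
apply: (mf_I (F := fun y x => k x * airys s (B + y + c * x))).
by apply: mfM; [apply: (mf_comp mk)|apply: (mf_comp (mf_airys s))]; mf_tac.
Qed.

Lemma lap_value_bnd : exists2 K, 0 <= K & forall y, `|lap_value y| <= K * expR (- m * y).
Proof.
have [N JN bN] := lap_airy_bnd.
have N0 t : 0 <= N t := le_trans (cn_ge0 _) (bN t).
have tp : 0 < 2 * pi :> R by rewrite mulr_gt0 ?pi_gt0.
exists ((2 * pi)^-1 * (2 * I N)).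
  by rewrite mulr_ge0 ?invr_ge0 ?(ltW tp)// mulr_ge0// I_ge0.
move=> y; rewrite -(ler_pM2l tp).
have -> : 2 * pi * `|lap_value y| = cn ((2 * pi)%:C * (lap_value y)%:C).
  by rewrite cnM !cn_real (ger0_norm (ltW tp)).
rewrite -lap_airyE.
have -> : 2 * pi * ((2 * pi)^-1 * (2 * I N) * expR (- m * y)) = 2 * I (fun t => N t * expR (- m * y)).
  rewrite IZr//; have := lt0r_neq0 tp.
  by move: (2 * pi) (I N) (expR _) => x z w x0; field.
apply: cn_CI_le; last exact: JZr.
- apply: CmfM; first exact: Cmf_lap_airy.
  by apply: Cmf_exp; apply: CmfM; [exact: Cmf_cst|apply: Cmf_line; mf_tac].
- move=> t; rewrite cnM; apply: ler_pM; rewrite ?cn_ge0//.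
  by rewrite cexp_line cn_Me cn_real ger0_norm ?expR_ge0.
Qed.

End Single.

Section Pair.
Variables (s1 B1 m1 e1 M1 s2 B2 m2 e2 M2 r1 r2 : R) (k1 k2 : R -> R).
Hypotheses (m1_gt0 : 0 < m1) (sm1 : - s1 < m1) (dk1 : dec M1 k1).
Hypotheses (m2_gt0 : 0 < m2) (sm2 : - s2 < m2) (dk2 : dec M2 k2).
Hypothesis r_gt0 : 0 < r1 * m1 + r2 * m2.

Local Notation al := (lap_airy s1 B1 m1 e1 k1).
Local Notation be := (lap_airy s2 B2 m2 e2 k2).
Local Notation den t s := (r1%:C * (m1 +i* t) + r2%:C * (m2 +i* s)).

(** In the applications [r1] and [r2] are 1 or -1. Contour variables on lines in the left half-plane
    are reflected to the right one, and [u - v] becomes [r1 z + r2 w] up to sign, with positive real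
    part. *)
Definition pair_integrand (t s : R) : C := al t * be s / den t s.

Let r := r1 * m1 + r2 * m2.

Let Reden t s : complex.Re (den t s) = r.
Proof. by rewrite /= !mul0r !subr0. Qed.

Let mal : Cmf al. Proof. exact: Cmf_lap_airy dk1. Qed.
Let mbe : Cmf be. Proof. exact: Cmf_lap_airy dk2. Qed.

Let den_bnd t s : cn (den t s)^-1 <= r^-1.
Proof.
have h : r <= cn (den t s) by rewrite -(Reden t s); apply: le_trans (ler_norm _) (Re_le_cn _).
by rewrite cnV lef_pV2 ?posrE//; exact: lt_le_trans h.
Qed.

Let Cmf_inv : Cmf (fun z : R * R => (den z.1 z.2)^-1).
Proof.
have mh : Cmf (fun d : R => (r +i* d)^-1).
  (* Measurability of the inverse is read off from its representation as a Laplace integral. *)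
  have -> : (fun d : R => (r +i* d)^-1) = fun d => CI (fun y => (pos y)%:C * cexp (- (r +i* d) * y%:C)).
    by apply/funext => d; have [_ ->] := CI_exp (z := r +i* d) r_gt0.
  apply: (Cmf_CI (F := fun d y => (pos y)%:C * cexp (- (r +i* d) * y%:C))).
  apply: CmfM; first by apply: Cmf_real; mf_tac.
  by apply: Cmf_exp; apply: CmfM; [apply: CmfN; apply: Cmf_line; mf_tac|apply: Cmf_real; mf_tac].
have -> : (fun z : R * R => (den z.1 z.2)^-1) = fun z => (r +i* (r1 * z.1 + r2 * z.2))^-1.
  apply/funext => z; congr (_^-1).
  by apply/eqP; rewrite eq_complex /= !(mul0r, subr0, addr0) !eqxx.
by apply: (Cmf_comp mh); mf_tac.
Qed.

Lemma Cmf_pair : Cmf (fun z : R * R => pair_integrand z.1 z.2).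
Proof.
rewrite /pair_integrand; apply: CmfM; last exact: Cmf_inv.
by apply: CmfM; [apply: (Cmf_comp mal)|apply: (Cmf_comp mbe)]; mf_tac.
Qed.

Lemma CJ_pair t : CJ (pair_integrand t).
Proof.
have [N2 JN2 bN2] := lap_airy_bnd B2 e2 m2_gt0 sm2 dk2.
apply: (@CJ_dom _ _ (fun s => cn (al t) * N2 s * r^-1)); first exact: (Cmf_section1 t Cmf_pair).
  move=> s; rewrite /pair_integrand cnM cnM ler_pM ?mulr_ge0 ?cn_ge0//.
  by rewrite ler_wpM2l ?cn_ge0.
by apply: JZr; exact: JZ.
Qed.

Lemma CJ_pair2 : CJ (fun t => CI (pair_integrand t)).
Proof.
have [N1 JN1 bN1] := lap_airy_bnd B1 e1 m1_gt0 sm1 dk1.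
have [N2 JN2 bN2] := lap_airy_bnd B2 e2 m2_gt0 sm2 dk2.
apply: (@CJ_dom _ _ (fun t => 2 * I (fun s => N1 t * N2 s * r^-1))); first exact: (Cmf_CI Cmf_pair).
  move=> t; apply: cn_CI_le.
  - exact: (Cmf_section1 t Cmf_pair).
  - by move=> s; rewrite /pair_integrand cnM cnM !ler_pM ?mulr_ge0 ?cn_ge0.
  - by apply: JZr; exact: JZ.
apply: JZ; apply: J_ext (JZr (I N2 * r^-1) JN1) => t.
by rewrite IZr ?IZ ?mulrA//; exact: JZ.
Qed.

Local Notation V1 := (lap_value s1 B1 e1 k1).
Local Notation V2 := (lap_value s2 B2 e2 k2).

Lemma J_pair_value : J (fun y => pos y * (V1 (r1 * y) * V2 (r2 * y))).
Proof.
have [K2 K20 HK2] := lap_value_bnd B2 e2 m2_gt0 sm2 dk2.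
have [K1 K10 HK1] := lap_value_bnd B1 e1 m1_gt0 sm1 dk1.
have mV1 : mf V1 := mf_lap_value s1 B1 e1 dk1.
have mV2 : mf V2 := mf_lap_value s2 B2 e2 dk2.
apply: (@J_dom _ _ (fun y => K1 * K2 * (pos y * expR (- r * y)))).
- by apply: mfM; [mf_tac|apply: mfM; [apply: (mf_comp mV1)|apply: (mf_comp mV2)]; mf_tac].
- move=> y; rewrite normrM (ger0_norm (pos_ge0 _)) normrM.
  have -> : K1 * K2 * (pos y * expR (- r * y)) = pos y * (K1 * expR (- m1 * (r1 * y)) * (K2 * expR (- m2 * (r2 * y)))).
    have -> : - r * y = - m1 * (r1 * y) + - m2 * (r2 * y) by rewrite /r; ring.
    by rewrite expRD; ring.
  by rewrite ler_wpM2l ?pos_ge0// ler_pM.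
- by apply: JZ; exact: J_exp.
Qed.

(** The exponential [e^(-y den)] factors over the two contour variables, and each of them is then
    integrated by [lap_airyE]. *)
Lemma CI_pair : CI (fun t => CI (pair_integrand t)) =
  ((2 * pi) ^+ 2)%:C * (I (fun y => pos y * (V1 (r1 * y) * V2 (r2 * y))))%:C.
Proof.
have [N1 JN1 bN1] := lap_airy_bnd B1 e1 m1_gt0 sm1 dk1.
have [N2 JN2 bN2] := lap_airy_bnd B2 e2 m2_gt0 sm2 dk2.
pose E y : R := pos y * expR (- r * y).
have JE : J E := J_exp r_gt0.
pose U t y := cexp (- (r1 * y)%:C * (m1 +i* t)).
pose W s y := cexp (- (r2 * y)%:C * (m2 +i* s)).
have UW t s y : cexp (- den t s * y%:C) = U t y * W s y.
  by rewrite -cexpD; congr cexp; rewrite !rmorphM; ring.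
have cnUW t s y : cn ((pos y)%:C * (U t y * W s y)) = E y.
  by rewrite -UW cnM cn_real ger0_norm ?pos_ge0// cn_cexp /E -(Reden t s); congr (_ * expR _); case: (den t s) => p q /=; rewrite mulr0 subr0.
have mU : Cmf (fun z : R * R => U z.1 z.2).
  by apply: Cmf_exp; apply: CmfM; [apply: CmfN; apply: Cmf_real; mf_tac|apply: Cmf_line; mf_tac].
have mW : Cmf (fun z : R * R => W z.1 z.2).
  by apply: Cmf_exp; apply: CmfM; [apply: CmfN; apply: Cmf_real; mf_tac|apply: Cmf_line; mf_tac].
have mpos : Cmf (fun y : R => (pos y)%:C) by apply: Cmf_real; mf_tac.
have step1 t : CI (pair_integrand t) = CI (fun y => al t * ((pos y)%:C * (U t y * ((2 * pi)%:C * (V2 (r2 * y))%:C)))).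
  transitivity (CI (fun s => CI (fun y => al t * be s * ((pos y)%:C * (U t y * W s y))))).
    apply: CI_ext => s; rewrite /pair_integrand.
    have h : 0 < complex.Re (den t s) by rewrite Reden.
    have [j <-] := CI_exp h; rewrite -CIZ//.
    by apply: CI_ext => y; rewrite UW.
  rewrite (@Cfubini_prod _ (fun s y => al t * be s * ((pos y)%:C * (U t y * W s y))) (fun s => cn (al t) * N2 s) E)//.
  - apply: CI_ext => y; rewrite -(lap_airyE B2 e2 m2_gt0 sm2 dk2).
    have j := CJ_lap_airy B2 e2 m2_gt0 sm2 dk2 (r2 * y).
    rewrite -CIZ// -CIZ; last exact: CJZ.
    rewrite -CIZ; last by do 2 apply: CJZ.
    by apply: CI_ext => s; rewrite /W; ring.
  - apply: CmfM; first by apply: CmfM; [exact: Cmf_cst|apply: (Cmf_comp mbe); mf_tac].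
    apply: CmfM; first by apply: (Cmf_comp mpos); mf_tac.
    apply: CmfM => //; first exact: (Cmf_comp (Cmf_section1 t mU) mf_snd).
  - exact: JZ.
  - by move=> s y; rewrite cnM cnUW cnM ler_wpM2r ?mulr_ge0 ?pos_ge0 ?expR_ge0// ler_wpM2l ?cn_ge0.
transitivity (CI (fun t => CI (fun y => al t * ((pos y)%:C * (U t y * ((2 * pi)%:C * (V2 (r2 * y))%:C)))))).
  by apply: CI_ext.
have [K2 K20 HK2] := lap_value_bnd B2 e2 m2_gt0 sm2 dk2.
have mV2 : mf V2 := mf_lap_value s2 B2 e2 dk2.
have tp : 0 <= 2 * pi :> R by rewrite mulr_ge0 ?pi_ge0.
rewrite (@Cfubini_prod _ (fun t y => al t * ((pos y)%:C * (U t y * ((2 * pi)%:C * (V2 (r2 * y))%:C))))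
  N1 (fun y => 2 * pi * K2 * E y))//; first last.
- move=> t y; rewrite cnM; apply: ler_pM; rewrite ?cn_ge0//.
  rewrite /U cexp_line cnM cn_real (ger0_norm (pos_ge0 _)) cnM cn_Me cn_real (ger0_norm (expR_ge0 _)).
  rewrite cnM !cn_real (ger0_norm tp).
  have -> : 2 * pi * K2 * E y = pos y * (expR (- m1 * (r1 * y)) * (2 * pi * (K2 * expR (- m2 * (r2 * y))))).
    rewrite /E; have -> : - r * y = - m1 * (r1 * y) + - m2 * (r2 * y) by rewrite /r; ring.
    by rewrite expRD; ring.
  by rewrite !ler_wpM2l ?pos_ge0 ?expR_ge0.
- exact: JZ.
- apply: CmfM; first by apply: (Cmf_comp mal); mf_tac.
  apply: CmfM; first by apply: (Cmf_comp mpos); mf_tac.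
  apply: CmfM; first exact: mU.
  apply: CmfM; first exact: Cmf_cst.
  by apply: Cmf_real; apply: (mf_comp mV2); mf_tac.
have JV := J_pair_value.
rewrite -CI_real -CIZ; last exact: CJ_real.
apply: CI_ext => y.
have j := CJ_lap_airy B1 e1 m1_gt0 sm1 dk1 (r1 * y).
transitivity (CI (fun t => (pos y)%:C * ((2 * pi)%:C * (V2 (r2 * y))%:C) * (al t * U t y))).
  by apply: CI_ext => t; ring.
rewrite CIZ// /U (lap_airyE B1 e1 m1_gt0 sm1 dk1).
have alg (z x v w : C) : x * (z * v) * (z * w) = z * z * (x * (w * v)) by ring.
by rewrite (rcM (pos y)) (rcM (V1 _)) expr2 (rcM (2 * pi)) alg.
Qed.

End Pair.
End LineTransform.

(** * The resolvent of a squared Hankel operator *)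

Section HankelResolvent.
Context {R : realType}.
Implicit Types f g k l : R -> R.

Lemma geometric_zero (a M r : R) : 0 <= r -> r < 1 -> (forall n, `|a| <= M * r ^+ n) -> a = 0.
Proof.
move=> r0 r1 h; apply/eqP; rewrite -normr_le0.
have c : M * r ^+ n @[n --> \oo] --> (0 : R).
  rewrite -[X in _ --> X](mulr0 M); apply: cvgMr.
  by apply: cvg_expr; rewrite ger0_norm.
rewrite -(cvg_lim (@Rhausdorff R) c); apply: limr_ge; first exact: cvgP c.
exact: nearW.
Qed.

Variables (C : R) (t : R -> R).
Hypotheses (dt : dec C t) (C2 : C < 2).

Let C0 : 0 <= C. Proof. exact: dec_ge0 dt. Qed.
(** A bound for the norm of the Hankel operator in the weighted sup norm that [dec] measures; the
    1/2 is the gain of [star_decay]. *)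
Let th : R := C / 2.
Let th0 : 0 <= th. Proof. by rewrite /th divr_ge0. Qed.
Let th1 : th < 1. Proof. by rewrite /th; have := C2; lra. Qed.
Let mt : mf t. Proof. by have [] := dt. Qed.
Let tb x : `|t x| <= C. Proof. exact: dec_bnd dt. Qed.

Definition hankel f : R -> R := tr (star f t).
Local Notation T := hankel.

Lemma hankelE f : hankel f = tr (star f t).
Proof. by []. Qed.

Lemma dec_hankel M f : dec M f -> dec (M * th) (T f).
Proof. by move=> d; rewrite /th mulrA; exact: dec_star. Qed.

Lemma hankelB M N f g x : dec M f -> dec N g -> T (fun y => f y - g y) x = T f x - T g x.
Proof. by move=> d1 d2; rewrite /T /tr -mulrBr (starBl x d1 d2 mt tb). Qed.

Lemma hankel_ip M N f g : dec M f -> dec N g -> ip (T f) g = ip f (T g).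
Proof.
move=> d1 d2; rewrite ipC (ip_tr _ d2) (ip_tr _ d1) -!star0.
by rewrite (star_comm 0 d2 d1 mt tb).
Qed.

Lemma star_hankel M N k f w : dec M k -> dec N f -> 0 <= w -> star k (T f) w = star f (star k t) w.
Proof. by move=> d1 d2 w0; rewrite (star_tr _ d1 w0) (star_comm w d1 d2 mt tb). Qed.

Lemma hankel_fixpoint M f : dec M f -> (forall x, f x = T (T f) x) -> forall x, f x = 0.
Proof.
move=> d fE x.
have r0 : 0 <= th * th by rewrite mulr_ge0.
have r1 : th * th < 1 by rewrite mulr_ilt1.
have dn n : dec (M * (th * th) ^+ n) f.
  elim: n => [|n IH]; first by rewrite expr0 mulr1.
  have := dec_hankel (dec_hankel IH).
  have -> : T (T f) = f by apply/funext => y; rewrite -fE.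
  by rewrite exprSr !mulrA.
by apply: (@geometric_zero _ M (th * th)) => // n; exact: dec_bnd (dn n).
Qed.

Fixpoint neumann f n : R -> R :=
  if n is m.+1 then fun x => f x + T (T (neumann f m)) x else f.

Definition resolvent f x : R := limn (fun n => neumann f n x).

Section Neumann.
Variables (M : R) (f : R -> R).
Hypothesis df : dec M f.

Let r : R := th * th.
Let r0 : 0 <= r. Proof. by rewrite mulr_ge0. Qed.
Let r1 : r < 1. Proof. by rewrite mulr_ilt1. Qed.
Let M0 : 0 <= M. Proof. exact: dec_ge0 df. Qed.
(** The fixed point of [m |-> M + m r], so that one constant bounds all Neumann partial sums. *)
Let M' : R := M / (1 - r).
Let M'0 : 0 <= M'. Proof. by rewrite divr_ge0// subr_ge0 ltW. Qed.
Let M'E : M + M' * r = M'.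
Proof. by rewrite /M'; field; rewrite subr_eq0 gt_eqF. Qed.

Let dec_neumann n : dec M' (neumann f n).
Proof.
elim: n => [|n IH] /=.
  by apply: dec_le df; rewrite -M'E lerDl mulr_ge0.
by rewrite -M'E /r mulrA; apply: decD df _; exact: dec_hankel (dec_hankel IH).
Qed.

Let neumann_diff n j : dec (M' * r ^+ n) (fun x => neumann f (n + j) x - neumann f n x).
Proof.
elim: n => [|n IH].
  rewrite add0n expr0 mulr1 /=; case: j => [|j] /=.
    by split=> [|x]; [apply: mfD; [exact: df.1|apply: mfN; exact: df.1]|rewrite subrr normr0 mulr_ge0 ?wt_ge0].
  have -> : (fun x => f x + T (T (neumann f j)) x - f x) = T (T (neumann f j)).
    by apply/funext => x; rewrite addrC addKr.
  apply: dec_le (dec_hankel (dec_hankel (dec_neumann j))).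
  by rewrite -mulrA ler_piMr// ltW.
rewrite addSn /=.
have -> : (fun x => f x + T (T (neumann f (n + j))) x - (f x + T (T (neumann f n)) x)) =
    T (T (fun x => neumann f (n + j) x - neumann f n x)).
  apply/funext => x; have dn := dec_neumann.
  have -> : T (fun x => neumann f (n + j) x - neumann f n x) = fun x => T (neumann f (n + j)) x - T (neumann f n) x.
    by apply/funext => y; rewrite (hankelB _ (dn _) (dn _)).
  by rewrite (hankelB _ (dec_hankel (dn _)) (dec_hankel (dn _))) opprD addrACA subrr add0r.
have -> : M' * r ^+ n.+1 = M' * r ^+ n * th * th by rewrite exprSr {2}/r !mulrA.
exact: dec_hankel (dec_hankel IH).
Qed.

Let neumann_cvg x : neumann f n x @[n --> \oo] --> resolvent f x.
Proof.
suff : cvgn (fun n => neumann f n x) by [].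
apply/cauchy_cvgP; apply: cauchy_exP => e e0.
have c : M' * r ^+ n @[n --> \oo] --> (0 : R).
  rewrite -[X in _ --> X](mulr0 M'); apply: cvgMr.
  by apply: cvg_expr; rewrite ger0_norm.
have /cvgrPdist_lt /(_ _ e0) [N _ HN] := c.
exists (neumann f N x); exists N => // n /= Nn.
rewrite /ball /= distrC; have := dec_bnd x (neumann_diff N (n - N)).
rewrite subnKC// => /le_lt_trans; apply.
by have := HN N (leqnn N); rewrite /= sub0r normrN ger0_norm// mulr_ge0// exprn_ge0.
Qed.

Let resolvent_tail n : dec (M' * r ^+ n) (fun x => resolvent f x - neumann f n x).
Proof.
have mR : mf (resolvent f).
  apply: (@measurable_fun_cvg _ _ _ setT (neumann f)) => [m|x _].
    by have [] := dec_neumann m.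
  exact: neumann_cvg.
split; first by apply: mfD => //; apply: mfN; have [] := dec_neumann n.
move=> x.
have c : `|neumann f (m + n) x - neumann f n x| @[m --> \oo] --> `|resolvent f x - neumann f n x|.
  apply: cvg_norm; apply: cvgB; last exact: cvg_cst.
  have h := @neumann_cvg x; rewrite -(cvg_shiftn n) in h; exact: h.
rewrite -(cvg_lim (@Rhausdorff R) c); apply: limr_le; first exact: cvgP c.
by apply: nearW => m; rewrite addnC; have [] := neumann_diff n m.
Qed.

Lemma dec_resolvent : exists M1, dec M1 (resolvent f).
Proof.
have := decD (resolvent_tail 0) df.
have -> : (fun x => resolvent f x - neumann f 0 x + f x) = resolvent f.
  by apply/funext => x; rewrite /= subrK.
by move=> d; exists (M' * r ^+ 0 + M).
Qed.

Lemma resolventE x : resolvent f x = f x + T (T (resolvent f)) x.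
Proof.
have [M1 dR] := dec_resolvent.
apply/eqP; rewrite -subr_eq0; apply/eqP.
apply: (@geometric_zero _ (2 * M') r) => // n.
(* The defect of the resolvent equation is a difference of two Neumann tails, both at most
   [M' r^n]. *)
have e : resolvent f x - (f x + T (T (resolvent f)) x) =
   (resolvent f x - neumann f n.+1 x) - T (T (fun x => resolvent f x - neumann f n x)) x.
  have dn := dec_neumann n.
  have -> : T (fun x => resolvent f x - neumann f n x) = fun x => T (resolvent f) x - T (neumann f n) x.
    by apply/funext => y; rewrite (hankelB _ dR dn).
  rewrite (hankelB _ (dec_hankel dR) (dec_hankel dn)) /=.
  by move: (T (T (resolvent f)) x) (T (T (neumann f n)) x) => u v; ring.
rewrite e; apply: le_trans (ler_normB _ _) _.
have h1 := dec_bnd x (resolvent_tail n.+1).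
have h2 := dec_bnd x (dec_hankel (dec_hankel (resolvent_tail n))).
have rn : 0 <= M' * r ^+ n by rewrite mulr_ge0 ?exprn_ge0.
have h3 : M' * r ^+ n.+1 <= M' * r ^+ n by rewrite exprSr mulrA ler_piMr// ltW.
have h4 : M' * r ^+ n * th * th <= M' * r ^+ n by rewrite -mulrA ler_piMr// ltW.
lra.
Qed.

Lemma resolvent_unique N u : dec N u -> (forall x, u x = f x + T (T u) x) ->
  forall x, u x = resolvent f x.
Proof.
move=> du uE x; have [M1 dR] := dec_resolvent.
apply/eqP; rewrite -subr_eq0; apply/eqP; move: x.
apply: (hankel_fixpoint (decB du dR)) => x.
have -> : T (fun x => u x - resolvent f x) = fun x => T u x - T (resolvent f) x.
  by apply/funext => y; rewrite (hankelB _ du dR).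
by rewrite (hankelB _ (dec_hankel du) (dec_hankel dR)) uE resolventE opprD addrACA subrr add0r.
Qed.

End Neumann.

(** Applying [T] to the resolvent equation of [f] gives the equation of [T f], which has only one
    decaying solution. *)
Lemma resolvent_hankel M f x : dec M f -> resolvent (T f) x = T (resolvent f) x.
Proof.
move=> d; have [M1 dR] := dec_resolvent d.
symmetry; apply: (resolvent_unique (dec_hankel d) (dec_hankel dR)) => y.
have e : T (resolvent f) y = T (fun x => f x + T (T (resolvent f)) x) y.
  by congr (T _ y); apply/funext => z; exact: resolventE d _.
have dTT := decN (dec_hankel (dec_hankel dR)).
have -> : T (resolvent f) y = T (fun x => f x - - T (T (resolvent f)) x) y.
  by rewrite e; congr (T _ y); apply/funext => z; rewrite opprK.
rewrite (hankelB _ d dTT); congr (_ + _).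
rewrite /T /tr -mulrN /star; congr (_ * _).
rewrite -IN.
  by apply: I_ext => z; rewrite mulNr opprK.
exact: (J_star _ dTT mt tb).
Qed.

(** The inner product of the two resolvents is expanded once by the equation of [f] and once by that
    of [g]; the terms with [T] coincide because [T] is symmetric. *)
Lemma resolvent_ip M N f g : dec M f -> dec N g -> ip (resolvent f) g = ip f (resolvent g).
Proof.
move=> df dg; have [M1 dRf] := dec_resolvent df; have [N1 dRg] := dec_resolvent dg.
have [mRf _] := dRf; have [mRg _] := dRg.
have ipD k l u : J (fun x => u x * k x) -> J (fun x => u x * l x) -> ip u (fun x => k x + l x) = ip u k + ip u l.
  by move=> j1 j2; rewrite /ip -ID//; apply: I_ext => x; rewrite mulrDr.
have bb (P : R) h : dec P h -> (forall y, `|h y| <= P) by move=> d y; exact: dec_bnd d.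
have E1 : ip (resolvent f) (resolvent g) = ip (resolvent f) g + ip (resolvent f) (T (T (resolvent g))).
  rewrite -ipD; [|exact: J_ip dRf dg.1 (bb _ _ dg)|exact: J_ip dRf (dec_hankel (dec_hankel dRg)).1 (bb _ _ (dec_hankel (dec_hankel dRg)))].
  by congr (ip _ _); apply/funext => x; exact: resolventE dg x.
have E2 : ip (resolvent f) (resolvent g) = ip f (resolvent g) + ip (T (T (resolvent f))) (resolvent g).
  rewrite ipC [ip f _]ipC [ip (T _) _]ipC -ipD; [|exact: J_ip dRg df.1 (bb _ _ df)|exact: J_ip dRg (dec_hankel (dec_hankel dRf)).1 (bb _ _ (dec_hankel (dec_hankel dRf)))].
  by congr (ip _ _); apply/funext => x; exact: resolventE df x.
have := E2; rewrite E1 (hankel_ip (dec_hankel dRf) dRg) (hankel_ip dRf (dec_hankel dRg)).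
by move/addIr.
Qed.

End HankelResolvent.

Opaque star tr ip hankel resolvent I.

Section InnerProduct.
Context {R : realType}.
Implicit Types f g k l : R -> R.

Lemma ip_dec M N f g : dec M f -> dec N g -> J (fun x => f x * g x).
Proof. by move=> d1 d2; exact: J_ip d1 d2.1 (fun y => dec_bnd y d2). Qed.

Lemma ipDr M N P f g h : dec M f -> dec N g -> dec P h ->
  ip f (fun x => g x + h x) = ip f g + ip f h.
Proof.
move=> d1 d2 d3; rewrite !ipE -ID; [|exact: ip_dec d1 d2|exact: ip_dec d1 d3].
by apply: I_ext => x; rewrite mulrDr.
Qed.

Lemma ipDl M N P f g h : dec M f -> dec N g -> dec P h ->
  ip (fun x => f x + g x) h = ip f h + ip g h.
Proof. by move=> d1 d2 d3; rewrite ipC (ipDr d3 d1 d2) !(ipC h). Qed.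

(** On the negative axis [star f k] is the reflection of [star k f], so the integral over the line
    splits into two half-line inner products. *)
Lemma correlation_split M N P f g k : dec M f -> dec N g -> dec P k ->
  I (fun w => star f k w * star g k w) =
  ip (tr (star f k)) (tr (star g k)) + ip (tr (star k f)) (tr (star k g)).
Proof.
move=> df dg dk.
have opp M1 h w : dec M1 h -> star h k (- w) = star k h w.
  by move=> dh; exact: star_opp w dk dh.1 (fun y => dec_bnd y dh).
have mh M1 h : dec M1 h -> mf (star h k) by move=> dh; apply: mf_star; [exact: dh.1|exact: dk.1].
have mh' M1 h : dec M1 h -> mf (star k h) by move=> dh; apply: mf_star; [exact: dk.1|exact: dh.1].
have J1 := ip_dec (dec_star df dk) (dec_star dg dk).
have J2 := ip_dec (dec_star dk df) (dec_star dk dg).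
have E2 : ip (tr (star k f)) (tr (star k g)) =
    I (fun w => tr (star k f) (- w) * tr (star k g) (- w)) by rewrite ipE -[LHS](I_opp J2).
rewrite E2 ipE -ID; [|exact: J1|exact: J_opp J2].
have m1 := mh _ _ df; have m2 := mh _ _ dg; have m3 := mh' _ _ df; have m4 := mh' _ _ dg.
have m5 := mf_tr m1; have m6 := mf_tr m2; have m7 := mf_tr m3; have m8 := mf_tr m4.
apply: I_except0; [by mf_tac|by mf_tac|].
move=> w w0; rewrite !trE.
have e1 : star f k w = star k f (- w) by rewrite -(opp _ _ _ df) opprK.
have e2 : star g k w = star k g (- w) by rewrite -(opp _ _ _ dg) opprK.
rewrite -e1 -e2 /pos oppr_gt0.
by case: ltrgtP w0 => //= _ _; ring.
Qed.

Lemma correlation_identity M N P f g k : dec M f -> dec N g -> dec P k ->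
  ip (tr (star f k)) (tr (star g k)) + ip (tr (star k f)) (tr (star k g)) =
  ip f (tr (star (tr (star k k)) g)) + ip g (tr (star (tr (star k k)) f)).
Proof.
move=> df dg dk; rewrite -(correlation_split df dg dk) (correlation_product df dg dk).
by rewrite (ip_tr _ df) (ip_tr _ dg).
Qed.

End InnerProduct.

(** * The bilinear form built from the kernels q and p *)

Section ResolventKernel.
Context {R : realType}.
Implicit Types f g k l : R -> R.
Variables (C : R) (t : R -> R).
Hypotheses (dt : dec C t) (C2 : C < 2).
Local Notation T := (hankel t).
Local Notation Rs := (resolvent t).

Definition qker : R -> R := Rs t.
Definition pker : R -> R := T qker.
Local Notation q := qker.
Local Notation p := pker.

Lemma dec_q : exists Q, dec Q q.
Proof. exact: dec_resolvent dt C2 _ _ dt. Qed.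

Lemma dec_p : exists P, dec P p.
Proof. by have [Q dq] := dec_q; exists (Q * (C / 2)); exact: dec_hankel dt _ _ dq. Qed.

Lemma qE x : q x = t x + T p x.
Proof. exact: resolventE dt C2 _ _ dt x. Qed.

Variables (Q P : R).
Hypotheses (dq : dec Q q) (dp : dec P p).
Let mt : mf t. Proof. by have [] := dt. Qed.
Let tb x : `|t x| <= C. Proof. exact: dec_bnd dt. Qed.

(** Here [q = t + T p]: correlating [f] with [t] gives [T f], and correlating [f] with [T p] gives
    the correlation of [p] with [T f]. *)
Lemma star_hankel_q M f w : dec M f -> 0 < w -> star f q w = T f w + star p (T f) w.
Proof.
move=> d w0.
have -> : q = fun x => t x + T p x by apply/funext => x; exact: qE.
have dTp := dec_hankel dt dp.
rewrite (starD w d mt dTp.1 tb (fun y => dec_bnd y dTp)).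
by rewrite (star_hankel dt dp d (ltW w0)) (hankelE t f) (tr_pos _ w0) hankelE (star_tr _ d (ltW w0)).
Qed.

Lemma star_hankel_p M f w : dec M f -> 0 <= w -> star f p w = star q (T f) w.
Proof. by move=> d w0; rewrite (star_hankel dt dq d w0) /pker hankelE (star_tr _ d w0). Qed.

(** The case [f = q] of [star_hankel_q], since [T q = p]. This quadratic relation is the form in
    which the resolvent equation enters [bform_step]. *)
Lemma tr_star_qq : tr (star q q) = fun x => p x + tr (star p p) x.
Proof.
apply/funext => x; case: (ltP 0 x) => x0.
  by rewrite !tr_pos// (star_hankel_q dq x0).
by rewrite !tr_neg// (dec_neg dp x0) addr0.
Qed.

Local Notation sp f := (tr (star p f)).
Local Notation sq f := (tr (star q f)).

Definition bform f g := ip (fun x => f x + sp f x) (fun x => g x + sp g x) - ip (sq f) (sq g).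

Lemma bform_hankel M N f g : dec M f -> dec N g ->
  bform (T f) (T g) = ip (tr (star f q)) (tr (star g q)) - ip (tr (star f p)) (tr (star g p)).
Proof.
move=> df dg.
have e1 (M1 : R) (h : R -> R) : dec M1 h -> (fun x => T h x + sp (T h) x) = tr (star h q).
  move=> dh; apply/funext => x; case: (ltP 0 x) => x0; last by rewrite hankelE !tr_neg// addr0.
  by rewrite [in RHS]tr_pos// (star_hankel_q dh x0) [in X in _ + X]tr_pos.
have e2 (M1 : R) (h : R -> R) : dec M1 h -> sq (T h) = tr (star h p).
  move=> dh; apply/funext => x; case: (ltP 0 x) => x0; last by rewrite !tr_neg.
  by rewrite (tr_pos (star q _) x0) (tr_pos (star h p) x0) (star_hankel_p dh (ltW x0)).
rewrite /bform; congr (ip _ _ - ip _ _).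
- exact: e1 df.
- exact: e1 dg.
- exact: e2 df.
- exact: e2 dg.
Qed.

(** After [bform_hankel] this is the difference of the correlation identities for [k = q] and
    [k = p]. By [tr_star_qq] the two autocorrelations differ by [p], which accounts exactly for the
    mixed terms of [bform]. *)
Lemma bform_step M N f g : dec M f -> dec N g ->
  bform f g - bform (T f) (T g) = ip f g.
Proof.
move=> df dg; rewrite (bform_hankel df dg) /bform.
have dspf := dec_star dp df; have dspg := dec_star dp dg.
rewrite (ipDl df dspf (decD dg dspg)) (ipDr df dg dspg) (ipDr dspf dg dspg).
have := correlation_identity df dg dq; have := correlation_identity df dg dp.
rewrite tr_star_qq.
have drp := dec_star dp dp.
have e M1 h : dec M1 h -> tr (star (fun x => p x + tr (star p p) x) h) = fun x => sp h x + tr (star (tr (star p p)) h) x.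
  move=> dh; apply/funext => x; rewrite !trE -mulrDr; congr (_ * _).
  rewrite !starE -ID; last 2 first.
  - exact: J_star x dp dh.1 (fun y => dec_bnd y dh).
  - exact: J_star x drp dh.1 (fun y => dec_bnd y dh).
  by apply: I_ext => y; rewrite mulrDl.
rewrite (e _ _ df) (e _ _ dg) (ipDr df dspg (dec_star drp dg)) (ipDr dg dspf (dec_star drp df)).
rewrite (ipC (sp f) g).
have alg (a b c d e' f' g' h i : R) : g' + d = h + i -> f' + e' = b + h + (c + i) ->
  a + b + (c + d) - e' - (f' - g') = a by lra.
exact: alg.
Qed.

Lemma bform_bound : exists K, forall M N f g, dec M f -> dec N g -> `|bform f g| <= K * (M * N).
Proof.
exists ((1 + P / 2) * (1 + P / 2) + Q / 2 * (Q / 2)) => M N f g df dg.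
have b (M1 N1 : R) (u v : R -> R) : dec M1 u -> dec N1 v -> `|ip u v| <= M1 * N1.
  by move=> d1 d2; exact: ip_bnd d1 d2.1 (fun y => dec_bnd y d2).
apply: le_trans (ler_normB _ _) _.
have h1 := b _ _ _ _ (decD df (dec_star dp df)) (decD dg (dec_star dp dg)).
have h2 := b _ _ _ _ (dec_star dq df) (dec_star dq dg).
apply: le_trans (lerD h1 h2) _.
by rewrite le_eqVlt; apply/orP; left; apply/eqP; field.
Qed.

Lemma bformE M N f g : dec M f -> dec N g -> bform f g = ip (Rs f) g.
Proof.
move=> df dg; have [M1 du] := dec_resolvent dt C2 df.
pose f_ n := iter n T f; pose g_ n := iter n T g; pose u_ n := iter n T (Rs f).
pose th := C / 2.
have C0 : 0 <= C by exact: dec_ge0 dt.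
have th0 : 0 <= th by rewrite divr_ge0.
have th1 : th < 1 by rewrite /th; have := C2; lra.
have dec_iter (K : R) (h : R -> R) n : dec K h -> dec (K * th ^+ n) (iter n T h).
  move=> dh; elim: n => [|n IH]; first by rewrite expr0 mulr1.
  rewrite iterS exprSr mulrA; have := dec_hankel dt IH; exact.
have u_E n : u_ n = fun x => f_ n x + T (T (u_ n)) x.
  elim: n => [|n IH]; first by apply/funext => x; exact: resolventE dt C2 _ _ df x.
  rewrite /u_ /f_ /= -/(u_ n) -/(f_ n); apply/funext => x.
  have dfn := dec_iter _ _ n df; have dTT := dec_hankel dt (dec_hankel dt (dec_iter _ _ n du)).
  rewrite {1}IH !hankelE !trE -mulrDr -!hankelE; congr (_ * _).
  rewrite !starE -ID; last 2 first.
  - exact: J_star x dfn mt tb.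
  - exact: J_star x dTT mt tb.
  by apply: I_ext => y; rewrite mulrDl.
(* Both forms drop by [ip f g] when [T] is applied to all arguments, so their difference does not
   depend on [n], while each of them is of order [th^(2 n)]. *)
have stepE n : bform f g - ip (Rs f) g = bform (f_ n) (g_ n) - ip (u_ n) (g_ n).
  elim: n => [//|n ->]; rewrite /f_ /g_ /u_ !iterS -/(f_ n) -/(g_ n) -/(u_ n).
  have dfn := dec_iter _ _ n df; have dgn := dec_iter _ _ n dg; have dun := dec_iter _ _ n du.
  have h1 := bform_step dfn dgn.
  have h2 : ip (u_ n) (g_ n) = ip (f_ n) (g_ n) + ip (T (u_ n)) (T (g_ n)).
    rewrite -(hankel_ip dt (dec_hankel dt dun) dgn).
    rewrite -(ipDl dfn (dec_hankel dt (dec_hankel dt dun)) dgn).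
    by congr (ip _ _); exact: u_E.
  have alg (a b c d e : R) : a - b = c -> d = c + e -> a - d = b - e by lra.
  exact: alg h1 h2.
have [K HK] := bform_bound.
apply/eqP; rewrite -subr_eq0; apply/eqP.
have r0 : 0 <= th * th by rewrite mulr_ge0.
have r1 : th * th < 1 by rewrite mulr_ilt1.
apply: (@geometric_zero _ _ (K * (M * N) + M1 * N) (th * th) r0 r1) => n.
rewrite (stepE n); apply: le_trans (ler_normB _ _) _.
have dfn := dec_iter _ _ n df; have dgn := dec_iter _ _ n dg; have dun := dec_iter _ _ n du.
apply: le_trans (lerD (HK _ _ _ _ dfn dgn) (ip_bnd dun dgn.1 (fun y => dec_bnd y dgn))) _.
rewrite (exprMn _ th th); move: (th ^+ n) => z.
by rewrite le_eqVlt; apply/orP; left; apply/eqP; ring.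
Qed.

End ResolventKernel.

(** * Correlations with functions that may grow on the negative axis *)

Section Reflected.
Context {R : realType}.
Implicit Types f g k l : R -> R.

(* The rate [m + 1] below absorbs the growth [e^{mw}] of a reflected Airy function. *)
Definition decm (m B : R) (G : R -> R) := mf G /\ forall w, `|G w| <= B * (pos w * expR (- m * w)).

Lemma decm_tr m B g : 0 <= B -> mf g -> (forall w, 0 < w -> `|g w| <= B * expR (- m * w)) -> decm m B (tr g).
Proof.
move=> B0 mg gB; split; first exact: mf_tr.
move=> w; case: (ltP 0 w) => w0; last by rewrite tr_neg// normr0 pos0// mul0r mulr0.
by rewrite tr_pos// pos1// mul1r gB.
Qed.

Lemma decm_ge0 m B g : decm m B g -> 0 <= B.
Proof.
by move=> [_ gB]; have := le_trans (normr_ge0 _) (gB 1); rewrite pos1// mul1r pmulr_lge0// expR_gt0.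
Qed.

Lemma decm_star m B M l g : 0 <= m -> dec M l -> decm m B g -> decm m (M * B) (tr (star l g)).
Proof.
move=> m0 dl dg; have [mg gB] := dg; have [ml lM] := dl; have B0 := decm_ge0 dg; have M0 := dec_ge0 dl.
apply: decm_tr; [by rewrite mulr_ge0|exact: mf_star|].
move=> w w0; rewrite starE.
have -> : M * B * expR (- m * w) = I (fun x => M * B * expR (- m * w) * wt x).
  rewrite IZ; last exact: J_wt.
  by rewrite I_wt mulr1.
apply: I_norm_le; last by apply: JZ; exact: J_wt.
  by apply: mfM => //; apply: (mf_comp mg); mf_tac.
move=> x; case: (ltP 0 x) => x0; last by rewrite (dec_neg dl)// wt_neg// !(mul0r, mulr0, normr0).
rewrite normrM.
have -> : M * B * expR (- m * w) * wt x = M * wt x * (B * expR (- m * w)) by ring.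
apply: ler_pM => //; apply: le_trans (gB _) _.
rewrite pos1 ?addr_gt0// mul1r ler_wpM2l// ler_expR mulrDr gerDr mulNr oppr_le0 mulr_ge0// ltW//.
Qed.

Variables (m A : R) (f : R -> R).
Hypotheses (m1 : 1 <= m) (A0 : 0 <= A) (mf0 : mf f) (fA : forall x, `|f x| <= A * expR (- m * x)).

Let m0 : 0 <= m. Proof. by have := m1; lra. Qed.

Lemma dec_trf : dec A (tr f).
Proof.
apply: dec_tr => // x x0; apply: le_trans (fA x) _.
by rewrite ler_wpM2l// ler_expR mulNr lerN2 ler_peMl// ltW.
Qed.

Lemma J_refl_cst B G : decm (m + 1) B G -> J (fun w => G w * f (- w)).
Proof.
move=> dG; have [mG GB] := dG; have B0 := decm_ge0 dG.
apply: (@J_dom _ _ (fun w => B * A * wt w)); last by apply: JZ; exact: J_wt.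
  by apply: mfM => //; apply: (mf_comp mf0); mf_tac.
move=> w; rewrite normrM; apply: le_trans (ler_pM _ _ (GB w) (fA (- w))) _ => //.
have -> : B * (pos w * expR (- (m + 1) * w)) * (A * expR (- m * - w)) =
  B * A * (pos w * (expR (- (m + 1) * w) * expR (- m * - w))) by ring.
rewrite -expRD /wt; have -> : - (m + 1) * w + - m * - w = - w by ring.
by [].
Qed.

Lemma J_decm B G : decm (m + 1) B G -> J G.
Proof.
move=> dG; have [mG GB] := dG; have B0 := decm_ge0 dG.
apply: (@J_dom _ _ (fun w => B * wt w)) => //; last by apply: JZ; exact: J_wt.
move=> w; apply: le_trans (GB w) _; rewrite ler_wpM2l// /wt.
case: (ltP 0 w) => w0; last by rewrite pos0// !mul0r.
by rewrite ler_wpM2l ?pos_ge0// ler_expR mulNr lerN2 ler_peMl ?(ltW w0)//; have := m1; lra.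
Qed.

Section Kernel.
Variables (M B : R) (k G : R -> R).
Hypotheses (dk : dec M k) (dG : decm (m + 1) B G).

Let M0 : 0 <= M. Proof. exact: dec_ge0 dk. Qed.
Let B0 : 0 <= B. Proof. exact: decm_ge0 dG. Qed.
Let mk : mf k. Proof. by have [] := dk. Qed.
Let mG : mf G. Proof. by have [] := dG. Qed.

(** The factor [k (y + w)] forces [y > - w]; hence [f y] is at most [A e^(m w)], and the rate
    [m + 1] of [G] leaves [e^(-w)]. *)
Let bnd w y : `|G w * (k (y + w) * f y)| <= B * A * wt w * (M * wt (y + w)).
Proof.
case: (ltP 0 (y + w)) => yw; last by rewrite (dec_neg dk)// mul0r mulr0 normr0 !mulr_ge0 ?wt_ge0.
rewrite !normrM.
have h1 := dG.2 w; have h2 := dk.2 (y + w); have h3 := fA y.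
apply: le_trans (ler_pM _ _ h1 (ler_pM _ _ h2 h3)) _ => //.
have e : expR (- m * y) <= expR (m * w).
  by rewrite ler_expR -subr_ge0 mulNr opprK -mulrDr addrC mulr_ge0// ltW.
apply: (@le_trans _ _ (B * (pos w * expR (- (m + 1) * w)) * (M * wt (y + w) * (A * expR (m * w))))).
  by rewrite !(ler_wpM2l, mulr_ge0, pos_ge0, expR_ge0, wt_ge0).
have -> : B * (pos w * expR (- (m + 1) * w)) * (M * wt (y + w) * (A * expR (m * w))) =
  B * A * (pos w * (expR (- (m + 1) * w) * expR (m * w))) * (M * wt (y + w)) by ring.
rewrite -expRD; have -> : - (m + 1) * w + m * w = - w by ring.
by [].
Qed.

Lemma J_refl_shift w : J (fun y => k (y + w) * f y).
Proof.
apply: (@J_dom _ _ (fun y => A * expR (m * w) * (M * wt (y + w)))); last by apply: JZ; apply: JZ; exact: J_shift J_wt.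
  by apply: mfM => //; apply: (mf_comp mk); mf_tac.
move=> y; case: (ltP 0 (y + w)) => yw; last by rewrite (dec_neg dk)// mul0r normr0 !mulr_ge0 ?wt_ge0 ?expR_ge0.
have h2 := dk.2 (y + w); have h3 := fA y.
rewrite normrM mulrC; apply: ler_pM => //; apply: le_trans h3 _; rewrite ler_wpM2l//.
by rewrite ler_expR -subr_ge0 mulNr opprK -mulrDr addrC mulr_ge0// ltW.
Qed.

Lemma star_refl w : star k f (- w) = I (fun y => k (y + w) * f y).
Proof.
rewrite starE -[RHS](I_shift (- w) (J_refl_shift w)).
by apply: I_ext => x; rewrite subrK.
Qed.

Lemma J_refl : J (fun w => G w * star k f (- w)).
Proof.
have -> : (fun w => G w * star k f (- w)) = fun w => I (fun y => G w * (k (y + w) * f y)).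
  by apply/funext => w; rewrite star_refl IZ//; exact: J_refl_shift.
apply: (@fubini_J _ _ (fun w y => B * A * wt w * (M * wt (y + w))) (fun w => B * A * wt w * M)).
- by apply: mfM; [apply: (mf_comp mG)|apply: mfM; [apply: (mf_comp mk)|apply: (mf_comp mf0)]]; mf_tac.
- by apply: JZr; apply: JZ; exact: J_wt.
- exact: bnd.
- by move=> w; apply: JZ; apply: JZ; exact: J_shift J_wt.
- move=> w; rewrite IZ; last by apply: JZ; exact: J_shift J_wt.
  rewrite IZ; last exact: J_shift J_wt.
  rewrite I_shift; last exact: J_wt.
  by rewrite I_wt mulr1.
Qed.

(** Fubini moves the correlation from [f] to [G]. As [f] may grow on the negative axis,
    integrability of the new integrand is part of the conclusion. *)
Lemma I_refl : J (fun y => f y * star G k y) /\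
  I (fun w => G w * star k f (- w)) = I (fun y => f y * star G k y).
Proof.
have e y : f y * star G k y = I (fun w => G w * (k (y + w) * f y)).
  rewrite starE mulrC -IZr.
    by apply: I_ext => w; rewrite -mulrA [w + y]addrC.
  apply: (@J_dom _ _ (fun w => B * wt w * M)).
  - by apply: mfM => //; apply: (mf_comp mk); mf_tac.
  - move=> w; rewrite normrM; apply: ler_pM => //; last exact: dec_bnd dk.
    apply: le_trans (dG.2 w) _; rewrite ler_wpM2l// /wt.
    case: (ltP 0 w) => w0; last by rewrite pos0// !mul0r.
    by rewrite ler_wpM2l ?pos_ge0// ler_expR mulNr lerN2 ler_peMl ?(ltW w0)//; have := m1; lra.
  - by apply: JZr; apply: JZ; exact: J_wt.
have mF : mf (fun z : R * R => G z.1 * (k (z.2 + z.1) * f z.2)).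
  by apply: mfM; [apply: (mf_comp mG)|apply: mfM; [apply: (mf_comp mk)|apply: (mf_comp mf0)]]; mf_tac.
have J2 y : J (fun w => G w * (k (y + w) * f y)).
  apply: (@J_dom _ _ (fun w => A * expR (- m * y) * M * `|G w|)).
  - by apply: mfM => //; apply: mfM; [apply: (mf_comp mk)|]; mf_tac.
  - move=> w; rewrite !normrM mulrC ler_wpM2r// mulrC ler_pM//; last exact: dec_bnd dk.
  - by apply: JZ; apply: J_norm; exact: J_decm dG.
have JA : J (fun w => B * A * wt w * M) by apply: JZr; apply: JZ; exact: J_wt.
have JG w : J (fun y => B * A * wt w * (M * wt (y + w))) by apply: JZ; apply: JZ; exact: J_shift J_wt.
have GA w : I (fun y => B * A * wt w * (M * wt (y + w))) <= B * A * wt w * M.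
  rewrite IZ; last by apply: JZ; exact: J_shift J_wt.
  rewrite IZ; last exact: J_shift J_wt.
  by rewrite I_shift ?I_wt ?mulr1//; exact: J_wt.
split.
  have -> : (fun y => f y * star G k y) = fun y => I (fun w => G w * (k (y + w) * f y)).
    by apply/funext.
  exact: (fubini_J2 mF JA bnd JG GA J2).
transitivity (I (fun w => I (fun y => G w * (k (y + w) * f y)))).
  by apply: I_ext => w; rewrite star_refl IZ//; exact: J_refl_shift.
rewrite (fubini_I mF JA bnd JG GA J2).
by apply: I_ext => y; rewrite e.
Qed.

End Kernel.
End Reflected.

Section ReflectedForm.
Context {R : realType}.
Implicit Types f g k l : R -> R.

Lemma decm_dec (m B : R) g : 1 <= m -> decm m B g -> dec B g.
Proof.
move=> m1 dg; have [mg gB] := dg; have B0 := decm_ge0 dg; split=> // w.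
apply: le_trans (gB w) _; rewrite ler_wpM2l// /wt.
case: (ltP 0 w) => w0; last by rewrite pos0// !mul0r.
by rewrite ler_wpM2l ?pos_ge0// ler_expR mulNr lerN2 ler_peMl ?(ltW w0).
Qed.

Lemma decmD (m B B' : R) f g : decm m B f -> decm m B' g -> decm m (B + B') (fun x => f x + g x).
Proof.
move=> [mf0 fB] [mg gB]; split; first exact: mfD.
by move=> w; apply: le_trans (ler_normD _ _) _; rewrite mulrDl lerD.
Qed.

Variables (C : R) (t : R -> R).
Hypotheses (dt : dec C t) (C2 : C < 2).
Local Notation T := (hankel t).
Local Notation Rs := (resolvent t).
Local Notation q := (qker t).
Local Notation p := (pker t).

Variables (m A B : R) (f g : R -> R).
Hypotheses (m1 : 1 <= m) (A0 : 0 <= A) (mf0 : mf f) (fA : forall x, `|f x| <= A * expR (- m * x)).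
Hypothesis dg : decm (m + 1) B g.

Lemma reflected_form :
  [/\ J (fun w => tr (star q g) w * f (- w)), J (fun w => tr (star q g) w * star p f (- w)),
      J (fun w => (g w + tr (star p g) w) * star q f (- w)) &
  I (fun w => tr (star q g) w * f (- w)) + I (fun w => tr (star q g) w * star p f (- w))
  - I (fun w => (g w + tr (star p g) w) * star q f (- w)) = - ip (Rs (T (tr f))) g].
Proof.
have [Q dq] := dec_q dt C2; have [P dp] := dec_p dt C2.
have m1' : 1 <= m + 1 by have := m1; lra.
have m0' : 0 <= m + 1 by have := m1; lra.
have dg' := decm_dec m1' dg.
have d1 : decm (m + 1) (Q * B) (tr (star q g)) := decm_star m0' dq dg.
have d1p : decm (m + 1) (P * B) (tr (star p g)) := decm_star m0' dp dg.
have d2 : decm (m + 1) (B + P * B) (fun w => g w + tr (star p g) w) := decmD dg d1p.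
have [G1 G1E] : exists G1 : R -> R, G1 = tr (star q g) by exists (tr (star q g)).
have [G2 G2E] : exists G2 : R -> R, G2 = (fun w => g w + tr (star p g) w) by eexists.
rewrite -G1E in d1 *; rewrite -G2E in d2 *.
have d1' := decm_dec m1' d1; have d2' := decm_dec m1' d2.
have J0 := J_refl_cst mf0 fA d1.
have J1 := J_refl m1 A0 mf0 fA dp d1.
have J2 := J_refl m1 A0 mf0 fA dq d2.
have {}J2 : J (fun w => (g w + tr (star p g) w) * star q f (- w)) by move: J2; rewrite {1}G2E.
split=> //; rewrite [X in _ - X](_ : _ = I (fun w => G2 w * star q f (- w))); last by rewrite G2E.
have [J1' E1] := I_refl m1 A0 mf0 fA dp d1.
have [J2' E2] := I_refl m1 A0 mf0 fA dq d2.
have J0' : J (fun y => f y * G1 (- y)).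
  by have := J_opp J0; apply: J_ext => y; rewrite opprK mulrC.
have E0 : I (fun w => G1 w * f (- w)) = I (fun y => f y * G1 (- y)).
  by rewrite -(I_opp J0); apply: I_ext => y; rewrite opprK mulrC.
(* The three terms now form one integral of [f] times a cofactor. *)
rewrite E0 E1 E2 -(ID J0' J1') -(IB (JD J0' J1') J2').
have df : dec A (tr f) := dec_trf m1 A0 mf0 fA.
have mG1 : mf G1 := d1'.1; have mG2 : mf G2 := d2'.1.
have mp : mf p := dp.1; have mq : mf q := dq.1; have mg : mf g := dg'.1.
have gb x := dec_bnd x dg'; have pb x := dec_bnd x dp; have qb x := dec_bnd x dq.
rewrite (@I_except0 _ _ (fun y => tr f y * star G1 p y - tr f y * star G2 q y)); first last.
- move=> y y0; case: (ltP 0 y) => yy.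
    have -> : G1 (- y) = 0 by rewrite G1E tr_neg ?oppr_le0 ?(ltW yy).
    by rewrite (tr_pos _ yy) mulr0 add0r.
  rewrite !(tr_neg _ yy) !mul0r subr0 -mulrDr -mulrBr.
  suff -> : G1 (- y) + star G1 p y - star G2 q y = 0 by rewrite mulr0.
  have w0 : 0 < - y by rewrite oppr_gt0 lt_neqAle y0.
  have h1 : star G1 p y = star p (star q g) (- y).
    rewrite -[y in LHS]opprK (star_opp _ dp mG1 (fun x => dec_bnd x d1')).
    by rewrite G1E (star_tr _ dp (ltW w0)).
  have h2 : star G2 q y = star q g (- y) + star q (star p g) (- y).
    rewrite -[y in LHS]opprK (star_opp _ dq mG2 (fun x => dec_bnd x d2')).
    rewrite G2E (starD _ dq mg d1p.1 gb (fun x => dec_bnd x (decm_dec m1' d1p))).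
    by rewrite (star_tr _ dq (ltW w0)).
  by rewrite h1 h2 G1E (tr_pos _ w0) (star_comm _ dp dq mg gb) subrr.
- by apply: mfD; [|apply: mfN]; (apply: mfM; [exact: mf_tr|exact: mf_star]).
- have mG1' : mf (fun x : R => G1 (- x)) by apply: (mf_comp mG1); mf_tac.
  apply: mfD; [apply: mfD|apply: mfN]; apply: mfM; by [exact: mf0|exact: mG1'|exact: mf_star].
have s1b x : `|star G1 p x| <= Q * B * P := star_bnd x d1' mp pb.
have s2b x : `|star G2 q x| <= (B + P * B) * Q := star_bnd x d2' mq qb.
have ms1 : mf (star G1 p) by exact: mf_star.
have ms2 : mf (star G2 q) by exact: mf_star.
rewrite IB; [|exact: J_ip df ms1 s1b|exact: J_ip df ms2 s2b].
rewrite -[I (fun y => tr f y * star G1 p y)]ipE -[I (fun y => tr f y * star G2 q y)]ipE.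
rewrite -!star0 (star_comm 0 df d1' mp pb) (star_comm 0 df d2' mq qb) !star0.
have dTf := dec_hankel dt df.
(* Only positive arguments are left, where correlating [f] with [p] and [q] yields the entries of
   [bform (T (tr f)) g], with the opposite sign. *)
have -> : ip G1 (star (tr f) p) = ip G1 (tr (star q (T (tr f)))).
  rewrite -(ip_tr _ d1'); congr (ip _ _); apply/funext => w.
  case: (ltP 0 w) => w0; last by rewrite (tr_neg _ w0) (tr_neg _ w0).
  by rewrite (tr_pos _ w0) (tr_pos _ w0) (star_hankel_p dt dq df (ltW w0)).
have -> : ip G2 (star (tr f) q) = ip G2 (fun w => T (tr f) w + tr (star p (T (tr f))) w).
  rewrite -(ip_tr _ d2'); congr (ip _ _); apply/funext => w.
  case: (ltP 0 w) => w0; last by rewrite (tr_neg _ w0) (tr_neg _ w0) (dec_neg dTf w0) add0r.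
  by rewrite (tr_pos _ w0) (tr_pos _ w0) (star_hankel_q dt C2 dp df w0).
rewrite -(bformE dt C2 dq dp dTf dg') /bform (ipC G1) (ipC G2) G1E G2E opprB.
by [].
Qed.

End ReflectedForm.

(** * The squared Hankel operator on weakly integrable functions *)

Section SquareKernel.
Context {R : realType}.
Variables (A v : R -> R) (b : R).
Hypotheses (b0 : 0 <= b) (mA : mf A) (Ab : forall x, `|A x| <= b * expR (- x)).
Hypotheses (mv : mf v) (Jv : J (fun y => v y * expR (- y))).

Let Jv' : J (fun y => `|v y| * expR (- y)).
Proof. by apply: J_ext (J_norm Jv) => y; rewrite normrM [`|expR _|]ger0_norm ?expR_ge0. Qed.

Let Avb u y : `|v y * A (y + u)| <= b * expR (- u) * (`|v y| * expR (- y)).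
Proof.
rewrite normrM; have -> : b * expR (- u) * (`|v y| * expR (- y)) = `|v y| * (b * expR (- (y + u))).
  by rewrite opprD expRD; ring.
by rewrite ler_wpM2l// Ab.
Qed.

Lemma J_star_growth u : J (fun y => v y * A (y + u)).
Proof.
apply: (@J_dom _ _ (fun y => b * expR (- u) * (`|v y| * expR (- y)))); last exact: JZ.
  by apply: mfM => //; mf_tac.
exact: Avb.
Qed.

(** Integrability against [e^(-y)] is what an element of [L^2] provides. It is enough because the
    bound on [A (y + u)] splits into [e^(-y)] and [e^(-u)]. *)
Lemma dec_star_growth : exists D, dec D (tr (star v A)).
Proof.
have D0 : 0 <= b * I (fun y => `|v y| * expR (- y)).
  by rewrite mulr_ge0// I_ge0// => y; rewrite mulr_ge0 ?expR_ge0.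
exists (b * I (fun y => `|v y| * expR (- y))); apply: dec_tr => //; first exact: mf_star.
move=> u u0; rewrite starE.
have -> : b * I (fun y => `|v y| * expR (- y)) * expR (- u) = I (fun y => b * expR (- u) * (`|v y| * expR (- y))).
  by rewrite IZ//; ring.
apply: I_norm_le; [exact: J_mf (J_star_growth u)|exact: Avb|exact: JZ].
Qed.

Definition square_kernel x y := I (fun u => pos u * (A (x + u) * A (y + u))).

Let mk x : mf (fun z : R * R => pos z.2 * (A (x + z.2) * A (z.1 + z.2))).
Proof.
apply: mfM; first by mf_tac.
by apply: mfM; apply: (mf_comp mA); mf_tac.
Qed.

Let kb x y u : `|pos u * (A (x + u) * A (y + u))| <= b * expR (- x) * (b * expR (- y)) * wt u.
Proof.
case: (ltP 0 u) => u0; last by rewrite (pos0 u0) (wt_neg u0) mul0r mulr0 normr0.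
rewrite /wt (pos1 u0) !mul1r normrM.
have e1 : `|A (x + u)| <= b * expR (- x) * expR (- u).
  by apply: le_trans (Ab _) _; rewrite opprD expRD mulrA.
have e2 : `|A (y + u)| <= b * expR (- y).
  by apply: le_trans (Ab _) _; rewrite ler_wpM2l// ler_expR lerN2 lerDl ltW.
by apply: le_trans (ler_pM _ _ e1 e2) _ => //; rewrite [leRHS]mulrAC.
Qed.

Lemma J_square_kernel x : J (fun y => square_kernel x y * v y).
Proof.
apply: (@J_dom _ _ (fun y => b * expR (- x) * b * (`|v y| * expR (- y)))); last exact: JZ.
  by apply: mfM => //; exact: (mf_I (F := fun y u => pos u * (A (x + u) * A (y + u)))).
move=> y; rewrite normrM.
have -> : b * expR (- x) * b * (`|v y| * expR (- y)) = b * expR (- x) * (b * expR (- y)) * 1 * `|v y| by ring.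
rewrite ler_wpM2r// -(@I_wt R) -IZ; last exact: J_wt.
apply: I_norm_le; [exact: (mf_section1 y (F := fun y u => pos u * (A (x + u) * A (y + u))))|exact: kb|by apply: JZ; exact: J_wt].
Qed.

Lemma square_kernelE x : I (fun y => square_kernel x y * v y) = star (tr (star v A)) A x.
Proof.
have Jk y : J (fun u => pos u * (A (x + u) * A (y + u))).
  apply: J_dom (kb x y) _; last by apply: JZ; exact: J_wt.
  exact: (mf_section1 y (F := fun y u => pos u * (A (x + u) * A (y + u)))).
transitivity (I (fun y => I (fun u => pos u * (A (x + u) * A (y + u)) * v y))).
  by apply: I_ext => y; rewrite IZr.
rewrite (@fubini_prod _ (fun y u => pos u * (A (x + u) * A (y + u)) * v y)
  (fun y => b * expR (- x) * b * (`|v y| * expR (- y))) (@wt R)).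
- rewrite starE; apply: I_ext => u; rewrite trE starE -mulrA [_ * A (u + x)]mulrC mulrA -IZ.
    by apply: I_ext => y; rewrite [u + x]addrC; ring.
  exact: J_star_growth.
- by apply: mfM => //; apply: (mf_comp mv); mf_tac.
- exact: JZ.
- exact: J_wt.
- move=> y u; rewrite normrM; apply: le_trans (ler_wpM2r _ (kb x y u)) _ => //.
  by rewrite le_eqVlt; apply/orP; left; apply/eqP; ring.
Qed.

End SquareKernel.

(** * The Airy resolvent *)

Section ResolventOnHalfLine.
Context {R : realType}.
Local Notation mu := (@lebesgue_measure R).

Lemma J_sqr_Lfun2 (f : R -> R) : mf f -> J (fun x => f x ^+ 2) -> f \in Lfun mu 2%:E.
Proof.
move=> m1 J1; rewrite inE; apply/andP; split; first by rewrite inE.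
rewrite !inE/= /finite_norm unlock /Lnorm poweR_lty//=.
have -> : (\int[mu]_x (`|f x| `^ 2)%:E = \int[mu]_x (f x ^+ 2)%:E)%E.
  by apply: eq_integral => x _; rewrite powR_mulrn// real_normK ?num_real.
by rewrite EI// ltry.
Qed.

Variable a : R.
Hypothesis a0 : 0 <= a.

Definition airy_shift : R -> R := tr (fun x => airy (a + x)).
Local Notation A := (fun x : R => airy (a + x)).
Local Notation t := airy_shift.
Local Notation T := (hankel t).
Local Notation Rs := (resolvent t).
Local Notation b := (@airy_bound R).

Let b0 : 0 <= b. Proof. by rewrite /airy_bound divr_ge0 ?expR_ge0. Qed.

Let mA : mf A. Proof. by apply: (mf_comp (@mf_airys R 0)); mf_tac. Qed.

(** The condition [0 <= a] lets the shifted function keep the constant of the unshifted one, which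
    is below 2. *)
Let Ab (x : R) : `|A x| <= b * expR (- x).
Proof.
apply: le_trans (airy_le _) _; rewrite ler_wpM2l// ler_expR lerN2 lerDr//.
Qed.

Lemma dec_airy_shift : dec b t.
Proof. by apply: dec_tr => // x _; exact: Ab. Qed.

Let dt := dec_airy_shift.
Let C2 := @airy_bound_lt2 R.

Lemma KAi_square (x y : R) : KAi (a + x) (a + y) = square_kernel A x y.
Proof.
rewrite /KAi /KAi_shift Rint_cy; first by apply: I_ext => u; rewrite !addrA.
by apply: mfM; apply: (mf_comp (@mf_airys R 0)); mf_tac.
Qed.

(** The hypothesis on [v] is weak on purpose: the formula is applied to an unknown representative in
    [L^2] as well as to the Neumann resolvent. *)
Lemma one_minus_KAiE (g v : R -> R) (x : R) : v = (fun y => pos y * g (a + y)) ->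
  mf v -> J (fun y => v y * expR (- y)) ->
  one_minus_KAi a g (a + x) = g (a + x) - star (tr (star v A)) A x.
Proof.
move=> vE mv Jv; rewrite /one_minus_KAi Rint_oy; congr (_ - _).
rewrite -(square_kernelE b0 mA Ab mv Jv).
have Jk := J_square_kernel b0 mA Ab mv Jv x.
rewrite -(I_shift (- a) Jk); apply: I_ext => y.
by rewrite -KAi_square vE [a + (y - a)]addrC subrK mulrCA.
Qed.

Lemma star_shift_tr D (s : R -> R) (x : R) : dec D s -> 0 < x -> star s A x = T s x.
Proof. by move=> ds x0; rewrite hankelE (tr_pos _ x0) (star_tr _ ds (ltW x0)). Qed.

Lemma tr_star_shift D (s : R -> R) : dec D s -> tr (star s A) = T s.
Proof.
move=> ds; apply/funext => x; case: (ltP 0 x) => x0.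
  by rewrite (tr_pos _ x0) (star_shift_tr ds x0).
by rewrite (tr_neg _ x0) hankelE (tr_neg _ x0).
Qed.

Variables (M : R) (F : R -> R).
Hypothesis dF : dec M (tr (fun x => F (a + x))).
Local Notation f := (tr (fun x => F (a + x))).

(** [KAi_resolvent] is a [get], about which nothing is known before some solution is exhibited; the
    translated Neumann resolvent is one. *)
Lemma KAi_resolvent_exists : exists g, L2 a g /\
    one_minus_KAi a g = F %[ae mu in `]a, +oo[%classic].
Proof.
have [M1 du] := dec_resolvent dt C2 dF.
have [mu0 uM] := du.
pose g (x : R) := Rs f (x - a); exists g.
have mg : mf g by apply: (mf_comp mu0); mf_tac.
split.
  rewrite /L2; have -> : g \_ `]a, +oo[ = g.
    apply/funext => x; rewrite patchE mem_setE in_itv /= andbT.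
    by case: ltP => // xa; rewrite /g (dec_neg du)// subr_le0.
  apply: J_sqr_Lfun2 => //.
  have := J_shift (- a) (ip_dec du du); apply: J_ext => x.
  by rewrite expr2.
apply: aeW => x /=; rewrite in_itv /= andbT => ax.
have x0 : 0 < x - a by rewrite subr_gt0.
have vE : (fun y => pos y * g (a + y)) = Rs f.
  apply/funext => y; rewrite /g [a + y]addrC addrK.
  by rewrite -trE (dec_tr_id _ du).
have Ju : J (fun y => Rs f y * expR (- y)).
  apply: (@J_dom _ _ (fun y => M1 * wt y)); last by apply: JZ; exact: J_wt.
    by apply: mfM => //; mf_tac.
  move=> y; case: (ltP 0 y) => y0; last by rewrite (dec_neg du y0) mul0r normr0 wt_neg// mulr0.
  rewrite normrM; apply: le_trans (uM y); rewrite ler_piMr// ger0_norm ?expR_ge0//.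
  by rewrite -expR0 ler_expR oppr_le0 ltW.
have xE : x = a + (x - a) by rewrite addrC subrK.
rewrite [in LHS]xE (one_minus_KAiE _ (esym vE) mu0 Ju).
rewrite (tr_star_shift du) (star_shift_tr (dec_hankel dt du) x0) -xE /g.
rewrite (resolventE dt C2 dF) addrK (tr_pos _ x0) -xE//.
Qed.

(* The chosen representative is only known to lie in [L^2]; it agrees almost
   everywhere with [F + K_Ai g], which decays exponentially, so that uniqueness among
   exponentially decaying functions applies. *)
Lemma KAi_resolvent_ae : mf (fun x : R => pos (x - a) * KAi_resolvent a F x) /\
  \forall x \ae mu, pos ((x : R) - a) * KAi_resolvent a F x = Rs f (x - a).
Proof.
have := @getPex _ _ KAi_resolvent_exists; rewrite -/(KAi_resolvent a F).
move: (KAi_resolvent a F) => g [gL gE].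
pose g0 x := pos (x - a) * g x.
have g0E : g \_ `]a, +oo[ = g0.
  apply/funext => x; rewrite patchE mem_setE in_itv /= andbT /g0 /pos subr_gt0.
  by case: ltP => _; rewrite ?mul1r ?mul0r.
rewrite /L2 g0E in gL.
have mg0 : mf g0 by move: gL; rewrite inE => /andP[]; rewrite inE.
have Jg0 : J (fun x => g0 x ^+ 2) by exact: Lfun2_integrable_sqr gL.
split=> //.
pose v y := pos y * g (a + y).
have vE y : v y = g0 (y + a) by rewrite /v /g0 addrK addrC.
have mv : mf v by rewrite (funext vE); apply: (mf_comp mg0); mf_tac.
(* Square integrability gives weighted integrability through [|v| e^(-y) <= v^2 + e^(-2 y)]. *)
have Jv : J (fun y => v y * expR (- y)).
  apply: (@J_dom _ _ (fun y => v y ^+ 2 + pos y * expR (- 2 * y))).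
  - by apply: mfM => //; mf_tac.
  - move=> y; case: (ltP 0 y) => y0; last by rewrite /v (pos0 y0) !mul0r normr0 expr0n addr0.
    rewrite normrM [`|expR _|]ger0_norm ?expR_ge0// (pos1 y0) mul1r -[v y ^+ 2]real_normK ?num_real//.
    have -> : expR (- 2 * y) = expR (- y) ^+ 2 by rewrite expr2 -expRD; congr expR; ring.
    have := sqr_ge0 (`|v y| - expR (- y)); have : 0 <= `|v y| * expR (- y) by rewrite mulr_ge0 ?expR_ge0.
    by move: (`|v y|) (expR (- y)) => p q; nra.
  - apply: JD; last exact: J_exp.
    by have := J_shift a Jg0; apply: J_ext => y; rewrite vE.
have [D ds] := dec_star_growth b0 mA Ab mv Jv.
set s := tr (star v A) in ds.
have dTs := dec_hankel dt ds.
pose u x := f x + T s x.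
have du := decD dF dTs.
have gu : \forall x \ae mu, g0 x = u (x - a).
  apply: ae_imp gE => x /= H; rewrite /g0 /u; case: (ltP a x) => ax; last first.
    have x0 : x - a <= 0 by rewrite subr_le0.
    by rewrite (pos0 x0) (tr_neg _ x0) (dec_neg dTs x0) mul0r addr0.
  have x0 : 0 < x - a by rewrite subr_gt0.
  have xE : x = a + (x - a) by rewrite addrC subrK.
  have := H _; rewrite in_itv /= andbT => /(_ ax); rewrite [in LHS]xE (@one_minus_KAiE _ v)//.
  rewrite -/v -/s (star_shift_tr ds x0) -xE (pos1 x0) mul1r (tr_pos _ x0) -xE.
  by move=> <-; rewrite subrK.
(* The integral [s] of the representative [v] does not see null sets, so [v] may be replaced by [u];
   thereby [u] satisfies the resolvent equation at every point. *)
have sE : s = T u.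
  rewrite -(tr_star_shift du) /s; congr tr; apply/funext => w; rewrite !starE.
  have Jw := J_star_growth mA Ab mv Jv w.
  have Jw2 : J (fun y => u y * A (y + w)).
    refine (J_star_growth mA Ab du.1 _ w).
    apply: (@J_dom _ _ (fun y => (M + D * (b / 2)) * wt y)); last by apply: JZ; exact: J_wt.
      by apply: mfM; [exact: du.1|mf_tac].
    move=> y; case: (ltP 0 y) => y0; last by rewrite (dec_neg du y0) mul0r normr0 wt_neg// mulr0.
    rewrite normrM; apply: le_trans (du.2 y); rewrite ler_piMr// ger0_norm ?expR_ge0//.
    by rewrite -expR0 ler_expR oppr_le0 ltW.
  rewrite -(I_shift (- a) Jw) -(I_shift (- a) Jw2); apply: I_ae.
  - exact: J_mf (J_shift (- a) Jw).
  - exact: J_mf (J_shift (- a) Jw2).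
  - by apply: ae_imp gu => x /= <-; rewrite vE subrK.
have uE x : u x = Rs f x.
  apply: (resolvent_unique dt C2 dF du) => y.
  by rewrite -sE.
by apply: ae_imp gu => x; rewrite uE.
Qed.

Section Pairing.
Variable G : R -> R.
Hypotheses (mG : mf (fun x => G (a + x))) (JG : J (fun x => Rs f x * G (a + x))).

Let KAi_pairing_ae : \forall x \ae mu, pos ((x : R) - a) * (KAi_resolvent a F x * G x) =
  Rs f (x - a) * G (a + (x - a)).
Proof.
have [_ ae1] := KAi_resolvent_ae; apply: ae_imp ae1 => x /= H.
by rewrite mulrA H [a + _]addrC subrK.
Qed.

Let mf_KAi_pairing : mf (fun x : R => pos (x - a) * (KAi_resolvent a F x * G x)).
Proof.
have [m1 _] := KAi_resolvent_ae.
have GE x : G x = G (a + (x - a)) by rewrite addrC subrK.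
have mG' : mf G by rewrite (funext GE); apply: (mf_comp mG); mf_tac.
have -> : (fun x : R => pos (x - a) * (KAi_resolvent a F x * G x)) = fun x => pos (x - a) * KAi_resolvent a F x * G x.
  by apply/funext => x; rewrite mulrA.
exact: mfM.
Qed.

Lemma J_KAi_resolvent : J (fun x : R => pos (x - a) * (KAi_resolvent a F x * G x)).
Proof. exact: J_ae mf_KAi_pairing (J_shift (- a) JG) KAi_pairing_ae. Qed.

Lemma I_KAi_resolvent :
  I (fun x : R => pos (x - a) * (KAi_resolvent a F x * G x)) = I (fun x => Rs f x * G (a + x)).
Proof.
rewrite -(I_shift (- a) JG).
exact: I_ae mf_KAi_pairing (J_mf (J_shift (- a) JG)) KAi_pairing_ae.
Qed.

End Pairing.

End ResolventOnHalfLine.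

(** * Algebra of the three resolvent forms *)

Section ResolventForms.
Context {R : realType}.
Variables (C : R) (t : R -> R).
Hypotheses (dt : dec C t) (C2 : C < 2).
Local Notation T := (hankel t).
Local Notation Rs := (resolvent t).

Lemma ipBl M N P (f g h : R -> R) : dec M f -> dec N g -> dec P h ->
  ip (fun x => f x - g x) h = ip f h - ip g h.
Proof.
move=> d1 d2 d3; rewrite !ipE -IB; [|exact: ip_dec d1 d3|exact: ip_dec d2 d3].
by apply: I_ext => x; rewrite mulrBl.
Qed.

Lemma ipBr M N P (f g h : R -> R) : dec M f -> dec N g -> dec P h ->
  ip h (fun x => f x - g x) = ip h f - ip h g.
Proof. by move=> d1 d2 d3; rewrite ipC (ipBl d1 d2 d3) !(ipC h). Qed.

Lemma resolventB_ip M N P (f g h : R -> R) : dec M f -> dec N g -> dec P h ->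
  ip (Rs (fun x => f x - g x)) h = ip (Rs f) h - ip (Rs g) h.
Proof.
move=> d1 d2 d3; have [Q dR] := dec_resolvent dt C2 d3.
rewrite (resolvent_ip dt C2 (decB d1 d2) d3) (ipBl d1 d2 dR).
by rewrite (resolvent_ip dt C2 d1 d3) (resolvent_ip dt C2 d2 d3).
Qed.

Lemma resolvent_ip_hankel M N (f g : R -> R) : dec M f -> dec N g ->
  ip (Rs f) (T g) = ip (Rs (T f)) g.
Proof.
move=> d1 d2; have [Q dR] := dec_resolvent dt C2 d1.
rewrite -(hankel_ip dt dR d2); congr (ip _ _); apply/funext => x.
by rewrite (resolvent_hankel dt C2 x d1).
Qed.

(** This is [T R T = T^2 R = R - 1]. *)
Lemma resolvent_ip_hankel2 M N (f g : R -> R) : dec M f -> dec N g ->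
  ip (Rs (T f)) (T g) = ip (Rs f) g - ip f g.
Proof.
move=> d1 d2; have [Q dR] := dec_resolvent dt C2 d1.
have dTR := dec_hankel dt dR.
have -> : ip (Rs (T f)) (T g) = ip (T (Rs f)) (T g).
  by congr (ip _ _); apply/funext => x; rewrite (resolvent_hankel dt C2 x d1).
rewrite -(hankel_ip dt dTR d2) -(ipBl dR d1 d2); congr (ip _ _); apply/funext => x.
by rewrite (resolventE dt C2 d1 x) addrC addKr.
Qed.

Definition tacnode_core (u u' v v' : R -> R) : R :=
  ip (Rs u) v + ip (Rs u') v' - ip (Rs (T u)) v' - ip (Rs (T u')) v.

Variables (M M' N N' : R) (u u' v v' : R -> R).
Hypotheses (du : dec M u) (du' : dec M' u') (dv : dec N v) (dv' : dec N' v').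

Lemma core_i : ip u' v' + ip (Rs (fun x => u x - T u' x)) (fun x => v x - T v' x) =
  tacnode_core u u' v v'.
Proof.
have dTu' := dec_hankel dt du'; have dTv' := dec_hankel dt dv'.
rewrite (resolventB_ip du dTu' (decB dv dTv')).
have [Q d1] := dec_resolvent dt C2 du; have [Q' d2] := dec_resolvent dt C2 dTu'.
rewrite (ipBr dv dTv' d1) (ipBr dv dTv' d2) (resolvent_ip_hankel du dv') (resolvent_ip_hankel2 du' dv').
by rewrite /tacnode_core; lra.
Qed.

Lemma core_ii : ip (Rs (fun x => u x - T u' x)) v + ip (Rs (fun x => u' x - T u x)) v' =
  tacnode_core u u' v v'.
Proof.
have dTu' := dec_hankel dt du'; have dTu := dec_hankel dt du.
rewrite (resolventB_ip du dTu' dv) (resolventB_ip du' dTu dv').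
by rewrite /tacnode_core; lra.
Qed.

Lemma core_br : ip u' v' + ip u v - ip (Rs (fun x => v x - T v' x)) (T u')
  - ip (Rs (fun x => v' x - T v x)) (T u) = tacnode_core u u' v v'.
Proof.
have dTu' := dec_hankel dt du'; have dTu := dec_hankel dt du.
have dTv' := dec_hankel dt dv'; have dTv := dec_hankel dt dv.
rewrite (resolventB_ip dv dTv' dTu') (resolventB_ip dv' dTv dTu).
rewrite (resolvent_ip_hankel2 dv' du') (resolvent_ip_hankel2 dv du).
rewrite (resolvent_ip dt C2 dv dTu') (resolvent_ip dt C2 dv' dTu).
rewrite (resolvent_ip dt C2 dv du) (resolvent_ip dt C2 dv' du').
rewrite /tacnode_core !(ipC v) !(ipC v'); lra.
Qed.

End ResolventForms.

(** * The Brownian form and forms (i) and (ii) *)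

Section TacnodeForms.
Context {R : realType}.
Variables (sigma tau1 xi1 tau2 xi2 : R).
Hypothesis sigma_gt0 : 0 < sigma.

Local Notation c := (@cbrt2 R).
Local Notation a := (sigma_tilde sigma).
Local Notation t := (airy_shift a).
Local Notation T := (hankel t).
Local Notation Rs := (resolvent t).

Lemma pos_scale (k x : R) : 0 < k -> pos (k * x) = pos x.
Proof. by move=> k0; rewrite /pos pmulr_rgt0. Qed.

Lemma cbrt2_gt0 : 0 < c. Proof. exact: powR_gt0. Qed.

Lemma cbrt2_cube : c ^+ 3 = 2.
Proof. by rewrite -powR_mulrn ?powR_ge0// -powRrM divfK// powRr1. Qed.

Lemma cbrt2_sqr : 2 `^ (2 / 3) = c ^+ 2.
Proof. by rewrite -powR_mulrn ?powR_ge0// -powRrM; congr (_ `^ _); field. Qed.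

Lemma sigma_tilde_ge0 : 0 <= a.
Proof. by rewrite mulr_ge0 ?powR_ge0// ltW. Qed.

(** It turns the shift [- sigma] of the definitions into [+ sigma] in the coordinate measured from
    [sigma_tilde]. *)
Lemma cbrt2_sigma_tilde : c * a = 2 * sigma.
Proof. by rewrite /sigma_tilde cbrt2_sqr mulrA -exprS cbrt2_cube. Qed.

(* [Ai^(tau)(xi - sigma + cbrt2 * kappa)] in the coordinate [kappa = sigma_tilde + x]. *)
Definition hfun (tau xi x : R) : R := airys tau (xi + sigma + c * x).

Lemma mf_hfun tau xi : mf (hfun tau xi).
Proof. by apply: (mf_comp (mf_airys tau)); mf_tac. Qed.

(** The vertical line can be moved arbitrarily far to the right, so every large rate [m] is
    available, with a bound on the whole axis. *)
Lemma hfun_growth (tau xi m : R) : 0 < m -> - tau < m / c ->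
  exists2 K, 0 <= K & forall x, `|hfun tau xi x| <= K * expR (- m * x).
Proof.
move=> m0 mt; have mc : 0 < m / c by rewrite divr_gt0 ?cbrt2_gt0.
exists (airy_cst tau (m / c) * expR (- (m / c) * (xi + sigma))).
  rewrite mulr_ge0 ?expR_ge0// /airy_cst !mulr_ge0 ?invr_ge0 ?mulr_ge0 ?expR_ge0 ?pi_ge0//.
  by apply: I_ge0 => y; exact: expR_ge0.
move=> x; apply: le_trans (airys_le mc mt _) _.
rewrite le_eqVlt; apply/orP; left; apply/eqP; rewrite -[RHS]mulrA -expRD; congr (_ * expR _).
by have := cbrt2_gt0; move: c => k k0; field; rewrite gt_eqF.
Qed.

Lemma dec_hfun tau xi : exists M, dec M (tr (hfun tau xi)).
Proof.
have n0 := normr_ge0 tau; have c0 := cbrt2_gt0; have n1 := ler_norm (- tau); rewrite normrN in n1.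
have [||K K0 HK] := @hfun_growth tau xi (c * `|tau| + 1).
- by rewrite ltr_wpDl// mulr_ge0// ltW.
- rewrite ltr_pdivlMr//; apply: le_lt_trans (ler_wpM2r (ltW c0) n1) _.
  by rewrite mulrC ltrDl.
exists K; apply: dec_tr => //; first exact: mf_hfun.
move=> x x0; apply: le_trans (HK x) _; rewrite ler_wpM2l// ler_expR mulNr lerN2.
by rewrite ler_peMl ?(ltW x0)// lerDr mulr_ge0// ltW.
Qed.

Local Notation H tau xi := (tr (hfun tau xi)).

Lemma airys_calA tau xi x : airys tau (xi - sigma + c * (a + x)) = hfun tau xi x.
Proof. by rewrite /hfun mulrDr cbrt2_sigma_tilde; congr airys; ring. Qed.

Lemma calAE tau xi x : 0 < x ->
  calA tau (xi - sigma) (a + x) = H tau xi x - T (H tau (- xi)) x.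
Proof.
move=> x0; have [M d] := dec_hfun tau (- xi).
rewrite /calA airys_calA (tr_pos _ x0); congr (_ - _).
rewrite Rint_cy; last first.
  by apply: mfM; [apply: (mf_comp (mf_airys tau))|apply: (mf_comp (@mf_airys R 0))]; mf_tac.
rewrite -(star_shift_tr a d x0) starE; apply: I_ext => y.
have e1 : - (xi - sigma) + c * y = - xi + sigma + c * y by rewrite opprB [sigma - xi]addrC.
have e2 : a + x + y = a + (y + x) by rewrite -addrA [x + y]addrC.
by rewrite e1 e2 trE /hfun -[RHS]mulrA.
Qed.

Lemma tr_calA tau xi : tr (fun x => calA tau (xi - sigma) (a + x)) =
  fun x => H tau xi x - T (H tau (- xi)) x.
Proof.
apply/funext => x; case: (ltP 0 x) => x0; first by rewrite (tr_pos _ x0) calAE.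
by rewrite hankelE !(tr_neg _ x0) subrr.
Qed.

(** The substitution [u = c x] produces the factor [c] that already stands before the resolvent
    terms. *)
Lemma KAi_shift_ip s1 s2 x1 x2 : KAi_shift s1 s2 (sigma + x1) (sigma + x2) =
  c * ip (H s1 x1) (H s2 x2).
Proof.
have c0 := cbrt2_gt0; have [M d1] := dec_hfun s1 x1; have [N d2] := dec_hfun s2 x2.
have cc : c * c^-1 = 1 by rewrite mulfV ?gt_eqF.
rewrite /KAi_shift Rint_cy; last first.
  by apply: mfM; [apply: (mf_comp (mf_airys s1))|apply: (mf_comp (mf_airys s2))]; mf_tac.
set g := (X in I X).
have gE x : g (c * x) = H s1 x1 x * H s2 x2 x.
  rewrite /g !trE (pos_scale _ c0) /hfun (addrC sigma x1) (addrC sigma x2).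
  case: (ltP 0 x) => x0; first by rewrite (pos1 x0) !mul1r.
  by rewrite (pos0 x0) !mul0r.
have ci : 0 < c^-1 by rewrite invr_gt0.
have Jg : J g.
  have := J_scale ci (ip_dec d1 d2); apply: J_ext => x.
  by rewrite -gE mulrA cc mul1r.
by rewrite ipE -(I_ext gE) (I_scale c0 Jg) mulrA cc mul1r.
Qed.

Section Pairing.
Variables (tau xi : R) (G g : R -> R) (N : R).
Hypotheses (mG : mf (fun x => G (a + x))) (GE : forall x, 0 < x -> G (a + x) = g x) (dg : dec N g).
Local Notation F := (fun x => H tau xi x - T (H tau (- xi)) x).

Let pairing : J (fun x : R => pos (x - a) * (KAi_resolvent a (calA tau (xi - sigma)) x * G x)) /\
  I (fun x : R => pos (x - a) * (KAi_resolvent a (calA tau (xi - sigma)) x * G x)) = ip (Rs F) g.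
Proof.
have dt := dec_airy_shift sigma_tilde_ge0; have C2 := @airy_bound_lt2 R.
have [M d1] := dec_hfun tau xi; have [M' d2] := dec_hfun tau (- xi).
have dF := decB d1 (dec_hankel dt d2); have [Q dR] := dec_resolvent dt C2 dF.
have E x : Rs F x * g x = Rs F x * G (a + x).
  by case: (ltP 0 x) => x0; [rewrite GE|rewrite (dec_neg dR x0) !mul0r].
have JE : J (fun x => Rs F x * G (a + x)) by exact: J_ext E (ip_dec dR dg).
rewrite ipE (I_ext E); move: dF JE; rewrite -tr_calA => dF JE.
split; first exact: (J_KAi_resolvent sigma_tilde_ge0 dF mG JE).
exact: (I_KAi_resolvent sigma_tilde_ge0 dF mG JE).
Qed.

Lemma J_KAi_calA : J (fun x : R => pos (x - a) * (KAi_resolvent a (calA tau (xi - sigma)) x * G x)).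
Proof. by have [] := pairing. Qed.

Lemma I_KAi_calA :
  \int[lebesgue_measure]_(kappa in `]a, +oo[) (KAi_resolvent a (calA tau (xi - sigma)) kappa * G kappa) =
  ip (Rs F) g.
Proof. by rewrite Rint_oy; have [] := pairing. Qed.

End Pairing.

Let c0 := cbrt2_gt0.
Let dt := dec_airy_shift sigma_tilde_ge0.
Let C2 := @airy_bound_lt2 R.

Lemma mf_hfun_calA tau xi : mf (fun x => airys tau (xi - sigma + c * (a + x))).
Proof. by rewrite (funext (airys_calA tau xi)); exact: mf_hfun. Qed.

Lemma mf_calA tau xi : mf (fun x => calA tau (xi - sigma) (a + x)).
Proof.
rewrite /calA; apply: mfD; first exact: mf_hfun_calA.
apply: mfN.
have -> : (fun x => \int[lebesgue_measure]_(beta in `[0, +oo[) (airys tau (- (xi - sigma) + c * beta) * airy (a + x + beta))) =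
  fun x => I (fun beta => pos beta * (airys tau (- (xi - sigma) + c * beta) * airy (a + x + beta))).
  apply/funext => x; rewrite Rint_cy//.
  by apply: mfM; [apply: (mf_comp (mf_airys tau))|apply: (mf_comp (@mf_airys R 0))]; mf_tac.
apply: (mf_I (F := fun x beta => pos beta * (airys tau (- (xi - sigma) + c * beta) * airy (a + x + beta)))).
apply: mfM; first by mf_tac.
by apply: mfM; [apply: (mf_comp (mf_airys tau))|apply: (mf_comp (@mf_airys R 0))]; mf_tac.
Qed.

Definition tacnode_value : R :=
  - heat_part tau1 xi1 tau2 xi2 +
  c * tacnode_core t (H tau1 xi1) (H tau1 (- xi1)) (H (- tau2) xi2) (H (- tau2) (- xi2)).

Lemma tacnode_iE : tacnode_i sigma tau1 xi1 tau2 xi2 = tacnode_value.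
Proof.
have [M1 d1] := dec_hfun tau1 xi1; have [M1' d1'] := dec_hfun tau1 (- xi1).
have [M2 d2] := dec_hfun (- tau2) xi2; have [M2' d2'] := dec_hfun (- tau2) (- xi2).
rewrite /tacnode_i /tacnode_value -addrA KAi_shift_ip.
rewrite (I_KAi_calA tau1 xi1 (mf_calA (- tau2) xi2) (calAE (- tau2) xi2) (decB d2 (dec_hankel dt d2'))).
by rewrite -mulrDr (core_i dt C2 d1 d1' d2 d2').
Qed.

Lemma tacnode_iiE : tacnode_ii sigma tau1 xi1 tau2 xi2 = tacnode_value.
Proof.
have [M1 d1] := dec_hfun tau1 xi1; have [M1' d1'] := dec_hfun tau1 (- xi1).
have [M2 d2] := dec_hfun (- tau2) xi2; have [M2' d2'] := dec_hfun (- tau2) (- xi2).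
pose G (xi x : R) := airys (- tau2) (xi - sigma + c * x).
have GE xi x : 0 < x -> G xi (a + x) = H (- tau2) xi x.
  by move=> x0; rewrite /G airys_calA (tr_pos _ x0).
have mG xi : mf (fun x => G xi (a + x)) := mf_hfun_calA (- tau2) xi.
have J1 := J_KAi_calA tau1 xi1 (mG xi2) (GE xi2) d2.
have J2 := J_KAi_calA tau1 (- xi1) (mG (- xi2)) (GE (- xi2)) d2'.
have I1 := I_KAi_calA tau1 xi1 (mG xi2) (GE xi2) d2.
have I2 := I_KAi_calA tau1 (- xi1) (mG (- xi2)) (GE (- xi2)) d2'.
rewrite /tacnode_ii /tacnode_value -(core_ii dt C2 d1 d1' d2 d2'); congr (_ + c * _).
rewrite opprK in I2; rewrite Rint_oy in I1; rewrite Rint_oy in I2.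
have := ID J1 J2; rewrite I1 I2 => <-; rewrite Rint_oy; apply: I_ext => x.
exact: mulrDr.
Qed.

Lemma tacnode_brE : tacnode_br sigma tau1 xi1 tau2 xi2 = tacnode_value.
Proof.
have [M1 d1] := dec_hfun tau1 xi1; have [M1' d1'] := dec_hfun tau1 (- xi1).
have [M2 d2] := dec_hfun (- tau2) xi2; have [M2' d2'] := dec_hfun (- tau2) (- xi2).
rewrite /tacnode_br /tacnode_value -(core_br dt C2 d1 d1' d2 d2').
(* The subtracted Airy function cancels the first part of [calA]; what remains is minus [T] of the
   function with the opposite sign of [xi]. *)
have br (xi xi' : R) : \int[lebesgue_measure]_(kappa in `]a, +oo[)
    (KAi_resolvent a (calA (- tau2) (xi' - sigma)) kappa *
     (calA tau1 (xi - sigma) kappa - airys tau1 (xi - sigma + c * kappa))) =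
    - ip (Rs (fun x => H (- tau2) xi' x - T (H (- tau2) (- xi')) x)) (T (H tau1 (- xi))).
  have [M d] := dec_hfun tau1 (- xi); have dT := dec_hankel dt d.
  have [N2 e1] := dec_hfun (- tau2) xi'; have [N2' e2] := dec_hfun (- tau2) (- xi').
  have dF := decB e1 (dec_hankel dt e2); have [Q dR] := dec_resolvent dt C2 dF.
  pose G (x : R) := calA tau1 (xi - sigma) x - airys tau1 (xi - sigma + c * x).
  have mG : mf (fun x => G (a + x)).
    by apply: mfD; [exact: mf_calA|apply: mfN; exact: mf_hfun_calA].
  have GE x : 0 < x -> G (a + x) = - T (H tau1 (- xi)) x.
    by move=> x0; rewrite /G (calAE _ _ x0) airys_calA (tr_pos _ x0) addrAC subrr add0r.
  rewrite (I_KAi_calA (- tau2) xi' mG GE (decN dT)) !ipE -IN; last exact: ip_dec dR dT.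
  by apply: I_ext => x; rewrite mulrN.
rewrite (br xi1 xi2) (br (- xi1) (- xi2)) !opprK !KAi_shift_ip.
have alg (k p q r s u : R) : - p + k * q + k * r + k * - s + k * - u = - p + k * (q + r - s - u) by ring.
exact: alg.
Qed.

End TacnodeForms.

(** * Form (iii) *)

Section WholeLine.
Context {R : realType}.
Variables (p q h1 h2 g : R -> R) (P Q A1 A2 m kap : R).
Hypotheses (dp : dec P p) (dq : dec Q q) (m_gt0 : 0 < m) (mh1 : mf h1) (mh2 : mf h2).
Hypotheses (A10 : 0 <= A1) (A20 : 0 <= A2).
Hypotheses (b1 : forall x, `|h1 x| <= A1 * expR (- m * x)) (b1' : forall x, `|h1 x| <= A1 * expR (- (m + 1) * x)).
Hypotheses (b2 : forall x, `|h2 x| <= A2 * expR (- m * x)) (b2' : forall x, `|h2 x| <= A2 * expR (- (m + 1) * x)).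
Hypothesis conv : forall x z, I (fun w => h1 (x + w) * h2 (z - w)) = kap * g (x + z).
Variable A3 : R.
Hypotheses (mg : mf g) (dg : dec A3 (tr g)).

Let P0 : 0 <= P. Proof. exact: dec_ge0 dp. Qed.
Let Q0 : 0 <= Q. Proof. exact: dec_ge0 dq. Qed.
Let mp : mf p. Proof. exact: dp.1. Qed.
Let mq : mf q. Proof. exact: dq.1. Qed.
Let E (w : R) := expR (- (1 : R) * `|w|).
Let E0 w : 0 <= E w. Proof. exact: expR_ge0. Qed.
Let JE : J E. Proof. exact: J_exp_abs. Qed.

(** For [w >= 0] the first factor is taken at rate [m + 1] and the second at rate [m], for [w < 0]
    conversely; as [x] and [z] are nonnegative, the exponents add up to at most [- |w|]. *)
Let hb x z w : 0 <= x -> 0 <= z -> `|h1 (x + w) * h2 (z - w)| <= A1 * A2 * E w.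
Proof.
move=> x0 z0; have pr (a b : R) : `|h1 (x + w)| <= A1 * expR a -> `|h2 (z - w)| <= A2 * expR b ->
    a + b <= - `|w| -> `|h1 (x + w) * h2 (z - w)| <= A1 * A2 * E w.
  move=> h3 h4 h5; rewrite normrM; apply: le_trans (ler_pM _ _ h3 h4) _ => //.
  rewrite mulrACA -expRD ler_wpM2l ?mulr_ge0// ler_expR mulN1r//.
have mx : 0 <= m * x by rewrite mulr_ge0// ltW.
have mz : 0 <= m * z by rewrite mulr_ge0// ltW.
case: (lerP 0 w) => w0.
  by apply: pr (b1' _) (b2 _) _; rewrite ger0_norm//; nra.
by apply: pr (b1 _) (b2' _) _; rewrite ltr0_norm//; nra.
Qed.

Let J1 w : J (fun x => p x * h1 (x + w)).
Proof.
apply: (@J_dom _ _ (fun x => P * wt x * (A1 * expR (- m * w)))).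
- by apply: mfM => //; apply: (mf_comp mh1); mf_tac.
- move=> x; case: (ltP 0 x) => x0; last by rewrite (dec_neg dp x0) (wt_neg x0) mulr0 !mul0r normr0.
  rewrite normrM; apply: ler_pM => //; first exact: dp.2.
  apply: le_trans (b1 _) _; rewrite ler_wpM2l// ler_expR !mulNr lerN2 ler_pM2l// lerDr ltW//.
- by apply: JZr; apply: JZ; exact: J_wt.
Qed.

Let J2 w : J (fun z => q z * h2 (z + w)).
Proof.
apply: (@J_dom _ _ (fun x => Q * wt x * (A2 * expR (- m * w)))).
- by apply: mfM => //; apply: (mf_comp mh2); mf_tac.
- move=> x; case: (ltP 0 x) => x0; last by rewrite (dec_neg dq x0) (wt_neg x0) mulr0 !mul0r normr0.
  rewrite normrM; apply: ler_pM => //; first exact: dq.2.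
  apply: le_trans (b2 _) _; rewrite ler_wpM2l// ler_expR !mulNr lerN2 ler_pM2l// lerDr ltW//.
- by apply: JZr; apply: JZ; exact: J_wt.
Qed.

Let S w := h1 w + star p h1 w.

Let mS : mf S. Proof. by apply: mfD => //; exact: mf_star. Qed.

Let F1 z w x : p x * (h1 (x + w) * h2 (z - w)) = p x * h1 (x + w) * h2 (z - w).
Proof. by rewrite mulrA. Qed.

Let b3 z w : 0 <= z -> `|star p h1 w * h2 (z - w)| <= P * (A1 * A2 * E w).
Proof.
move=> z0; rewrite starE -IZr//.
have -> : P * (A1 * A2 * E w) = I (fun x => P * wt x * (A1 * A2 * E w)).
  by rewrite IZr ?IZ ?I_wt ?mulr1//; [exact: J_wt|apply: JZ; exact: J_wt].
apply: I_norm_le; last by apply: JZr; apply: JZ; exact: J_wt.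
  by apply: J_mf; apply: JZr; exact: J1.
move=> x; case: (ltP 0 x) => x0; last by rewrite (dec_neg dp x0) (wt_neg x0) mulr0 !mul0r normr0.
by rewrite -mulrA normrM; apply: ler_pM => //; [exact: dp.2|apply: hb; rewrite // ltW].
Qed.

Let b4 z w : 0 <= z -> `|h1 w * h2 (z - w)| <= A1 * A2 * E w.
Proof. by move=> z0; have := hb w (lexx 0) z0; rewrite add0r. Qed.

(** The value of [conv] at [x = 0], for the atom, plus its integral against [p]. *)
Let SE z : 0 <= z -> I (fun w => S w * h2 (z - w)) = kap * (g z + star p g z).
Proof.
move=> z0.
have mhz : mf (fun w : R => h2 (z - w)) by apply: (mf_comp mh2); mf_tac.
have Ja : J (fun w => h1 w * h2 (z - w)).
  by apply: (@J_dom _ _ (fun w => A1 * A2 * E w)); [exact: mfM|move=> w; exact: b4|exact: JZ].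
have Jb : J (fun w => star p h1 w * h2 (z - w)).
  apply: (@J_dom _ _ (fun w => P * (A1 * A2 * E w))); [|by move=> w; exact: b3|by do 2 apply: JZ].
  by apply: mfM => //; exact: mf_star.
transitivity (I (fun w => h1 w * h2 (z - w)) + I (fun w => star p h1 w * h2 (z - w))).
  by rewrite -(ID Ja Jb); apply: I_ext => w; rewrite /S mulrDl.
rewrite mulrDr; congr (_ + _).
  by have := conv 0 z; rewrite add0r => <-; apply: I_ext => w; rewrite add0r.
transitivity (I (fun w => I (fun x => p x * (h1 (x + w) * h2 (z - w))))).
  by apply: I_ext => w; rewrite starE -IZr//; apply: I_ext => x; rewrite mulrA.
rewrite (@fubini_prod _ (fun w x => p x * (h1 (x + w) * h2 (z - w))) (fun w => A1 * A2 * E w) (fun x => P * wt x)).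
- rewrite starE.
  transitivity (I (fun x => kap * (p x * g (x + z)))).
    apply: I_ext => x; rewrite mulrCA -conv.
    have [->|p0] := eqVneq (p x) 0; first by rewrite mul0r; under I_ext do rewrite mul0r; rewrite I0.
    have x0 : 0 < x by rewrite ltNge; apply: contra p0 => x0; rewrite (dec_neg dp x0).
    rewrite IZ//; apply: (@J_dom _ _ (fun w => A1 * A2 * E w)); [|by move=> w; apply: hb; rewrite // ltW|exact: JZ].
    by apply: mfM => //; apply: (mf_comp mh1); mf_tac.
  have [->|k0] := eqVneq kap 0; first by rewrite mul0r; under I_ext do rewrite mul0r; rewrite I0.
  rewrite IZ//; apply: (@J_dom _ _ (fun x => P * wt x * A3)); [|move=> x|by apply: JZr; apply: JZ; exact: J_wt].
    by apply: mfM => //; apply: (mf_comp mg); mf_tac.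
  case: (ltP 0 x) => x0; last by rewrite (dec_neg dp x0) (wt_neg x0) mulr0 !mul0r normr0.
  rewrite normrM; apply: ler_pM => //; first exact: dp.2.
  by rewrite -(tr_pos g (x := x + z)) ?ltr_pwDl//; exact: dec_bnd dg.
- apply: mfM; first by apply: (mf_comp mp); mf_tac.
  by apply: mfM; [apply: (mf_comp mh1)|apply: (mf_comp mh2)]; mf_tac.
- exact: JZ.
- by apply: JZ; exact: J_wt.
- move=> w x; case: (ltP 0 x) => x0; last by rewrite (dec_neg dp x0) (wt_neg x0) mulr0 mul0r mulr0 normr0.
  by rewrite normrM mulrC; apply: ler_pM => //; [apply: hb; rewrite // ltW|exact: dp.2].
Qed.

Let K := (1 + P) * (A1 * A2).

Let b5 z w : 0 <= z -> `|S w * h2 (z - w)| <= K * E w.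
Proof.
move=> z0; rewrite /S mulrDl; apply: le_trans (ler_normD _ _) _.
have -> : K * E w = A1 * A2 * E w + P * (A1 * A2 * E w) by rewrite /K; ring.
by apply: lerD; [exact: b4|exact: b3].
Qed.

Let K0 : 0 <= K. Proof. by rewrite !mulr_ge0// addr_ge0. Qed.

Let qS w : S w * star q h2 (- w) = I (fun z => q z * (S w * h2 (z - w))).
Proof. by rewrite starE -IZ//; apply: I_ext => z; rewrite mulrCA. Qed.

Let b6 w z : `|q z * (S w * h2 (z - w))| <= K * E w * (Q * wt z).
Proof.
case: (ltP 0 z) => z0; last by rewrite (dec_neg dq z0) (wt_neg z0) mulr0 mul0r mulr0 normr0.
by rewrite normrM mulrC; apply: ler_pM => //; [apply: b5; rewrite // ltW|exact: dq.2].
Qed.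

(** For fixed [z] the integral over [w] is a convolution, by which the product of [h1] and [h2]
    collapses to the single function [g]. *)
Lemma whole_line_correlation :
  J (fun w => S w * star q h2 (- w)) /\
  I (fun w => S w * star q h2 (- w)) = kap * I (fun z => q z * (g z + star p g z)).
Proof.
have mF : mf (fun z : R * R => q z.2 * (S z.1 * h2 (z.2 - z.1))).
  apply: mfM; first by apply: (mf_comp mq); mf_tac.
  by apply: mfM; [apply: (mf_comp mS)|apply: (mf_comp mh2)]; mf_tac.
split.
  apply: (@J_dom _ _ (fun w => K * E w * Q)); last by apply: JZr; exact: JZ.
    by apply: mfM => //; apply: (mf_comp (mf_star mq mh2)); mf_tac.
  move=> w; rewrite qS; have -> : K * E w * Q = I (fun z => K * E w * (Q * wt z)).
    by rewrite IZ ?IZ ?I_wt ?mulr1//; [exact: J_wt|apply: JZ; exact: J_wt].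
  apply: I_norm_le; [exact: (mf_section1 w (F := fun w z => q z * (S w * h2 (z - w))) mF)|exact: b6|by do 2 apply: JZ; exact: J_wt].
rewrite (I_ext qS).
rewrite (@fubini_prod _ (fun w z => q z * (S w * h2 (z - w))) (fun w => K * E w) (fun z => Q * wt z))//.
- transitivity (I (fun z => kap * (q z * (g z + star p g z)))).
    apply: I_ext => z; have [->|q0] := eqVneq (q z) 0.
      by rewrite mul0r mulr0; under I_ext do rewrite mul0r; rewrite I0.
    have z0 : 0 < z by rewrite ltNge; apply: contra q0 => z0; rewrite (dec_neg dq z0).
    rewrite mulrCA -SE ?(ltW z0)// IZ//.
    apply: (@J_dom _ _ (fun w => K * E w)); [|by move=> w; apply: b5; rewrite // ltW|exact: JZ].
    by apply: mfM => //; apply: (mf_comp mh2); mf_tac.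
  have [->|k0] := eqVneq kap 0; first by rewrite mul0r; under I_ext do rewrite mul0r; rewrite I0.
  have dpg := dec_star dp dg.
  rewrite IZ//; apply: J_ext (ip_dec dq (decD dg dpg)) => x.
  case: (ltP 0 x) => x0; last by rewrite (dec_neg dq x0) !mul0r.
  by rewrite !(tr_pos _ x0) (star_tr _ dp (ltW x0)).
- exact: JZ.
- by apply: JZ; exact: J_wt.
Qed.

End WholeLine.

(** * The term C as a correlation over the whole line *)

Section CorrelationKernel.
Context {R : realType}.
Variable sigma : R.
Hypothesis sigma_gt0 : 0 < sigma.

Local Notation c := (@cbrt2 R).
Local Notation a := (sigma_tilde sigma).
Local Notation t := (airy_shift a).
Local Notation q := (qker t).
Local Notation p := (pker t).
Local Notation A := (fun x : R => airy (a + x)).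
Local Notation b := (@airy_bound R).

Let a0 : 0 <= a := sigma_tilde_ge0 sigma_gt0.
Let dt := dec_airy_shift a0.
Let C2 := @airy_bound_lt2 R.
Let c0 : 0 < c := @cbrt2_gt0 R.

Lemma powR_cbrt2V : 2 `^ (- (1 / 3)) = c^-1.
Proof. by rewrite powRN. Qed.

Lemma powR_cbrt2V2 : 2 `^ (- (2 / 3)) = c^-1 ^+ 2.
Proof. by rewrite powRN cbrt2_sqr exprVn. Qed.

Lemma airys_dec (s xi : R) : exists K, dec K (tr (fun x => airys s (a + x + xi))).
Proof.
have n0 := normr_ge0 s; have n1 := ler_norm (- s); rewrite normrN in n1.
have m0 : 0 < `|s| + 1 by lra.
have ms : - s < `|s| + 1 by lra.
have k0 : 0 <= airy_cst s (`|s| + 1) * expR (- (`|s| + 1) * (a + xi)).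
  rewrite mulr_ge0 ?expR_ge0// /airy_cst !mulr_ge0 ?invr_ge0 ?mulr_ge0 ?expR_ge0 ?pi_ge0//.
  by apply: I_ge0 => y; exact: expR_ge0.
exists (airy_cst s (`|s| + 1) * expR (- (`|s| + 1) * (a + xi))); apply: dec_tr => //.
  by apply: (mf_comp (mf_airys s)); mf_tac.
move=> x x0; apply: le_trans (airys_le m0 ms _) _.
have -> : - (`|s| + 1) * (a + x + xi) = - (`|s| + 1) * (a + xi) + - (`|s| + 1) * x by ring.
rewrite expRD mulrA ler_wpM2l// ler_expR mulNr lerN2 ler_peMl ?(ltW x0)//; lra.
Qed.

Let dec_tA : dec b (tr A). Proof. exact: dt. Qed.

Lemma I_calQ (G : R -> R) : mf (fun x => G (a + x)) -> J (fun x => q x * G (a + x)) ->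
  \int[lebesgue_measure]_(kappa in `]a, +oo[) (calQ sigma kappa * G kappa) = I (fun x => q x * G (a + x)).
Proof. by move=> mG JG; rewrite Rint_oy (I_KAi_resolvent a0 dec_tA mG JG). Qed.

Lemma I_calQ_ip (G g : R -> R) N : (forall x, 0 < x -> G (a + x) = g x) -> dec N g ->
  \int[lebesgue_measure]_(kappa in `]a, +oo[) (calQ sigma kappa * G kappa) = ip q g.
Proof.
move=> GE dg; have [Q dq] := dec_q dt C2; have mg := dg.1.
have gE (x : R) : g (a + x - a) = g x by rewrite addrAC subrr add0r.
rewrite ipE -(I_ext (f := fun x => q x * g (a + x - a))); last by move=> x; rewrite gE.
rewrite -(@I_calQ (fun x => g (x - a))).
- rewrite !Rint_oy; apply: I_ext => x; case: (ltP 0 (x - a)) => x0; last by rewrite (pos0 x0) !mul0r.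
  by congr (_ * (_ * _)); rewrite -GE// addrC subrK.
- by apply: (mf_comp mg); mf_tac.
- by apply: J_ext (ip_dec dq dg) => x; rewrite gE.
Qed.

(** After the two integrals are exchanged, the one over [lambda] yields [p], because [p = T q]. *)
Lemma calC_inner (g gx : R -> R) (K x : R) : mf g -> dec K (tr g) -> 0 < x ->
  gx = (fun al => g (al + x)) ->
  \int[lebesgue_measure]_(lambda in `]a, +oo[)
     (calQ sigma lambda * \int[lebesgue_measure]_(alpha in `[0, +oo[) (airy (alpha + lambda) * gx alpha)) =
  star p g x.
Proof.
move=> mg dg x0 ->; have [Q dq] := dec_q dt C2; have [P dp] := dec_p dt C2.
have mq := dq.1; have mairy := @mf_airys R 0.
have b0 : 0 <= b := dec_ge0 dt.
have K0 := dec_ge0 dg.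
pose F z al := pos al * (airy (al + (a + z)) * g (al + x)).
have mF : mf (fun z : R * R => F z.1 z.2).
  apply: mfM; first by mf_tac.
  by apply: mfM; [apply: (mf_comp mairy)|apply: (mf_comp mg)]; mf_tac.
have Fb z al : 0 < z -> `|F z al| <= b * K * wt al.
  move=> z0; rewrite /F; case: (ltP 0 al) => al0; last by rewrite (pos0 al0) (wt_neg al0) mul0r mulr0 normr0.
  rewrite (pos1 al0) mul1r /wt (pos1 al0) mul1r normrM mulrAC; apply: ler_pM => //.
    apply: le_trans (airy_le _) _; rewrite ler_wpM2l// ler_expR lerN2 lerDl.
    by rewrite addr_ge0// ltW.
  by rewrite -(tr_pos g (x := al + x)) ?addr_gt0//; exact: dec_bnd dg.
have E1 z : \int[lebesgue_measure]_(alpha in `[0, +oo[) (airy (alpha + (a + z)) * g (alpha + x)) = I (F z).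
  by rewrite Rint_cy//; apply: mfM; [apply: (mf_comp mairy)|apply: (mf_comp mg)]; mf_tac.
have mIF : mf (fun z => I (F z)) := mf_I mF.
have Jw : J (fun al => b * K * wt al) by apply: JZ; exact: J_wt.
have Fb' z al : `|q z * F z al| <= Q * wt z * (b * K * wt al).
  case: (ltP 0 z) => z0; last by rewrite (dec_neg dq z0) (wt_neg z0) mulr0 !mul0r normr0.
  by rewrite normrM; apply: ler_pM => //; [exact: dq.2|exact: Fb].
have mqF : mf (fun z : R * R => q z.1 * F z.1 z.2) by apply: mfM => //; apply: (mf_comp mq); mf_tac.
have Jq : J (fun z => Q * wt z) by apply: JZ; exact: J_wt.
have qIF z : q z * I (F z) = I (fun al => q z * F z al).
  case: (ltP 0 z) => z0.
    rewrite IZ//; apply: J_dom (mf_section1 z mF) (fun al => Fb z al z0) Jw.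
  by rewrite (dec_neg dq z0) mul0r; under [in RHS]I_ext do rewrite mul0r; rewrite I0.
have JqF : J (fun z => q z * I (F z)).
  rewrite (funext qIF); apply: (@fubini_J _ (fun z al => q z * F z al) (fun z al => Q * wt z * (b * K * wt al)) (fun z => Q * wt z * (b * K))) => //.
  - exact: JZr.
  - by move=> z; apply: JZ.
  - by move=> z; rewrite IZ// IZ ?I_wt ?mulr1//; exact: J_wt.
pose G lam := \int[lebesgue_measure]_(alpha in `[0, +oo[) (airy (alpha + lam) * g (alpha + x)).
rewrite (@I_calQ G); first last.
- by apply: J_ext JqF => z; rewrite /G E1.
- by rewrite /G (funext E1).
rewrite (I_ext (g := fun z => I (fun al => q z * F z al))); last by move=> z; rewrite /G E1 qIF.
rewrite (fubini_prod mqF Jq Jw Fb') starE; apply: I_ext => al.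
have -> : p al = pos al * star q A al by rewrite /pker -(tr_star_shift a dq) trE.
rewrite starE -mulrA [_ * g _]mulrC mulrA -IZ.
  by apply: I_ext => z; rewrite /F addrCA [al + z]addrC; ring.
apply: (@J_dom _ _ (fun z => Q * wt z * (b * expR (- (a + al))))); [|move=> z|exact: JZr].
  apply: (mfM mq); apply: (mf_comp mairy); apply: mfD; first exact: mf_cst.
  by apply: mfD; [exact: mf_id|exact: mf_cst].
case: (ltP 0 z) => z0; last by rewrite (dec_neg dq z0) (wt_neg z0) mulr0 !mul0r normr0.
rewrite normrM; apply: ler_pM => //; first exact: dq.2.
apply: le_trans (airy_le _) _; rewrite ler_wpM2l// ler_expR lerN2 lerD2l lerDr ltW//.
Qed.

Lemma calC_halfE (s xi : R) (g : R -> R) : g = (fun x => airys (c^-1 ^+ 2 * s) (a + x + c^-1 * xi)) ->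
  calC_half sigma s xi = c^-1 * I (fun z => q z * (g z + star p g z)).
Proof.
move=> gE; have [K] := airys_dec (c^-1 ^+ 2 * s) (c^-1 * xi); rewrite -gE => dg.
have [Q dq] := dec_q dt C2; have [P dp] := dec_p dt C2.
have mg : mf g by rewrite gE; apply: (mf_comp (mf_airys _)); mf_tac.
have dgg := decD dg (dec_star dp dg).
rewrite /calC_half powR_cbrt2V powR_cbrt2V2 (I_calQ_ip _ dgg).
  rewrite ipE; congr (_ * _); apply: I_ext => x.
  case: (ltP 0 x) => x0; last by rewrite (dec_neg dq x0) !mul0r.
  by rewrite !(tr_pos _ x0) (star_tr _ dp (ltW x0)).
move=> x x0; rewrite (tr_pos _ x0) (tr_pos _ x0) (star_tr _ dp (ltW x0)).
have gxE : (fun al => airys (c^-1 ^+ 2 * s) (al + (a + x) + c^-1 * xi)) = fun al => g (al + x).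
  by apply/funext => al; rewrite gE addrCA.
by rewrite -(calC_inner mg dg x0 gxE) [in RHS]gE.
Qed.

Lemma calC_whole (tau1 tau2 x1 x2 : R) (h1 h2 : R -> R) :
  h1 = hfun sigma tau1 x1 -> h2 = hfun sigma (- tau2) x2 ->
  J (fun w => (h1 w + star p h1 w) * star q h2 (- w)) /\
  calC_half sigma (tau1 - tau2) (x1 + x2) = c * I (fun w => (h1 w + star p h1 w) * star q h2 (- w)).
Proof.
move=> h1E h2E; have [Q dq] := dec_q dt C2; have [P dp] := dec_p dt C2.
pose g x := airys (c^-1 ^+ 2 * (tau1 - tau2)) (a + x + c^-1 * (x1 + x2)).
have [K] := airys_dec (c^-1 ^+ 2 * (tau1 - tau2)) (c^-1 * (x1 + x2)); rewrite -/g => dg.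
have mg : mf g by apply: (mf_comp (mf_airys _)); mf_tac.
have n1 := ler_norm (- tau1); have n2 := ler_norm (- - tau2); rewrite normrN in n1; rewrite opprK in n2.
have n10 := normr_ge0 tau1; have n20 := normr_ge0 tau2.
(* With this choice [m / c] and [(m + 1) / c] exceed both [- tau1] and [tau2], so each Airy function
   is bounded at the two rates. *)
pose m : R := c * (`|tau1| + `|tau2|) + 1.
have m0 : 0 < m by rewrite ltr_wpDl// mulr_ge0 ?addr_ge0// ltW.
have mc : `|tau1| + `|tau2| < m / c by rewrite ltr_pdivlMr// mulrC ltrDl.
have mc' : `|tau1| + `|tau2| < (m + 1) / c.
  by apply: lt_trans mc _; rewrite ltr_pM2r ?invr_gt0// ltrDl.
have h11 : - tau1 < m / c by lra.
have h12 : - tau1 < (m + 1) / c by lra.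
have h21 : - - tau2 < m / c by rewrite opprK; lra.
have h22 : - - tau2 < (m + 1) / c by rewrite opprK; lra.
have m10 : 0 < m + 1 by lra.
have [A11 p11 b11] := hfun_growth sigma x1 m0 h11.
have [A12 p12 b12] := hfun_growth sigma x1 m10 h12.
have [A21 p21 b21] := hfun_growth sigma x2 m0 h21.
have [A22 p22 b22] := hfun_growth sigma x2 m10 h22.
have up (u v k y : R) : 0 <= v -> `|y| <= u * expR k -> `|y| <= (u + v) * expR k.
  by move=> v0 /le_trans; apply; rewrite ler_wpM2r ?expR_ge0// lerDl.
have up' (u v k y : R) : 0 <= u -> `|y| <= v * expR k -> `|y| <= (u + v) * expR k.
  by move=> v0 /le_trans; apply; rewrite ler_wpM2r ?expR_ge0// lerDr.
have s1E : - (- tau2) = tau2 by rewrite opprK.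
have cn0 : c != 0 by rewrite gt_eqF.
(* One factor [c^-1] comes from rescaling [w], the other from [airys_convolution] with [k = c]; the
   arguments combine through [c a = 2 sigma]. *)
have conv x z : I (fun w => h1 (x + w) * h2 (z - w)) = c^-1 ^+ 2 * g (x + z).
  pose B1 := x1 + sigma + c * x; pose B2 := x2 + sigma + c * z.
  have HE w : h1 (x + w) * h2 (z - w) = airys tau1 (B1 + c * w) * airys (- tau2) (B2 - c * w).
    by rewrite h1E h2E /hfun /B1 /B2 (mulrBr c z w) (mulrDr c x w) (addrA _ (c * x)) (addrA _ (c * z)).
  rewrite (I_ext HE) (I_scale c0 (J_airys_product tau1 (- tau2) B1 B2)).
  rewrite (airys_convolution _ _ _ _ c0 (@cbrt2_cube R)) mulrA -expr2 /g; congr (_ * airys _ _).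
  have -> : B1 + B2 = c * (a + (x + z)) + (x1 + x2).
    by rewrite /B1 /B2 mulrDr cbrt2_sigma_tilde; ring.
  by rewrite mulrDr mulKf.
have [JW EW] : J (fun w => (h1 w + star p h1 w) * star q h2 (- w)) /\
    I (fun w => (h1 w + star p h1 w) * star q h2 (- w)) = c^-1 ^+ 2 * I (fun z => q z * (g z + star p g z)).
  apply: (@whole_line_correlation R p q h1 h2 g P Q (A11 + A12) (A21 + A22) m (c^-1 ^+ 2) dp dq m0
    _ _ (addr_ge0 p11 p12) (addr_ge0 p21 p22) _ _ _ _ conv K mg dg).
  - by rewrite h1E; exact: mf_hfun.
  - by rewrite h2E; exact: mf_hfun.
  - by move=> x; rewrite h1E; exact: up.
  - by move=> x; rewrite h1E; exact: up'.
  - by move=> x; rewrite h2E; exact: up.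
  - by move=> x; rewrite h2E; exact: up'.
split; first exact: JW.
rewrite EW mulrA (@calC_halfE (tau1 - tau2) (x1 + x2) g erefl); congr (_ * _).
by rewrite expr2 mulrA mulfV// mul1r.
Qed.

End CorrelationKernel.

(** * The functions hatQ and 1 - hatP as Laplace transforms *)

Section LaplaceForms.
Context {R : realType}.
Local Notation C := R[i].
Variable sigma : R.
Hypothesis sigma_gt0 : 0 < sigma.

Local Notation c := (@cbrt2 R).
Local Notation a := (sigma_tilde sigma).
Local Notation t := (airy_shift a).
Local Notation q := (qker t).
Local Notation p := (pker t).
Local Notation A := (fun x : R => airy (a + x)).
Local Notation b := (@airy_bound R).

Let a0 : 0 <= a := sigma_tilde_ge0 sigma_gt0.
Let dt := dec_airy_shift a0.
Let C2 := @airy_bound_lt2 R.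
Let c0 : 0 < c := @cbrt2_gt0 R.

Lemma CI_calQ (G : R -> C) : Cmf (fun x => G (a + x)) -> CJ (fun x => (q x)%:C * G (a + x)) ->
  cintegral `]a, +oo[ (fun kappa => (calQ sigma kappa)%:C * G kappa) = CI (fun x => (q x)%:C * G (a + x)).
Proof.
move=> [m1 m2] [J1 J2]; rewrite cint_oy !CIE; congr (_ +i* _).
  rewrite (I_ext (g := fun x => pos (x - a) * (calQ sigma x * complex.Re (G x)))); last by move=> x; rewrite !Re_realM.
  have ReE x : complex.Re ((q x)%:C * G (a + x)) = q x * complex.Re (G (a + x)) by rewrite Re_realM.
  rewrite (I_ext ReE); apply: (@I_KAi_resolvent R a a0 b (@airy R) dt (fun x => complex.Re (G x))) => //.
  exact: J_ext ReE J1.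
rewrite (I_ext (g := fun x => pos (x - a) * (calQ sigma x * complex.Im (G x)))); last by move=> x; rewrite !Im_realM.
have ImE x : complex.Im ((q x)%:C * G (a + x)) = q x * complex.Im (G (a + x)) by rewrite Im_realM.
rewrite (I_ext ImE); apply: (@I_KAi_resolvent R a a0 b (@airy R) dt (fun x => complex.Im (G x))) => //.
exact: J_ext ImE J2.
Qed.

(** The factor [e^(-2 sigma z)], which stems from [c a = 2 sigma], is what later turns [cubic_minus]
    into an Airy exponent. *)
Lemma hatQE (m s : R) : 0 < m ->
  hatQ sigma (- (m +i* s)) = cexp (- (2 * sigma)%:C * (m +i* s)) * lap c 0 q (m +i* s).
Proof.
move=> m0; have [Q dq] := dec_q dt C2; have Jl := CJ_lap c0 m0 dq s.
have E x : (q x)%:C * cexp ((c * (a + x))%:C * - (m +i* s)) =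
    cexp (- (2 * sigma)%:C * (m +i* s)) * ((q x)%:C * cexp (- (c * x)%:C * (m +i* s))).
  rewrite [RHS]mulrCA -cexpD; congr (_ * cexp _).
  by rewrite (mulrDr c) cbrt2_sigma_tilde (rcD (2 * sigma)) mulrN mulrDl opprD !mulNr.
rewrite /hatQ (@CI_calQ (fun kappa => cexp ((c * kappa)%:C * - (m +i* s)))).
- by rewrite (CI_ext E) CIZ// /lap add0r.
- by apply: Cmf_exp; apply: CmfM; [apply: Cmf_real; mf_tac|exact: Cmf_cst].
- by apply: CJ_ext (CJZ _ Jl) => x; rewrite E.
Qed.

(** Integrating over [kappa] first produces [p = T q], and the constant 1 becomes the atom at 0. *)
Lemma hatPE (m s : R) : 0 < m -> 1 - hatP sigma (m +i* s) = lap c 1 p (m +i* s).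
Proof.
move=> m0; have [Q dq] := dec_q dt C2; have [P dp] := dec_p dt C2.
have mq := dq.1; have mairy := @mf_airys R 0; have b0 : 0 <= b := dec_ge0 dt.
set z := m +i* s.
pose F x y := (pos y)%:C * (cexp (- (c * y)%:C * z) * (airy (a + x + y))%:C).
have me : Cmf (fun y => cexp (- (c * y)%:C * z)).
  by apply: Cmf_exp; apply: CmfM; [apply: CmfN; apply: Cmf_real; mf_tac|exact: Cmf_cst].
have mF : Cmf (fun u : R * R => F u.1 u.2).
  apply: CmfM; first by apply: Cmf_real; mf_tac.
  apply: CmfM; first by apply: (Cmf_comp me); mf_tac.
  apply: Cmf_real; apply: (mf_comp mairy); apply: mfD; last exact: mf_snd.
  by apply: mfD; [exact: mf_cst|exact: mf_fst].
have Fb x y : 0 < x -> cn (F x y) <= b * wt y.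
  move=> x0; rewrite /F cnM cn_real (ger0_norm (pos_ge0 _)).
  case: (ltP 0 y) => y0; last by rewrite (pos0 y0) (wt_neg y0) mul0r mulr0.
  rewrite /wt (pos1 y0) !mul1r cnM cn_real -[leRHS]mul1r; apply: ler_pM; rewrite ?cn_ge0//.
    rewrite cn_cexp -expR0 ler_expR /= oppr0 mul0r subr0 mulNr oppr_le0.
    by rewrite !mulr_ge0// ltW.
  apply: le_trans (airy_le _) _; rewrite ler_wpM2l// ler_expR lerN2 lerDr.
  by rewrite addr_ge0// ltW.
have Jw : J (fun y => b * wt y) by apply: JZ; exact: J_wt.
have Jq : J (fun x => Q * wt x) by apply: JZ; exact: J_wt.
have qFb x y : cn ((q x)%:C * F x y) <= Q * wt x * (b * wt y).
  rewrite cnM cn_real; case: (ltP 0 x) => x0; last by rewrite (dec_neg dq x0) (wt_neg x0) normr0 mulr0 !mul0r.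
  by apply: ler_pM; rewrite ?cn_ge0//; [exact: dq.2|exact: Fb].
have mqF : Cmf (fun u : R * R => (q u.1)%:C * F u.1 u.2).
  by apply: CmfM => //; apply: Cmf_real; apply: (mf_comp mq); mf_tac.
pose G kappa := cintegral `[0, +oo[ (fun y => cexp (- (c * y)%:C * z) * (airy (kappa + y))%:C).
have mGi kappa : Cmf (fun y => cexp (- (c * y)%:C * z) * (airy (kappa + y))%:C).
  apply: CmfM; first exact: me.
  by apply: Cmf_real; apply: (mf_comp mairy); apply: mfD; [exact: mf_cst|exact: mf_id].
have GE x : G (a + x) = CI (F x).
  exact: (cint_cy (mGi (a + x))).
have mG : Cmf (fun x => G (a + x)) by rewrite (funext GE); exact: (Cmf_CI mF).
have CJF x : 0 < x -> CJ (F x).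
  by move=> x0; apply: CJ_dom (Cmf_section1 x mF) (fun y => Fb x y x0) Jw.
have qG x : (q x)%:C * G (a + x) = CI (fun y => (q x)%:C * F x y).
  rewrite GE; case: (ltP 0 x) => x0; first by rewrite CIZ//; exact: CJF.
  rewrite (dec_neg dq x0) mul0r; symmetry.
  rewrite (CI_ext (g := fun=> (0 : R)%:C)); last by move=> y; rewrite mul0r.
  by rewrite CI_real I0.
have JqG : CJ (fun x => (q x)%:C * G (a + x)).
  apply: (@CJ_dom _ _ (fun x => 2 * (Q * wt x * b))); last by apply: JZ; exact: JZr.
    by apply: CmfM => //; exact: Cmf_real.
  move=> x; rewrite qG; have -> : Q * wt x * b = I (fun y => Q * wt x * (b * wt y)).
    by rewrite IZ// IZ ?I_wt ?mulr1//; exact: J_wt.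
  by apply: cn_CI_le; [exact: (Cmf_section1 x (F := fun x y => (q x)%:C * F x y) mqF)|exact: qFb|exact: JZ].
rewrite /hatP -/z opprK -/G (CI_calQ mG JqG) (CI_ext qG) (Cfubini_prod mqF Jq Jw qFb) /lap.
congr (_ + _); apply: CI_ext => y.
have -> : p y = pos y * star q A y by rewrite /pker -(tr_star_shift a dq) trE.
rewrite starE rcM -CI_real -mulrA [_ * cexp _]mulrC mulrA -CIZ.
  by apply: CI_ext => x; rewrite /F rcM -[a + x + y]addrA; ring.
apply: CJ_real; apply: (@J_dom _ _ (fun x => Q * wt x * (b * expR (- (a + y))))); [|move=> x|exact: JZr].
  apply: (mfM mq); apply: (mf_comp mairy); apply: mfD; first exact: mf_cst.
  by apply: mfD; [exact: mf_id|exact: mf_cst].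
case: (ltP 0 x) => x0; last by rewrite (dec_neg dq x0) (wt_neg x0) mulr0 !mul0r normr0.
rewrite normrM; apply: ler_pM => //; first exact: dq.2.
apply: le_trans (airy_le _) _; rewrite ler_wpM2l// ler_expR lerN2 lerD2l lerDr ltW//.
Qed.

End LaplaceForms.

(** * From double line integrals to half-line pairings *)

Section DoubleLine.
Context {R : realType}.
Local Notation C := R[i].
Local Notation c := (@cbrt2 R).
Let c0 : 0 < c := @cbrt2_gt0 R.

(** The switch is on for a line in the left half-plane, which is replaced by its image under
    [z |-> - z]. *)
Definition sgb (d : bool) (x : R) : R := if d then - x else x.

Lemma CI_sgb d (f : R -> C) : CJ f -> CI (fun x => f (sgb d x)) = CI f.
Proof. by case: d => // /CI_opp. Qed.

Lemma CJ_sgb d (f : R -> C) : CJ f -> CJ (fun x => f (sgb d x)).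
Proof. by case: d => // /CJ_opp. Qed.

Lemma I_scaleE (k : R) (f : R -> R) : 0 < k -> J f -> I f = k * I (fun x => f (k * x)).
Proof. by move=> k0 Jf; rewrite (I_scale k0 Jf) mulrA mulfV ?gt_eqF// mul1r. Qed.

(** The two factors [i] of the parametrisations cancel the sign of [(2 pi i)^2], and reflecting a
    parameter that runs over the whole line changes nothing. *)
Lemma double_lineE (cu cv eps : R) (d1 d2 : bool) (F : C -> C -> C) (G : R -> R -> C) :
  (forall u, CJ (G u)) -> CJ (fun u => CI (G u)) ->
  (forall u v, F (cu +i* u) (cv +i* v) = eps%:C * G (sgb d1 u) (sgb d2 v)) ->
  double_line_integral cu cv F = eps%:C * (((2 * pi) ^+ 2)%:C^-1 * CI (fun u => CI (G u))).
Proof.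
move=> j1 j2 FE.
have inner u : CI (fun v => F (cu +i* u) (cv +i* v) * 'i) = 'i * eps%:C * CI (G (sgb d1 u)).
  rewrite -(CI_sgb d2 (j1 _)) -CIZ; last exact: CJ_sgb.
  by apply: CI_ext => v; rewrite FE; ring.
have ii : 'i * 'i = -1 :> C by rewrite -expr2 sqr_i.
rewrite /double_line_integral /line_integral.
have -> : cintegral setT (fun u => cintegral setT (fun v => F (cu +i* u) (cv +i* v) * 'i) * 'i) =
    CI (fun u => 'i * eps%:C * CI (G (sgb d1 u)) * 'i).
  by apply: CI_ext => u; rewrite -inner.
rewrite CIZr; last by apply: CJZ; exact: (CJ_sgb d1 j2).
rewrite CIZ; last exact: (CJ_sgb d1 j2).
rewrite (CI_sgb d1 j2) /two_pi_i.
have -> : ((2 * pi)%:C * 'i) ^+ 2 = - ((2 * pi) ^+ 2)%:C :> C.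
  by rewrite exprMn rmorphXn [X in _ * X]expr2 ii mulrN1.
move: (CI _) => X; rewrite invrN.
have -> : 'i * eps%:C * X * 'i = - (eps%:C * X).
  have -> : 'i * eps%:C * X * 'i = ('i * 'i) * (eps%:C * X) by ring.
  by rewrite ii mulN1r.
by rewrite mulrNN mulrCA.
Qed.

Variables (sigma s1 m1 e1 M1 s2 m2 e2 M2 r1 r2 : R) (k1 k2 : R -> R).
Hypotheses (m1_gt0 : 0 < m1) (sm1 : - s1 < m1) (dk1 : dec M1 k1).
Hypotheses (m2_gt0 : 0 < m2) (sm2 : - s2 < m2) (dk2 : dec M2 k2).
Hypothesis r_gt0 : 0 < r1 * m1 + r2 * m2.

Local Notation pr x1 x2 := (pair_integrand c s1 (x1 + sigma) m1 e1 s2 (x2 + sigma) m2 e2 r1 r2 k1 k2).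

(** The correlation of [e delta_0 + k] with an Airy function. *)
Definition rshift (e : R) (k : R -> R) (s x w : R) : R :=
  e * hfun sigma s x w + star k (hfun sigma s x) w.

(** When [r1] or [r2] is -1, the corresponding factor is evaluated on the negative axis. *)
Definition pairing (x1 x2 : R) : R :=
  I (fun w => pos w * (rshift e1 k1 s1 x1 (r1 * w) * rshift e2 k2 s2 x2 (r2 * w))).

Let lap_valueE e k s x w : lap_value c s (x + sigma) e k (c * w) = rshift e k s x w.
Proof.
have hE y : airys s (x + sigma + c * w + c * y) = hfun sigma s x (y + w).
  by rewrite /hfun -addrA -mulrDr [w + y]addrC.
rewrite /lap_value /rshift starE.
have -> : (fun y => k y * airys s (x + sigma + c * w + c * y)) = fun y => k y * hfun sigma s x (y + w).
  by apply/funext => y; rewrite hE.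
by [].
Qed.

Let pairingE x1 x2 w : pos (c * w) * (lap_value c s1 (x1 + sigma) e1 k1 (r1 * (c * w)) *
    lap_value c s2 (x2 + sigma) e2 k2 (r2 * (c * w))) =
  pos w * (rshift e1 k1 s1 x1 (r1 * w) * rshift e2 k2 s2 x2 (r2 * w)).
Proof. by rewrite (pos_scale _ c0) ![_ * (c * w)]mulrCA !lap_valueE. Qed.

Lemma CI_pairing x1 x2 : CI (fun t => CI (pr x1 x2 t)) = ((2 * pi) ^+ 2)%:C * (c * pairing x1 x2)%:C.
Proof.
have Jp := J_pair_value c0 (x1 + sigma) e1 (x2 + sigma) e2 m1_gt0 sm1 dk1 m2_gt0 sm2 dk2 r_gt0.
rewrite (CI_pair c0 (x1 + sigma) e1 (x2 + sigma) e2 m1_gt0 sm1 dk1 m2_gt0 sm2 dk2 r_gt0).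
rewrite (I_scaleE c0 Jp) (I_ext (pairingE x1 x2)).
by [].
Qed.

Lemma double_line_pair (x1 x2 eps cu cv : R) (d1 d2 : bool) (F : C -> C -> C) :
  (forall u v, F (cu +i* u) (cv +i* v) =
    eps%:C * (pr x1 x2 (sgb d1 u) (sgb d2 v) + pr (- x1) (- x2) (sgb d1 u) (sgb d2 v))) ->
  double_line_integral cu cv F = (eps * (c * (pairing x1 x2 + pairing (- x1) (- x2))))%:C.
Proof.
move=> FE.
have j1 y1 y2 u : CJ (pr y1 y2 u) := CJ_pair c0 s1 (y1 + sigma) e1 (y2 + sigma) e2 dk1 m2_gt0 sm2 dk2 r_gt0 u.
have j2 y1 y2 : CJ (fun u => CI (pr y1 y2 u)) :=
  CJ_pair2 c0 (y1 + sigma) e1 (y2 + sigma) e2 m1_gt0 sm1 dk1 m2_gt0 sm2 dk2 r_gt0.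
have S u : CI (fun v => pr x1 x2 u v + pr (- x1) (- x2) u v) = CI (pr x1 x2 u) + CI (pr (- x1) (- x2) u).
  exact: CID (j1 _ _ _) (j1 _ _ _).
have jS : CJ (fun u => CI (fun v => pr x1 x2 u v + pr (- x1) (- x2) u v)).
  by rewrite (funext S); exact: CJD (j2 _ _) (j2 _ _).
rewrite (double_lineE (fun u => CJD (j1 _ _ u) (j1 _ _ u)) jS FE) (funext S) (CID (j2 _ _) (j2 _ _)) !CI_pairing.
have tp0 : ((2 * pi) ^+ 2)%:C != 0 :> C by rewrite fmorph_eq0 expf_neq0// mulf_neq0 ?pnatr_eq0// gt_eqF ?pi_gt0.
rewrite -mulrDr -rcD -mulrDr [RHS]rcM; congr (_ * _).
exact: mulKf.
Qed.

End DoubleLine.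

(** * The four double contour integrals *)

Section ContourTerms.
Context {R : realType}.
Local Notation C := R[i].
Variable sigma : R.
Hypothesis sigma_gt0 : 0 < sigma.

Local Notation c := (@cbrt2 R).
Local Notation a := (sigma_tilde sigma).
Local Notation t := (airy_shift a).
Local Notation q := (qker t).
Local Notation p := (pker t).

Lemma tacE_split (xi1 xi2 : R) (u v : C) : tacE xi1 xi2 u v =
  cexp (xi1%:C * u) * cexp (- (xi2%:C * v)) + cexp ((- xi1)%:C * u) * cexp (- ((- xi2)%:C * v)).
Proof.
rewrite /tacE -!cexpD !rmorphN /= !mulNr opprK; congr (_ + cexp _).
by rewrite addrC.
Qed.

Lemma cubic_plusE (tau xi : R) (z : C) :
  cubic_plus sigma tau z * cexp (xi%:C * z) = airy_integrand tau (- xi + sigma) z.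
Proof.
rewrite /cubic_plus /airy_integrand -cexpD; congr cexp.
by rewrite rcD rmorphN /=; ring.
Qed.

Lemma cubic_plusVE (tau xi : R) (z : C) :
  (cubic_plus sigma tau (- z))^-1 * cexp (- (xi%:C * - z)) = airy_integrand (- tau) (- xi + sigma) z.
Proof.
rewrite /cubic_plus /airy_integrand -cexpN -cexpD; congr cexp.
by rewrite rcD !rmorphN /=; field.
Qed.

Lemma cubic_minusE (tau xi : R) (z : C) :
  cubic_minus sigma tau (- z) * cexp (xi%:C * - z) * cexp (- (2 * sigma)%:C * z) =
  airy_integrand tau (xi + sigma) z.
Proof.
rewrite /cubic_minus /airy_integrand -!cexpD; congr cexp.
by rewrite (rcD xi) (rcM 2) (_ : (2 : R)%:C = 2); [field|rewrite rmorph_nat].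
Qed.

Lemma cubic_minusVE (tau xi : R) (z : C) :
  (cubic_minus sigma tau z)^-1 * cexp (- (xi%:C * z)) * cexp (- (2 * sigma)%:C * z) =
  airy_integrand (- tau) (xi + sigma) z.
Proof.
rewrite /cubic_minus /airy_integrand -cexpN -!cexpD; congr cexp.
by rewrite (rcD xi) (rcM 2) rmorphN /= (_ : (2 : R)%:C = 2); [field|rewrite rmorph_nat].
Qed.

Variables (tau1 xi1 tau2 xi2 : R).

Section Pointwise.
Variables (z w L1 L2 : C).
Local Notation e x := (cexp (- (2 * sigma)%:C * x)).

Let one : (1 : R)%:C = 1 :> C. Proof. by []. Qed.
Let mone : (- 1 : R)%:C = - 1 :> C. Proof. exact: rmorphN1. Qed.

Lemma term1_integrand :
  cubic_plus sigma tau1 z / cubic_plus sigma tau2 (- w) * tacE xi1 xi2 z (- w) * (L1 * L2 / (z + w)) =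
  airy_integrand tau1 (- xi1 + sigma) z * L1 * (airy_integrand (- tau2) (- xi2 + sigma) w * L2) /
    (1%:C * z + 1%:C * w) +
  airy_integrand tau1 (- - xi1 + sigma) z * L1 * (airy_integrand (- tau2) (- - xi2 + sigma) w * L2) /
    (1%:C * z + 1%:C * w).
Proof.
rewrite -(cubic_plusE tau1 xi1) -(cubic_plusE tau1 (- xi1)) -(cubic_plusVE tau2 xi2) -(cubic_plusVE tau2 (- xi2)).
rewrite one [1 * z]mul1r [1 * w]mul1r tacE_split.
move: (cubic_plus _ _ _) (cubic_plus _ _ _)^-1 (cexp _) (cexp _) (cexp _) (cexp _) (z + w)^-1 => X Y e1 e2 e3 e4 D.
by ring.
Qed.

Lemma term2_integrand :
  cubic_plus sigma tau1 z / cubic_minus sigma tau2 w * tacE xi1 xi2 z w * (L1 * (e w * L2) / (z - w)) =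
  airy_integrand tau1 (- xi1 + sigma) z * L1 * (airy_integrand (- tau2) (xi2 + sigma) w * L2) /
    (1%:C * z + (- 1)%:C * w) +
  airy_integrand tau1 (- - xi1 + sigma) z * L1 * (airy_integrand (- tau2) (- xi2 + sigma) w * L2) /
    (1%:C * z + (- 1)%:C * w).
Proof.
rewrite -(cubic_plusE tau1 xi1) -(cubic_plusE tau1 (- xi1)) -(cubic_minusVE tau2 xi2) -(cubic_minusVE tau2 (- xi2)).
rewrite one mone [1 * z]mul1r [-1 * w]mulN1r tacE_split.
move: (cubic_plus _ _ _) (cubic_minus _ _ _)^-1 (cexp _) (cexp _) (cexp _) (cexp _) (cexp _) (z - w)^-1 => X Y e0 e1 e2 e3 e4 D.
by ring.
Qed.

Lemma term3_integrand :
  cubic_minus sigma tau1 (- z) / cubic_plus sigma tau2 (- w) * tacE xi1 xi2 (- z) (- w) *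
    (L2 * (e z * L1) / (- z + w)) =
  airy_integrand tau1 (xi1 + sigma) z * L1 * (airy_integrand (- tau2) (- xi2 + sigma) w * L2) /
    ((- 1)%:C * z + 1%:C * w) +
  airy_integrand tau1 (- xi1 + sigma) z * L1 * (airy_integrand (- tau2) (- - xi2 + sigma) w * L2) /
    ((- 1)%:C * z + 1%:C * w).
Proof.
rewrite -(cubic_minusE tau1 xi1) -(cubic_minusE tau1 (- xi1)) -(cubic_plusVE tau2 xi2) -(cubic_plusVE tau2 (- xi2)).
rewrite one mone [-1 * z]mulN1r [1 * w]mul1r tacE_split.
move: (cubic_minus _ _ _) (cubic_plus _ _ _)^-1 (cexp _) (cexp _) (cexp _) (cexp _) (cexp _) (- z + w)^-1 => X Y e0 e1 e2 e3 e4 D.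
by ring.
Qed.

Lemma term4_integrand :
  cubic_minus sigma tau1 (- z) / cubic_minus sigma tau2 w * tacE xi1 xi2 (- z) w *
    (e z * L1 * (e w * L2) / (- z - w)) =
  - (airy_integrand tau1 (xi1 + sigma) z * L1 * (airy_integrand (- tau2) (xi2 + sigma) w * L2) /
    (1%:C * z + 1%:C * w) +
  airy_integrand tau1 (- xi1 + sigma) z * L1 * (airy_integrand (- tau2) (- xi2 + sigma) w * L2) /
    (1%:C * z + 1%:C * w)).
Proof.
rewrite -(cubic_minusE tau1 xi1) -(cubic_minusE tau1 (- xi1)) -(cubic_minusVE tau2 xi2) -(cubic_minusVE tau2 (- xi2)).
rewrite one [1 * z]mul1r [1 * w]mul1r -opprD invrN tacE_split.
move: (cubic_minus _ _ _) (cubic_minus _ _ _)^-1 (cexp _) (cexp _) (cexp _) (cexp _) (cexp _) (cexp _) (z + w)^-1 => X Y e0 e0' e1 e2 e3 e4 D.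
by ring.
Qed.

End Pointwise.

Variable delta : R.
Hypotheses (d0 : 0 < delta) (d1 : - tau1 < delta) (d2 : tau2 < delta).

Let dt := dec_airy_shift (sigma_tilde_ge0 sigma_gt0).
Let C2 := @airy_bound_lt2 R.
Let dd0 : 0 < 2 * delta. Proof. by rewrite mulr_gt0. Qed.
Let sm1 : - tau1 < delta := d1.
Let sm1' : - tau1 < 2 * delta. Proof. by have := d1; have := d0; lra. Qed.
Let sm2 : - - tau2 < delta. Proof. by rewrite opprK. Qed.
Let sm2' : - - tau2 < 2 * delta. Proof. by rewrite opprK; have := d2; have := d0; lra. Qed.

Let lineN (m y : R) : - m +i* y = - (m +i* - y) :> C.
Proof. by apply/eqP; rewrite eq_complex /= opprK !eqxx. Qed.

Lemma term1E : double_line_integral delta (- delta) (fun u v =>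
      cubic_plus sigma tau1 u / cubic_plus sigma tau2 v * tacE xi1 xi2 u v *
      ((1 - hatP sigma u) * (1 - hatP sigma (- v)) / (u - v))) =
  (1 * (c * (pairing sigma tau1 1 (- tau2) 1 1 1 p p (- xi1) (- xi2) +
             pairing sigma tau1 1 (- tau2) 1 1 1 p p (- - xi1) (- - xi2))))%:C.
Proof.
have [P dp] := dec_p dt C2.
apply: (@double_line_pair _ sigma tau1 delta 1 P (- tau2) delta 1 P 1 1 p p d0 sm1 dp d0 sm2 dp
  _ (- xi1) (- xi2) 1 _ _ false true).
  by rewrite !mul1r addr_gt0.
move=> u v; rewrite (lineN delta v) [- - (delta +i* - v)]opprK /sgb; move: (- v) => {}v.
have step (z w L1 L2 : C) : 1 - hatP sigma z = L1 -> 1 - hatP sigma w = L2 ->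
    cubic_plus sigma tau1 z / cubic_plus sigma tau2 (- w) * tacE xi1 xi2 z (- w) *
      ((1 - hatP sigma z) * (1 - hatP sigma w) / (z + w)) =
    airy_integrand tau1 (- xi1 + sigma) z * L1 * (airy_integrand (- tau2) (- xi2 + sigma) w * L2) /
      (1%:C * z + 1%:C * w) +
    airy_integrand tau1 (- - xi1 + sigma) z * L1 * (airy_integrand (- tau2) (- - xi2 + sigma) w * L2) /
      (1%:C * z + 1%:C * w).
  by move=> <- <-; exact: term1_integrand.
apply: etrans (step _ _ _ _ (hatPE sigma_gt0 u d0) (hatPE sigma_gt0 v d0)) _.
by rewrite [RHS]mul1r.
Qed.

Lemma term2E : double_line_integral (2 * delta) delta (fun u v =>
      cubic_plus sigma tau1 u / cubic_minus sigma tau2 v * tacE xi1 xi2 u v *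
      ((1 - hatP sigma u) * hatQ sigma (- v) / (u - v))) =
  (1 * (c * (pairing sigma tau1 1 (- tau2) 0 1 (- 1) p q (- xi1) xi2 +
             pairing sigma tau1 1 (- tau2) 0 1 (- 1) p q (- - xi1) (- xi2))))%:C.
Proof.
have [P dp] := dec_p dt C2; have [Q dq] := dec_q dt C2.
apply: (@double_line_pair _ sigma tau1 (2 * delta) 1 P (- tau2) delta 0 Q 1 (- 1) p q dd0 sm1' dp d0 sm2 dq
  _ (- xi1) xi2 1 _ _ false false).
  by have := d0; lra.
move=> u v; rewrite (hatPE sigma_gt0 u dd0) (hatQE sigma_gt0 v d0).
by rewrite term2_integrand [RHS]mul1r.
Qed.

Lemma term3E : double_line_integral (- delta) (- (2 * delta)) (fun u v =>
      cubic_minus sigma tau1 u / cubic_plus sigma tau2 v * tacE xi1 xi2 u v *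
      ((1 - hatP sigma (- v)) * hatQ sigma u / (u - v))) =
  (1 * (c * (pairing sigma tau1 0 (- tau2) 1 (- 1) 1 q p xi1 (- xi2) +
             pairing sigma tau1 0 (- tau2) 1 (- 1) 1 q p (- xi1) (- - xi2))))%:C.
Proof.
have [P dp] := dec_p dt C2; have [Q dq] := dec_q dt C2.
apply: (@double_line_pair _ sigma tau1 delta 0 Q (- tau2) (2 * delta) 1 P (- 1) 1 q p d0 sm1 dq dd0 sm2' dp
  _ xi1 (- xi2) 1 _ _ true true).
  by have := d0; lra.
move=> u v; rewrite (lineN delta u) (lineN (2 * delta) v) [- - (2 * delta +i* - v)]opprK.
rewrite (hatPE sigma_gt0 (- v) dd0) (hatQE sigma_gt0 (- u) d0).
by rewrite term3_integrand [RHS]mul1r.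
Qed.

(** The factor -1 comes from the denominator: with [u = - z] and [v = w] one has
    [u - v = - (z + w)]. *)
Lemma term4E : double_line_integral (- delta) delta (fun u v =>
      cubic_minus sigma tau1 u / cubic_minus sigma tau2 v * tacE xi1 xi2 u v *
      (hatQ sigma u * hatQ sigma (- v) / (u - v))) =
  (- 1 * (c * (pairing sigma tau1 0 (- tau2) 0 1 1 q q xi1 xi2 +
             pairing sigma tau1 0 (- tau2) 0 1 1 q q (- xi1) (- xi2))))%:C.
Proof.
have [P dp] := dec_p dt C2; have [Q dq] := dec_q dt C2.
apply: (@double_line_pair _ sigma tau1 delta 0 Q (- tau2) delta 0 Q 1 1 q q d0 sm1 dq d0 sm2 dq
  _ xi1 xi2 (- 1) _ _ true false).
  by rewrite !mul1r addr_gt0.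
move=> u v; rewrite (lineN delta u) (hatQE sigma_gt0 (- u) d0) (hatQE sigma_gt0 v d0).
have -> : (- 1 : R)%:C = - 1 :> C by exact: rmorphN1.
by rewrite term4_integrand [RHS]mulN1r.
Qed.

End ContourTerms.

(** * Assembly of the contour terms *)

Section HalfLineSplit.
Context {R : realType}.
Implicit Types f g k h W : R -> R.

Lemma pos_star_product P k f g w : dec P k ->
  pos w * (star k f w * star k g w) = tr (star k (tr f)) w * tr (star k (tr g)) w.
Proof.
move=> d; rewrite !trE; case: (ltP 0 w) => w0; last by rewrite (pos0 w0) !mul0r.
by rewrite (pos1 w0) !mul1r !(star_tr _ d (ltW w0)).
Qed.

Lemma pos_shift_product P k f g w : dec P k ->
  pos w * ((f w + star k f w) * (g w + star k g w)) =
  (tr f w + tr (star k (tr f)) w) * (tr g w + tr (star k (tr g)) w).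
Proof.
move=> d; rewrite !trE; case: (ltP 0 w) => w0; last by rewrite (pos0 w0) !mul0r addr0 mul0r.
by rewrite (pos1 w0) !mul1r !(star_tr _ d (ltW w0)).
Qed.

Lemma pos_star_shift P k f h w : dec P k ->
  pos w * (f w * (h w + star k h w)) = (tr h w + tr (star k (tr h)) w) * f w.
Proof.
move=> d; rewrite !trE; case: (ltP 0 w) => w0; last by rewrite (pos0 w0) !mul0r addr0 mul0r.
by rewrite (pos1 w0) !mul1r (star_tr _ d (ltW w0)) mulrC.
Qed.

Lemma pos_shift_star P k f g h w : dec P k ->
  pos w * ((f w + g w) * star k h w) = tr (star k (tr h)) w * f w + tr (star k (tr h)) w * g w.
Proof.
move=> d; rewrite !trE; case: (ltP 0 w) => w0; last by rewrite (pos0 w0) !mul0r addr0.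
by rewrite (pos1 w0) !mul1r (star_tr _ d (ltW w0)); ring.
Qed.

Lemma I_halves W : J W -> I W = I (fun w => pos w * W w) + I (fun w => pos w * W (- w)).
Proof.
move=> JW; have mW := J_mf JW.
have half (f : R -> R) : mf f -> (forall w, 0 <= f w <= 1) -> J (fun w => f w * W w).
  move=> m1 b1; apply: (@J_dom _ _ (fun w => `|W w|)); [exact: mfM|move=> w|exact: J_norm].
  by have /andP[f0 f1] := b1 w; rewrite normrM ger0_norm// ler_piMl.
have JWp : J (fun w => pos w * W w).
  by apply: half; [mf_tac|move=> w; rewrite pos_ge0 pos_le1].
have JWn : J (fun w => pos (- w) * W w).
  by apply: half; [apply: mf_pos; mf_tac|move=> w; rewrite pos_ge0 pos_le1].
have -> : I (fun w => pos w * W (- w)) = I (fun w => pos (- w) * W w).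
  by rewrite -(I_opp JWn); apply: I_ext => w; rewrite opprK.
rewrite -(ID JWp JWn); apply: I_except0 => //; first exact: J_mf (JD JWp JWn).
move=> w; case: (ltgtP w 0) => // ww _.
  by rewrite (pos0 (ltW ww)) pos1 ?oppr_gt0// mul0r add0r mul1r.
by rewrite (pos1 ww) pos0 ?oppr_le0 ?(ltW ww)// mul0r addr0 mul1r.
Qed.

(** Bookkeeping: [a1], [a2] stand for the term C, the letters [f], [b], [e], [g] for the four
    contour integrals in this order, and [t], [r] for the terms of [tacnode_core]. *)
Lemma contour_sum (h k a1 a2 b1 b2 e1 e2 f1 f2 g1 g2 r1 r2 t1 t2 : R) :
  k * a1 - k * b1 - k * e1 = - (k * r1) -> k * a2 - k * b2 - k * e2 = - (k * r2) ->
  f1 - g1 = t1 -> f2 - g2 = t2 ->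
  - h + (k * a1 + k * a2) + 1 * (k * (f2 + f1)) - 1 * (k * (b2 + b1)) - 1 * (k * (e1 + e2)) + - 1 * (k * (g1 + g2)) =
  - h + k * (t1 + t2 - r1 - r2).
Proof. by move=> e1' e2' <- <-; lra. Qed.

End HalfLineSplit.

Section ContourForm.
Context {R : realType}.
Local Notation C := R[i].
Variables (sigma tau1 tau2 : R).
Hypothesis sigma_gt0 : 0 < sigma.

Local Notation c := (@cbrt2 R).
Local Notation a := (sigma_tilde sigma).
Local Notation t := (airy_shift a).
Local Notation T := (hankel t).
Local Notation Rs := (resolvent t).
Local Notation q := (qker t).
Local Notation p := (pker t).
Local Notation h1 x := (hfun sigma tau1 x).
Local Notation h2 y := (hfun sigma (- tau2) y).

Let a0 : 0 <= a := sigma_tilde_ge0 sigma_gt0.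
Let dt := dec_airy_shift a0.
Let C2 := @airy_bound_lt2 R.
Let c0 : 0 < c := @cbrt2_gt0 R.

Let rshift1 (k : R -> R) s x w : rshift sigma 1 k s x w = hfun sigma s x w + star k (hfun sigma s x) w.
Proof. by rewrite /rshift mul1r. Qed.

Let rshift0 (k : R -> R) s x w : rshift sigma 0 k s x w = star k (hfun sigma s x) w.
Proof. by rewrite /rshift mul0r add0r. Qed.

(** The first and fourth contour integrals supply the [p] part and the [q] part of [bform]. *)
Lemma pairing_same (x y : R) :
  pairing sigma tau1 1 (- tau2) 1 1 1 p p x y - pairing sigma tau1 0 (- tau2) 0 1 1 q q x y =
  ip (Rs (tr (h1 x))) (tr (h2 y)).
Proof.
have [Q dq] := dec_q dt C2; have [P dp] := dec_p dt C2.
have [M1 d1] := dec_hfun sigma tau1 x; have [M2 d2] := dec_hfun sigma (- tau2) y.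
have e1 : pairing sigma tau1 1 (- tau2) 1 1 1 p p x y =
    ip (fun w => tr (h1 x) w + tr (star p (tr (h1 x))) w) (fun w => tr (h2 y) w + tr (star p (tr (h2 y))) w).
  by rewrite ipE; apply: I_ext => w; rewrite [1 * w]mul1r !rshift1 (pos_shift_product _ _ _ dp).
have e2 : pairing sigma tau1 0 (- tau2) 0 1 1 q q x y = ip (tr (star q (tr (h1 x)))) (tr (star q (tr (h2 y)))).
  by rewrite ipE; apply: I_ext => w; rewrite [1 * w]mul1r !rshift0 (pos_star_product _ _ _ dq).
by rewrite e1 e2 -(bformE dt C2 dq dp d1 d2).
Qed.

(** The second contour integral is the half [w > 0] of the whole-line integral from C. Subtracting
    it leaves the half [w < 0], which together with the third contour integral is the left side of
    [reflected_form]. *)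
Lemma pairing_opposite (x y : R) :
  c * I (fun w => (h1 x w + star p (h1 x) w) * star q (h2 y) (- w)) -
  c * pairing sigma tau1 1 (- tau2) 0 1 (- 1) p q x y -
  c * pairing sigma tau1 0 (- tau2) 1 (- 1) 1 q p x y =
  - (c * ip (Rs (T (tr (h1 x)))) (tr (h2 y))).
Proof.
have [Q dq] := dec_q dt C2; have [P dp] := dec_p dt C2.
have n1 := ler_norm (- tau1); have n2 := ler_norm (- - tau2); rewrite normrN in n1; rewrite opprK in n2.
have n10 := normr_ge0 tau1; have n20 := normr_ge0 tau2.
pose m : R := c * (`|tau1| + `|tau2|) + 1.
have m1 : 1 <= m by rewrite lerDr mulr_ge0 ?addr_ge0// ltW.
have m0 : 0 < m by lra.
have m10 : 0 < m + 1 by lra.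
have mc : `|tau1| + `|tau2| < m / c by rewrite ltr_pdivlMr// mulrC ltrDl.
have mc' : `|tau1| + `|tau2| < (m + 1) / c.
  by apply: lt_trans mc _; rewrite ltr_pM2r ?invr_gt0// ltrDl.
have h11 : - tau1 < m / c by lra.
have h22 : - - tau2 < (m + 1) / c by rewrite opprK; lra.
(* The first function gets the rate [m] and the second the rate [m + 1], as [reflected_form]
   asks. *)
have [A1 p1 b1] := hfun_growth sigma x m0 h11.
have [A2 p2 b2] := hfun_growth sigma y m10 h22.
have dg : decm (m + 1) A2 (tr (h2 y)).
  by apply: decm_tr; [exact: p2|exact: mf_hfun|move=> w _; exact: b2].
have [Ja Jb Jc E] := reflected_form dt C2 m1 p1 (mf_hfun sigma tau1 x) b1 dg.
have [JW _] := calC_whole sigma_gt0 (tau1 := tau1) (tau2 := tau2) (x1 := x) (x2 := y) erefl erefl.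
have E2 : pairing sigma tau1 1 (- tau2) 0 1 (- 1) p q x y =
    I (fun w => pos w * ((h1 x w + star p (h1 x) w) * star q (h2 y) (- w))).
  by apply: I_ext => w; rewrite [1 * w]mul1r [-1 * w]mulN1r rshift1 rshift0.
have E3 : pairing sigma tau1 0 (- tau2) 1 (- 1) 1 q p x y =
    I (fun w => (tr (h2 y) w + tr (star p (tr (h2 y))) w) * star q (h1 x) (- w)).
  apply: I_ext => w; rewrite [1 * w]mul1r [-1 * w]mulN1r rshift1 rshift0.
  exact: (pos_star_shift (fun w => star q (h1 x) (- w)) (h2 y) w dp).
have E4 : I (fun w => pos w * ((h1 x (- w) + star p (h1 x) (- w)) * star q (h2 y) (- - w))) =
    I (fun w => tr (star q (tr (h2 y))) w * h1 x (- w)) +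
    I (fun w => tr (star q (tr (h2 y))) w * star p (h1 x) (- w)).
  rewrite -(ID Ja Jb); apply: I_ext => w; rewrite opprK.
  exact: (pos_shift_star (fun w => h1 x (- w)) (fun w => star p (h1 x) (- w)) (h2 y) w dq).
have alg (k w v2 v3 i1 i2 i3 i4 i5 r : R) : w = i1 + i5 -> v2 = i1 -> v3 = i4 -> i5 = i2 + i3 ->
    i2 + i3 - i4 = - r -> k * w - k * v2 - k * v3 = - (k * r).
  by move=> -> -> -> -> e; rewrite -[RHS]mulrN -e; ring.
exact: alg (I_halves JW) E2 E3 E4 E.
Qed.

End ContourForm.

Section ContourAssembly.
Context {R : realType}.
Variables (sigma tau1 xi1 tau2 xi2 delta : R).
Hypotheses (sigma_gt0 : 0 < sigma) (d0 : 0 < delta) (d1 : - tau1 < delta) (d2 : tau2 < delta).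

Lemma tacnode_iiiE : tacnode_iii delta sigma tau1 xi1 tau2 xi2 = (tacnode_value sigma tau1 xi1 tau2 xi2)%:C.
Proof.
(* Opposite signs of [xi1] and [xi2] belong to the cross terms [R T] of the core, equal signs to the
   terms [R]. *)
have w1 := pairing_opposite tau1 tau2 sigma_gt0 xi1 (- xi2).
have w2 := pairing_opposite tau1 tau2 sigma_gt0 (- xi1) xi2.
have [_ c1] := calC_whole sigma_gt0 (tau1 := tau1) (tau2 := tau2) (x1 := xi1) (x2 := - xi2) erefl erefl.
have [_ c2] := calC_whole sigma_gt0 (tau1 := tau1) (tau2 := tau2) (x1 := - xi1) (x2 := xi2) erefl erefl.
have s1 := pairing_same tau1 tau2 sigma_gt0 xi1 xi2.
have s2 := pairing_same tau1 tau2 sigma_gt0 (- xi1) (- xi2).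
have c2' : - (xi1 - xi2) = - xi1 + xi2 by rewrite opprB addrC.
rewrite /tacnode_iii (term1E sigma_gt0 xi1 xi2 d0 d1 d2) (term2E sigma_gt0 xi1 xi2 d0 d1 d2).
rewrite (term3E sigma_gt0 xi1 xi2 d0 d1 d2) (term4E sigma_gt0 xi1 xi2 d0 d1 d2).
have -> : calC sigma (tau1 - tau2) (xi1 - xi2) = calC_half sigma (tau1 - tau2) (xi1 - xi2) +
  calC_half sigma (tau1 - tau2) (- xi1 + xi2) by rewrite /calC c2'.
rewrite c1 c2 (opprK xi1) (opprK xi2).
have -> (h x y z u v : R) : - h%:C + x%:C + y%:C - z%:C - u%:C + v%:C = (- h + x + y - z - u + v)%:C.
  by rewrite !(rmorphD, rmorphN).
congr (_%:C).
exact: contour_sum w1 w2 s1 s2.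
Qed.

End ContourAssembly.

Theorem theorem1p3 (R : realType) (sigma : R) (sigma_gt0 : 0 < sigma)
    (tau1 xi1 tau2 xi2 : R) :
  [/\ tacnode_br sigma tau1 xi1 tau2 xi2 = tacnode_i sigma tau1 xi1 tau2 xi2,
      tacnode_br sigma tau1 xi1 tau2 xi2 = tacnode_ii sigma tau1 xi1 tau2 xi2
    & forall delta : R, 0 < delta -> - tau1 < delta -> tau2 < delta ->
      (tacnode_br sigma tau1 xi1 tau2 xi2)%:C =
      tacnode_iii delta sigma tau1 xi1 tau2 xi2].
Proof.
rewrite tacnode_brE// tacnode_iE// tacnode_iiE//; split=> // delta d0 d1 d2.
by rewrite tacnode_iiiE.
Qed.
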